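(* There exist a constant $\epsilon\in(0,1]$ and an infinite family of finite bipartite graphs (with arbitrarily many vertices), each of which is a bipartite $\epsilon$-expander and is $3$-monotone (for a suitable ordering of its colour classes).
   Context: For $\epsilon\in(0,1]$, a bipartite graph $G$ with bipartition $V(G)=A\cup B$ is a bipartite $\epsilon$-expander if $|A|=|B|$ and $|N(S)|\geq(1+\epsilon)|S|$ for every subset $S\subset A$ with $|S|\leq |A|/2$, where $N(S)$ is the set of vertices adjacent to some vertex of $S$. Let $G$ be a bipartite graph with ordered colour classes $(v_1,\dots,v_n)$ and $(w_1,\dots,w_m)$. Two edges $v_iw_j$ and $v_kw_\ell$ cross if $i<k$ and $\ell<j$. A matching is monotone if no two of its edges cross. $G$ is $d$-monotone if (with respect to some ordering of its colour classes) $E(G)$ is the union of $d$ monotone matchings. *)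

(* Defs.v *)
From mathcomp Require Import all_boot all_order all_fingroup all_algebra.
Set Implicit Arguments. Unset Strict Implicit. Unset Printing Implicit Defensive.
Import Order.TTheory GRing.Theory Num.Theory.

Definition bigraph (n m : nat) := 'I_n -> 'I_m -> bool.

Definition nbhd (n m : nat) (G : bigraph n m) (S : {set 'I_n}) : {set 'I_m} :=
  [set w | [exists v in S, G v w]].

Definition bip_expander (R : numDomainType) (eps : R) (n m : nat)
    (G : bigraph n m) : Prop :=
  n = m /\
  forall S : {set 'I_n}, (#|S| * 2 <= n)%N ->
    ((1 + eps) * (#|S|%:R) <= (#|nbhd G S|%:R))%R.

Definition is_matching (n m : nat) (M : {set 'I_n * 'I_m}) : Prop :=
  forall e f, e \in M -> f \in M -> e != f -> (e.1 != f.1) && (e.2 != f.2).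

(* with respect to orderings of A and B given by the position maps pa, pb
   (vertex x is the (pa x)-th vertex of A), two edges v w and v' w' cross if
   pa v < pa v' and pb w' < pb w; a matching is monotone if no two edges cross *)
Definition is_monotone_matching (n m : nat) (pa : {perm 'I_n}) (pb : {perm 'I_m})
    (M : {set 'I_n * 'I_m}) : Prop :=
  is_matching M /\
  forall e f, e \in M -> f \in M ->
    ~ ((pa e.1 < pa f.1)%N /\ (pb f.2 < pb e.2)%N).

Definition d_monotone (d n m : nat) (G : bigraph n m) : Prop :=
  exists (pa : {perm 'I_n}) (pb : {perm 'I_m}) (Ms : 'I_d -> {set 'I_n * 'I_m}),
    (forall i, is_monotone_matching pa pb (Ms i)) /\
    (forall v w, G v w <-> exists i, (v, w) \in Ms i).

(* Main.v *)
Require Import Defs.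
From HB Require Import structures.
From mathcomp Require Import all_boot all_order all_fingroup all_algebra.
From mathcomp Require Import cyclic.
From mathcomp Require Import all_classical all_reals all_analysis measurable_realfun.
From mathcomp Require Import reals.
From mathcomp Require Import zify ring lra.
Set Implicit Arguments. Unset Strict Implicit. Unset Printing Implicit Defensive.
Import Order.TTheory GRing.Theory Num.Theory.

(** Real Moebius maps are increasing on intervals, so on [n] equal cells of [0, 1] a map close to the
    identity is covered by boundedly many monotone matchings. Fix a large prime [q] and take a set
    [S] of about [c q] integral matrices of determinant [q] that are pairwise close; the maps used
    are [g^-1 h] for [g], [h] in [S]. They act unitarily on L2(R) by [T], and the expansion comes
    from a spectral gap for their average [A] on oscillating step functions [phi] at scale [1/n],
    proved in the style of Sarnak and Xue:
    - words of length [l] in the letters of [S] and their adjugates collide rarely, since a primitive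
      matrix has at most one left divisor in [S] modulo [q]; together with the divisor bound this
      bounds the number of words close to [+-1];
    - a word is, up to a small error, a lower unipotent composed with an affine map on a grid of mesh
      [1/n^2], and a Bessel inequality for the affine translates of [phi] turns the bound on
      collisions into a bound on the norm of [A^k phi] for [q^k] about [n^4];
    - log-convexity of the moments brings this back to [A] itself, with a gain of a power of [q].
    Haar levels of different scales are almost orthogonal under [A], because a map close to the
    identity hardly moves coarse step functions; so [A] contracts everything but the mean on blocks,
    and block translations take care of the mean. This gives an expander that is [d]-monotone for
    some constant [d]. Spreading its [d] matchings over the blocks of a path, with identity matchings
    between adjacent blocks, makes it [3]-monotone. *)

(** Since [T] ignores nonzero scalar factors, the adjugate serves as inverse and all arithmetic
    stays in integral matrices. At scale [n] the group is cut into cells of side [n^-2], hence of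
    volume [n^-6]. Words of length [4k] near [+-q^(2k)] are counted up to a relative error
    [q^(-2k)], so [q^k] must reach [n^3]; the largest power of [q] below [n^4] does, as [q <= n].
    The Bessel inequality beats the trivial factor [n^6] by [v^4], where [v = n^(1/16)]: the divisor
    bound costs one [v], all constants raised to the power [k] together cost another, and [v^-2] is
    left for the squared norm. This fixes the order of choices. The closeness of [S] is absolute and
    determines the density [c]; every loss is exponential in [k], with a base depending on [c] and
    on the divisor constant but not on [q], so one large [q] absorbs them all. Only then is [d]
    known, and [n] runs over the numbers [64 q 2^J]. The gap is available for [n >= q] only, so the
    Haar levels start at the scale [64 q] and the block means need the translations. *)

Definition mat (K : Type) := (K * K * K * K)%type.
Definition ma {K} (g : mat K) := g.1.1.1.
Definition mb {K} (g : mat K) := g.1.1.2.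
Definition mc {K} (g : mat K) := g.1.2.
Definition md {K} (g : mat K) := g.2.

(** * Two by two matrices, with the adjugate in place of the inverse *)

Section mat.
Local Open Scope ring_scope.
Context (K : comNzRingType).
Implicit Types (g h : mat K).
Definition mmul g h : mat K :=
  (ma g * ma h + mb g * mc h, ma g * mb h + mb g * md h,
   mc g * ma h + md g * mc h, mc g * mb h + md g * md h).
Definition mdet g : K := ma g * md g - mb g * mc g.
Definition madj g : mat K := (md g, - mb g, - mc g, ma g).
Definition mscale (t : K) g : mat K := (t * ma g, t * mb g, t * mc g, t * md g).
Definition mone : mat K := (1, 0, 0, 1).

Lemma matP g h : ma g = ma h -> mb g = mb h -> mc g = mc h -> md g = md h -> g = h.
Proof.
move: g h => [[[a b] c] d] [[[a' b'] c'] d']; rewrite /ma /mb /mc /md /=.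
by move=> -> -> -> ->.
Qed.
Lemma mmulA g h k : mmul g (mmul h k) = mmul (mmul g h) k.
Proof. by apply: matP; rewrite /mmul /madj /mscale /mone /mdet /ma /mb /mc /md /=; ring. Qed.
Lemma mmul1m g : mmul mone g = g.
Proof. by apply: matP; rewrite /mmul /madj /mscale /mone /mdet /ma /mb /mc /md /=; ring. Qed.
Lemma mmulm1 g : mmul g mone = g.
Proof. by apply: matP; rewrite /mmul /madj /mscale /mone /mdet /ma /mb /mc /md /=; ring. Qed.
Lemma mdetM g h : mdet (mmul g h) = mdet g * mdet h.
Proof. by rewrite /mmul /madj /mscale /mone /mdet /ma /mb /mc /md /=; ring. Qed.
Lemma mdet_adj g : mdet (madj g) = mdet g.
Proof. by rewrite /mmul /madj /mscale /mone /mdet /ma /mb /mc /md /=; ring. Qed.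
Lemma madjM g h : madj (mmul g h) = mmul (madj h) (madj g).
Proof. by apply: matP; rewrite /mmul /madj /mscale /mone /mdet /ma /mb /mc /md /=; ring. Qed.
Lemma madjK g : madj (madj g) = g.
Proof. by apply: matP; rewrite /mmul /madj /mscale /mone /mdet /ma /mb /mc /md /=; ring. Qed.
Lemma mmul_adjl g : mmul (madj g) g = mscale (mdet g) mone.
Proof. by apply: matP; rewrite /mmul /madj /mscale /mone /mdet /ma /mb /mc /md /=; ring. Qed.
Lemma mmul_adjr g : mmul g (madj g) = mscale (mdet g) mone.
Proof. by apply: matP; rewrite /mmul /madj /mscale /mone /mdet /ma /mb /mc /md /=; ring. Qed.
Lemma mmulZl t g h : mmul (mscale t g) h = mscale t (mmul g h).
Proof. by apply: matP; rewrite /mmul /madj /mscale /mone /mdet /ma /mb /mc /md /=; ring. Qed.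
Lemma mmulZr t g h : mmul g (mscale t h) = mscale t (mmul g h).
Proof. by apply: matP; rewrite /mmul /madj /mscale /mone /mdet /ma /mb /mc /md /=; ring. Qed.
Lemma mdetZ t g : mdet (mscale t g) = t ^+ 2 * mdet g.
Proof. by rewrite /mmul /madj /mscale /mone /mdet /ma /mb /mc /md /=; ring. Qed.
Lemma mscaleA t s g : mscale t (mscale s g) = mscale (t * s) g.
Proof. by apply: matP; rewrite /mmul /madj /mscale /mone /mdet /ma /mb /mc /md /=; ring. Qed.
Lemma mscale1 g : mscale 1 g = g.
Proof. by apply: matP; rewrite /mmul /madj /mscale /mone /mdet /ma /mb /mc /md /=; ring. Qed.
End mat.
Arguments mone {K}.

(** * Many coprime pairs: a lower bound for sums of the totient *)

Section totient_sum.
Local Open Scope nat_scope.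

(** The totients of the divisors of [n] add up to [n]. Summing this over [n <= X] and exchanging the
    sums counts each [a] once for every multiple of it up to [X]. *)
Lemma sum_totient_div (X : nat) :
  (\sum_(1 <= a < X.+1) totient a * (X %/ a)) * 2 = X * X.+1.
Proof.
have -> : \sum_(1 <= a < X.+1) totient a * (X %/ a) =
          \sum_(1 <= n < X.+1) \sum_(1 <= a < X.+1 | a %| n) totient a.
  under [RHS]eq_bigr do rewrite big_mkcond/=.
  rewrite exchange_big_nat/=; apply: eq_big_nat => a /andP[a1 _].
  rewrite divn_count_dvd big_distrr/=.
  by apply: eq_bigr => n _; case: (a %| n); rewrite ?muln1 ?muln0.
have -> : \sum_(1 <= n < X.+1) \sum_(1 <= a < X.+1 | a %| n) totient a =
          \sum_(1 <= n < X.+1) n.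
  apply: eq_big_nat => n /andP[n1 nX].
  rewrite -[RHS]sum_totient_dvd -(big_mkord (fun d => d %| n) totient).
  rewrite [RHS]big_ltn_cond// dvd0n (gtn_eqF n1).
  rewrite (@big_cat_nat _ _ _ n.+1)//=.
  rewrite [X in _ + X]big1_seq ?addn0// => a; rewrite mem_index_iota => /andP[an /andP[na _]].
  by have := dvdn_leq n1 an; lia.
elim: X => [|X IH]; first by rewrite big_nil.
by rewrite big_nat_recr//= mulnDl IH; lia.
Qed.

(** In [sum_totient_div] a term with [8 a <= X] is at most [X], and there are at most [X / 8] of
    them, so they take at most a quarter of the total; in the other terms the quotient [X %/ a] is
    at most 7. *)
Lemma sum_totient_large (X : nat) :
  3 * X ^ 2 <= 56 * \sum_(1 <= a < X.+1 | X < 8 * a) totient a.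
Proof.
have H := sum_totient_div X.
have A : \sum_(1 <= a < X.+1) totient a * (X %/ a) <=
    7 * (\sum_(1 <= a < X.+1 | X < 8 * a) totient a) +
    \sum_(1 <= a < X.+1 | ~~ (X < 8 * a)) X.
  rewrite (bigID (fun a => X < 8 * a))/= leq_add//.
    rewrite big_distrr/=; apply: leq_sum => a Xa; rewrite mulnC leq_mul2r; apply/orP; right.
    have a0 : 0 < a by lia.
    by rewrite -ltnS ltn_divLR.
  rewrite big_nat_cond [X in _ <= X]big_nat_cond; apply: leq_sum => a /andP[/andP[a1 _] _].
  rewrite (leq_trans _ (leq_trunc_div X a))// mulnC leq_mul2l.
  rewrite totient_count_coprime; apply/orP; right.
  by rewrite -[X in _ <= X]muln1 -[in X in _ <= X](subn0 a) -sum_nat_const_nat leq_sum// => i _; case: coprime.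
have B : 8 * \sum_(1 <= a < X.+1 | ~~ (X < 8 * a)) X <= X ^ 2.
  have : \sum_(1 <= a < X.+1 | ~~ (X < 8 * a)) X <= \sum_(1 <= a < (X %/ 8).+1) X.
    rewrite -big_filter -[X in _ <= X]big_filter; have [f0|] := leqP (8 * (X %/ 8)) X; last by lia.
    rewrite [X in _ <= X]big_filter [X in X <= _]big_filter.
    rewrite (@big_cat_nat _ _ _ (X %/ 8).+1)//=; last by lia.
    rewrite [X in _ + X]big_nat_cond [X in _ + X]big_pred0 ?addn0.
      by rewrite big_mkcond/=; apply: leq_sum => a _; case: ifP.
    by move=> a; apply/negbTE/negP => /andP[/andP[a1 a2]]; lia.
  rewrite sum_nat_const_nat subn1/=; nia.
nia.
Qed.

End totient_sum.

(** * Many integral matrices of determinant [q] in one small box *)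

Section generators.
Local Open Scope ring_scope.

Definition mdvd (q : nat) (g : mat int) :=
  [&& (q %| ma g)%Z, (q %| mb g)%Z, (q %| mc g)%Z & (q %| md g)%Z].

(** The lower left entry that completes the row [(a, b)] to an integral matrix of determinant [q],
    whose last entry is then [(q + b c) / a]. *)
Definition compl (q a b : nat) := find (fun c => a %| q + b * c)%N (iota 0 a).

Lemma complP (q a b : nat) : (0 < a)%N -> coprime a b ->
  (compl q a b < a)%N /\ (a %| q + b * compl q a b)%N.
Proof.
move=> a0 ab; have [t ta] := Bezoutl b a0; rewrite (eqP ab) => td.
have h : has (fun c => a %| q + b * c)%N (iota 0 a).
  apply/hasP; exists ((t * q) %% a)%N; first by rewrite mem_iota/= ltn_pmod.
  rewrite /dvdn -modnDmr modnMmr modnDmr.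
  have -> : (q + b * (t * q) = q * (1 + t * b))%N by lia.
  by rewrite -/(dvdn _ _) dvdn_mull.
have h' : (compl q a b < a)%N by move: h; rewrite has_find size_iota.
by split=> //; have := nth_find 0%N h; rewrite nth_iota// add0n.
Qed.

Lemma pigeonhole (T : eqType) (U : finType) (f : T -> U) (s : seq T) (u0 : U) :
  exists u, (size s <= #|U| * count (fun x => f x == u) s)%N.
Proof.
have E : size s = (\sum_(u : U) count (fun x => f x == u) s)%N.
  elim: s => [|x s IH]; first by rewrite big1.
  rewrite /= big_split/= -IH -addn1 addnC; congr (_ + _)%N.
  by rewrite (bigD1 (f x))//= eqxx big1// => u; rewrite eq_sym => /negbTE ->.
case: (@arg_maxnP U u0 xpredT (fun u => count (fun x => f x == u) s) isT) => u _ M.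
exists u; rewrite E -sum_nat_const; apply: leq_sum => v _; exact: M.
Qed.

(** First rows are the coprime pairs with [X / 8 < a <= X] and [b < a]; the lower bound on [a] keeps
    the last entry [(q + b c) / a] below [33 X]. A box of side [X / D] in the four entries is then
    selected by the pigeonhole principle, which costs a factor depending on [D] alone. *)
Lemma generators_exist (D X q : nat) : (0 < D)%N -> (0 < X)%N ->
  (X ^ 2 <= q <= 4 * X ^ 2)%N ->
  exists S : seq (mat int), [/\ uniq S,
    (3 * X ^ 2 <= 56 * ((33 * D).+1 ^ 4 * size S))%N,
    (forall g, g \in S -> [/\ mdet g = q%:Z, 0 <= ma g <= 33 * X%:Z, 0 <= mb g <= 33 * X%:Z,
        0 <= mc g <= 33 * X%:Z & 0 <= md g <= 33 * X%:Z]) &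
    (forall g h, g \in S -> h \in S ->
      [/\ `|ma g - ma h| * D%:Z <= X%:Z, `|mb g - mb h| * D%:Z <= X%:Z,
          `|mc g - mc h| * D%:Z <= X%:Z & `|md g - md h| * D%:Z <= X%:Z])].
Proof.
move=> D0 X0 /andP[Xq qX].
pose pairs := [seq ab <- [seq (a, b) | a <- index_iota 1 X.+1, b <- index_iota 0 X] |
   [&& (X < 8 * ab.1)%N, (ab.2 < ab.1)%N & coprime ab.1 ab.2]].
have pairsP ab : ab \in pairs ->
    [/\ (0 < ab.1)%N, (ab.1 <= X)%N, (X < 8 * ab.1)%N, (ab.2 < ab.1)%N & coprime ab.1 ab.2].
  rewrite mem_filter => /andP[/and3P[h1 h2 h3]] /allpairsP[[a b] /= [ha hb E]].
  by move: h1 h2 h3; rewrite E/= => h1 h2 h3; move: ha; rewrite mem_index_iota => /andP[a1 a2]; split.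
have Upairs : uniq pairs.
  by apply: filter_uniq; apply: allpairs_uniq; rewrite ?iota_uniq// => -[? ?] [? ?].
have Spairs : (3 * X ^ 2 <= 56 * size pairs)%N.
  rewrite (leq_trans (sum_totient_large X))// leq_mul2l/=.
  have -> : size pairs = (\sum_(1 <= a < X.+1) \sum_(0 <= b < X)
      if [&& X < 8 * a, b < a & coprime a b] then 1 else 0)%N.
    by rewrite /pairs -sum1_size big_filter big_mkcond/= big_allpairs.
  rewrite big_mkcond/=.
  rewrite [X in (X <= _)%N]big_nat_cond [X in (_ <= X)%N]big_nat_cond.
  apply: leq_sum => a /andP[/andP[a1 aX] _]; case: ifP => // Xa.
  rewrite totient_count_coprime.
  rewrite (@big_cat_nat _ _ _ a 0 X)/=; [|lia|lia].
  rewrite (leq_trans _ (leq_addr _ _))// big_nat_cond [X in (_ <= X)%N]big_nat_cond.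
  by apply: leq_sum => b /andP[/andP[_ ba] _]; rewrite ba; case: coprime.
pose mk (ab : nat * nat) : mat int := (ab.1%:Z, ab.2%:Z, (compl q ab.1 ab.2)%:Z,
   ((q + ab.2 * compl q ab.1 ab.2) %/ ab.1)%N%:Z).
pose key1 (z : int) : 'I_(33 * D).+1 := inord (absz z * D %/ X).
pose key (g : mat int) := (key1 (ma g), key1 (mb g), key1 (mc g), key1 (md g)).
pose all := [seq mk ab | ab <- pairs].
have [k kP] := pigeonhole key all (ord0, ord0, ord0, ord0).
have allP g : g \in all -> [/\ mdet g = q%:Z, 0 <= ma g <= 33 * X%:Z, 0 <= mb g <= 33 * X%:Z,
        0 <= mc g <= 33 * X%:Z & 0 <= md g <= 33 * X%:Z].
  move=> /mapP[[a b] /pairsP[/= a0 aX Xa ba ab] ->].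
  have [ca dv] := complP q a0 ab.
  rewrite /mk /mdet /ma /mb /mc /md /=; set c := compl q a b in ca dv *.
  have E := divnK dv; set d := (_ %/ _)%N in E *.
  have d33 : (d <= 33 * X)%N by nia.
  by split; [lia|lia|lia|lia|lia].
exists [seq g <- all | key g == k]; split.
- by apply: filter_uniq; rewrite map_inj_uniq// => -[a b] [a' b'] [-> ->].
- move: kP; rewrite !card_prod !card_ord size_map -size_filter => kP.
  have -> : ((33 * D).+1 ^ 4 = (33 * D).+1 * (33 * D).+1 * (33 * D).+1 * (33 * D).+1)%N by lia.
  by rewrite (leq_trans Spairs)// leq_mul2l/=.
- by move=> g; rewrite mem_filter => /andP[_ /allP].
- move=> g h; rewrite !mem_filter => /andP[/eqP gk /allP[_ g1 g2 g3 g4]] /andP[/eqP hk /allP[_ h1 h2 h3 h4]].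
  have K (z w : int) : 0 <= z <= 33 * X%:Z -> 0 <= w <= 33 * X%:Z -> key1 z = key1 w ->
      `|z - w| * D%:Z <= X%:Z.
    move=> z1 w1 /(congr1 val); rewrite /= !inordK.
    - have := leq_trunc_div (absz z * D) X; have := leq_trunc_div (absz w * D) X.
      have := ltn_ceil (absz z * D) X0; have := ltn_ceil (absz w * D) X0.
      set u := (_ %/ _)%N; set v := (_ %/ _)%N => p1 p2 p3 p4 uv; nia.
    - by rewrite ltnS -(leq_pmul2r X0) (leq_trans (leq_trunc_div _ _))//; nia.
    - by rewrite ltnS -(leq_pmul2r X0) (leq_trans (leq_trunc_div _ _))//; nia.
  by move: hk; rewrite -gk => -[k1 k2 k3 k4]; split; apply: K.
Qed.

End generators.

(** * Left divisors of determinant [q] modulo [q] *)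

Section cosets.
Local Open Scope ring_scope.
Variables (q D X : nat).
Hypothesis q_prime : prime q.
Hypothesis X0 : (0 < X)%N.
Hypothesis Xq : (X ^ 2 <= q)%N.
Hypothesis D66 : (66 < D)%N.

Definition sized (g : mat int) := [/\ mdet g = q%:Z, `|ma g| <= 33 * X%:Z,
  `|mb g| <= 33 * X%:Z, `|mc g| <= 33 * X%:Z & `|md g| <= 33 * X%:Z].
Definition close (g h : mat int) :=
      [/\ `|ma g - ma h| * D%:Z <= X%:Z, `|mb g - mb h| * D%:Z <= X%:Z,
          `|mc g - mc h| * D%:Z <= X%:Z & `|md g - md h| * D%:Z <= X%:Z].

Lemma sized_adj g : sized g -> sized (madj g).
Proof.
rewrite /sized mdet_adj /madj /ma /mb /mc /md /= => -[-> ? ? ? ?].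
by rewrite !normrN; split.
Qed.

Lemma close_adj g h : close g h -> close (madj g) (madj h).
Proof.
rewrite /close /madj /ma /mb /mc /md /= => -[? ? ? ?].
by rewrite -!opprD !normrN; split.
Qed.

Let q0 : (0 < q)%N. Proof. exact: prime_gt0. Qed.

Lemma small_dvd (z : int) : (q %| z)%Z -> `|z| < q%:Z -> z = 0.
Proof.
move=> qz zq; apply/eqP/negPn/negP => z0.
have zp : (0 < absz z)%N by rewrite absz_gt0.
by move: qz; rewrite dvdzE => /(dvdn_leq zp); lia.
Qed.

Lemma comb_bound (x y e f : int) : `|x| <= 33 * X%:Z -> `|y| <= 33 * X%:Z ->
  `|e| * D%:Z <= X%:Z -> `|f| * D%:Z <= X%:Z -> `|x * e + y * f| * D%:Z <= 66 * X%:Z * X%:Z.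
Proof.
move=> xX yX eX fX.
have A : `|x| * (`|e| * D%:Z) <= 33 * X%:Z * X%:Z by apply: ler_pM => //; rewrite mulr_ge0.
have B : `|y| * (`|f| * D%:Z) <= 33 * X%:Z * X%:Z by apply: ler_pM => //; rewrite mulr_ge0.
have : `|x * e + y * f| * D%:Z <= (`|x| * `|e| + `|y| * `|f|) * D%:Z.
  by rewrite ler_wpM2r// -!normrM ler_normD.
by rewrite mulrDl -!mulrA; lia.
Qed.

Lemma comb_small (x y e f : int) : `|x| <= 33 * X%:Z -> `|y| <= 33 * X%:Z ->
  `|e| * D%:Z <= X%:Z -> `|f| * D%:Z <= X%:Z -> (q %| x * e + y * f)%Z -> x * e + y * f = 0.
Proof.
move=> xX yX eX fX /small_dvd; apply.
have := comb_bound xX yX eX fX; set w := `|_|.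
have w0 : 0 <= w by rewrite normr_ge0.
rewrite ltNge => H; apply/negP => wq; nia.
Qed.

(** Splits [det g] times [g^-1 h] into a scalar and a term linear in [h - g], which is small when
    [g] and [h] are close. *)
Lemma adj_mulE (g h : mat int) : mmul (madj g) h =
  (mdet g + (md g * (ma h - ma g) + (- mb g) * (mc h - mc g)),
   md g * (mb h - mb g) + (- mb g) * (md h - md g),
   (- mc g) * (ma h - ma g) + ma g * (mc h - mc g),
   mdet g + ((- mc g) * (mb h - mb g) + ma g * (md h - md g))).
Proof. by apply: matP; rewrite /mmul /madj /mdet /ma /mb /mc /md /=; ring. Qed.

(* Two elements in a common coset of SL2(Z) coincide: their quotient is an integral matrix close
   to the identity. *)
Lemma adj_mul_dvd g h : sized g -> close h g -> mdvd q (mmul (madj g) h) -> g = h.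
Proof.
move=> [dg a1 b1 c1 d1] [e1 e2 e3 e4]; rewrite adj_mulE /mdvd dg.
have M (y : int) : (q %| q%:Z + y)%Z -> (q %| y)%Z.
  by rewrite -[y in X in _ -> X](addKr q%:Z) => h'; rewrite rpredD// rpredN dvdzz.
move=> /and4P[/M h1 h2 h3 /M h4].
have b1' : `|- mb g| <= 33 * X%:Z by rewrite normrN.
have c1' : `|- mc g| <= 33 * X%:Z by rewrite normrN.
have r1 := comb_small d1 b1' e1 e3 h1; have r2 := comb_small d1 b1' e2 e4 h2.
have r3 := comb_small c1' a1 e1 e3 h3; have r4 := comb_small c1' a1 e2 e4 h4.
have dg' : ma g * md g - mb g * mc g = q%:Z by exact: dg.
have K (t : int) : q%:Z * t = 0 -> t = 0.
  by move/eqP; rewrite mulf_eq0 => /orP[|/eqP//]; lia.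
have L (x y : int) : md g * x + - mb g * y = 0 -> - mc g * x + ma g * y = 0 -> x = 0 /\ y = 0.
  move=> s1 s2; split; apply: K; rewrite -dg'.
    transitivity (ma g * (md g * x + - mb g * y) + mb g * (- mc g * x + ma g * y)); first by ring.
    by rewrite s1 s2 !mulr0.
  transitivity (mc g * (md g * x + - mb g * y) + md g * (- mc g * x + ma g * y)); first by ring.
  by rewrite s1 s2 !mulr0.
have [k1 k3] := L _ _ r1 r3; have [k2 k4] := L _ _ r2 r4.
by apply/esym/matP; apply/eqP; rewrite -subr_eq0 ?k1 ?k2 ?k3 ?k4.
Qed.

Lemma prime_dvdM (x y : int) : (q %| x * y)%Z -> ~~ (q %| x)%Z -> (q %| y)%Z.
Proof. by rewrite !dvdzE abszM Euclid_dvdM// => /orP[->|]. Qed.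

(** The vector [(v1, v2)] is killed modulo [q] by both adjugates; for matrices of rank one it spans
    both images, so [madj g] kills the columns of [h]. In the proof, [v1] or [v2] times each entry
    of the product is a combination of the given multiples of [q], and [q] is prime. *)
Lemma column_dvd (g h : mat int) (v1 v2 : int) : ~~ ((q %| v1)%Z && (q %| v2)%Z) ->
  (q %| md g * v1 - mb g * v2)%Z -> (q %| ma g * v2 - mc g * v1)%Z ->
  (q %| md h * v1 - mb h * v2)%Z -> (q %| ma h * v2 - mc h * v1)%Z ->
  mdvd q (mmul (madj g) h).
Proof.
move: g h => [[[a b] c] d] [[[a' b'] c'] d'].
rewrite /mdvd /mmul /madj /ma /mb /mc /md /= negb_and => nv g1 g2 h1 h2.
have D2 (x y s t z : int) : (q %| s)%Z -> (q %| t)%Z -> z = x * s + y * t -> (q %| z)%Z.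
  by move=> qs qt ->; apply: rpredD; rewrite dvdz_mull.
case/orP: nv => nv; apply/and4P; split; apply: (prime_dvdM _ nv).
- by apply: (D2 a' b _ _ _ g1 h2); ring.
- by apply: (D2 b' (- b) _ _ _ g1 h1); ring.
- by apply: (D2 a' (- a) _ _ _ g2 h2); ring.
- by apply: (D2 b' a _ _ _ g2 h1); ring.
- by apply: (D2 d c' _ _ _ h2 g1); ring.
- by apply: (D2 (- d) d' _ _ _ h1 g1); ring.
- by apply: (D2 (- c) c' _ _ _ h2 g2); ring.
- by apply: (D2 c d' _ _ _ h1 g2); ring.
Qed.

(** A primitive [P] has a column that is nonzero modulo [q]. Being killed by both adjugates, it puts
    [g] and [h] into one coset, and close elements of one coset coincide. *)
Lemma left_divisor_uniq (g h P : mat int) : sized g -> close h g -> ~~ mdvd q P ->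
  mdvd q (mmul (madj g) P) -> mdvd q (mmul (madj h) P) -> g = h.
Proof.
move=> sg ch nP gP hP; apply: adj_mul_dvd => //.
move: gP hP nP; rewrite /mdvd => /and4P[g1 g2 g3 g4] /and4P[h1 h2 h3 h4].
have E (u : mat int) : [/\ ma (mmul (madj u) P) = md u * ma P - mb u * mc P,
   mb (mmul (madj u) P) = md u * mb P - mb u * md P,
   mc (mmul (madj u) P) = ma u * mc P - mc u * ma P &
   md (mmul (madj u) P) = ma u * md P - mc u * mb P].
  by rewrite /mmul /madj /ma /mb /mc /md /=; split; ring.
have [e1 e2 e3 e4] := E g; have [f1 f2 f3 f4] := E h.
rewrite e1 in g1; rewrite e2 in g2; rewrite e3 in g3; rewrite e4 in g4.
rewrite f1 in h1; rewrite f2 in h2; rewrite f3 in h3; rewrite f4 in h4.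
case: (boolP ((q %| ma P)%Z && (q %| mc P)%Z)) => [/andP[-> ->]|n1 _]; last first.
  exact: (column_dvd n1 g1 g3 h1 h3).
by rewrite /= => n2; apply: (column_dvd n2 g2 g4 h2 h4).
Qed.

End cosets.

(** * Words in the letters, and the multiplicity of a matrix among them *)

Section words.
Local Open Scope ring_scope.
Variables (q D X : nat) (S : seq (mat int)).
Hypothesis q_prime : prime q.
Hypothesis X0 : (0 < X)%N.
Hypothesis Xq : (X ^ 2 <= q)%N.
Hypothesis D66 : (66 < D)%N.
Hypothesis SU : uniq S.
Hypothesis S0 : (0 < size S)%N.
Hypothesis S1 : forall g, g \in S -> sized q X g.
Hypothesis S2 : forall g h, g \in S -> h \in S -> close D X g h.

Definition letters (b : bool) := if b then [seq madj g | g <- S] else S.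

(** Adjugates and elements of [S] alternate, so that each pair [madj g], [h] of consecutive letters
    multiplies to a matrix close to the scalar [q]. *)
Fixpoint words (b : bool) (l : nat) : seq (mat int) :=
  if l is l'.+1 then [seq mmul e P | e <- letters b, P <- words (~~ b) l'] else [:: mone].

Let q0 : (0 < q)%N. Proof. exact: prime_gt0. Qed.
Let qz0 : q%:Z != 0. Proof. by rewrite -lt0n. Qed.

Lemma letters_uniq b : uniq (letters b).
Proof. by case: b => //=; rewrite map_inj_uniq// => g h /(congr1 (@madj _)); rewrite !madjK. Qed.

Lemma letters_sized b g : g \in letters b -> sized q X g.
Proof. by case: b => [/mapP[h /S1 hs ->]|/S1//]; exact: sized_adj. Qed.

Lemma letters_close b g h : g \in letters b -> h \in letters b -> close D X g h.
Proof.
case: b => [/mapP[g' gs ->] /mapP[h' hs ->]|]; last exact: S2.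
by apply: close_adj; exact: S2.
Qed.

Lemma size_letters b : size (letters b) = size S.
Proof. by case: b; rewrite /= ?size_map. Qed.

Lemma size_words b l : size (words b l) = (size S ^ l)%N.
Proof. by elim: l b => [|l IH] b //=; rewrite size_allpairs size_letters IH expnS. Qed.

Lemma det_words b l P : P \in words b l -> mdet P = q%:Z ^+ l.
Proof.
elim: l b P => [|l IH] b P; first by rewrite inE => /eqP ->; rewrite /mdet /=.
move=> /allpairsP[[e P'] /= [/letters_sized[de _ _ _ _] /IH dP ->]].
by rewrite mdetM de dP exprS.
Qed.

Lemma mscale_inj (t : int) : t != 0 -> injective (mscale t).
Proof.
move=> t0 [[[a b] c] d] [[[a' b'] c'] d']; rewrite /mscale /ma /mb /mc /md /= => -[].
by move=> /(mulfI t0) -> /(mulfI t0) -> /(mulfI t0) -> /(mulfI t0) ->.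
Qed.

Lemma mdvdP P : reflect (exists P', P = mscale q%:Z P') (mdvd q P).
Proof.
apply: (iffP and4P) => [[/dvdzP[a' a] /dvdzP[b' b] /dvdzP[c' c] /dvdzP[d' d]]|[P' ->]].
  exists (a', b', c', d'); apply: matP; rewrite /mscale ?a ?b ?c ?d /ma /mb /mc /md /= mulrC//.
by rewrite /mscale /ma /mb /mc /md /=; split; rewrite dvdz_mulr// dvdzz.
Qed.

Lemma count_good_le1 (T : eqType) (s : seq T) (good : pred T) : uniq s ->
  (forall x y, x \in s -> y \in s -> good x -> good y -> x = y) -> (count good s <= 1)%N.
Proof.
move=> us H; rewrite -size_filter.
case E : [seq x <- s | good x] => [|x [|y r]] //.
have : uniq [seq x <- s | good x] by exact: filter_uniq.
have xy : x = y.
  have xs : x \in [seq x <- s | good x] by rewrite E inE eqxx.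
  have ys : y \in [seq x <- s | good x] by rewrite E !inE eqxx orbT.
  by move: xs ys; rewrite !mem_filter => /andP[? ?] /andP[? ?]; apply: H.
by rewrite E xy /= inE eqxx.
Qed.

(** Peel off the first letter [e]. If [q] divides [madj e P], which happens for at most one [e], the
    rest of the word is [q^j] times a primitive matrix. For every other [e] the rest is [q^(j-1)]
    times the primitive matrix [madj e P], so the exponent drops and pays for the [|S|] choices of
    [e]. Two contributions of equal size explain the factor 2 per letter. *)
Lemma count_words b l j P : ~~ mdvd q P ->
  (count_mem (mscale (q%:Z ^+ j) P) (words b l) <= 2 ^ l * size S ^ j)%N.
Proof.
elim: l b j P => [|l IH] b j P nP.
  by rewrite /= addn0 mul1n; case: eqP => // _; rewrite expn_gt0 S0.
rewrite /= count_flatten -map_comp sumnE big_map.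
set Q := mscale _ P.
have step e : e \in letters b ->
   (count_mem Q [seq mmul e P' | P' <- words (~~ b) l] <=
    (if j is j'.+1 then 2 ^ l * size S ^ j' else 0) +
    (if mdvd q (mmul (madj e) P) then 2 ^ l * size S ^ j else 0))%N.
  move=> el; have [de _ _ _ _] := letters_sized el.
  rewrite count_map.
  have sub P' : mmul e P' = Q -> mscale q%:Z P' = mscale (q%:Z ^+ j) (mmul (madj e) P).
    by move=> /(congr1 (mmul (madj e))); rewrite mmulA mmul_adjl de mmulZl mmul1m /Q mmulZr.
  case: (boolP (mdvd q (mmul (madj e) P))) => [/mdvdP[P2 eP]|ne].
    have nP2 : ~~ mdvd q P2.
      apply: contra nP => /mdvdP[P3 P23]; apply/mdvdP; exists (mmul e P3).
      have : mmul e (mmul (madj e) P) = mscale q%:Z (mmul e P2) by rewrite eP mmulZr.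
      rewrite mmulA mmul_adjr de mmulZl mmul1m => /(mscale_inj qz0) ->.
      by rewrite P23 mmulZr.
    rewrite (leq_trans _ (leq_addl _ _))// (leq_trans _ (IH (~~ b) j P2 nP2))//.
    apply: sub_count => P' /= /eqP /sub; rewrite eP mscaleA mulrC -mscaleA => /(mscale_inj qz0) ->.
    by [].
  rewrite addn0; case: j Q sub => [|j] Q sub.
    rewrite leqn0 -leqn0 leqNgt -has_count; apply/negP => /hasP[P' _ /= /eqP /sub].
    rewrite expr0 mscale1 => E; move/negP: ne; apply; apply/mdvdP; exists P'.
    by rewrite -E.
  rewrite (leq_trans _ (IH (~~ b) j _ ne))//.
  apply: sub_count => P' /= /eqP /sub; rewrite exprS -mscaleA => /(mscale_inj qz0) ->.
  by [].
rewrite big_seq (leq_trans (leq_sum _ step))// -big_seq big_split/=.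
rewrite -big_mkcond/= !big_const_seq !iter_addn_0 count_predT size_letters.
have good : (count (fun e => mdvd q (mmul (madj e) P)) (letters b) <= 1)%N.
  apply: count_good_le1 (letters_uniq b) _ => g h gl hl gd hd.
  exact: (left_divisor_uniq q_prime X0 Xq D66 (letters_sized gl) (letters_close hl gl) nP).
rewrite expnS mulSn mul1n mulnDl leq_add//; last first.
  by rewrite -[X in (_ <= X)%N]muln1 leq_mul2l good orbT.
by case: j {Q step} => [|j]; rewrite ?mul0n// expnSr mulnA.
Qed.

End words.

(** * The divisor bound *)

Section divisor_bound.
Local Open Scope nat_scope.

Lemma expn_le_exp2 (m x : nat) : 0 < m -> x ^ m <= m ^ m * 2 ^ x.
Proof.
move=> m0; have xm := ltn_ceil x m0; have mx := leq_trunc_div x m.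
rewrite (@leq_trans ((m * 2 ^ (x %/ m)) ^ m))//.
  rewrite leq_exp2r// (leq_trans (ltnW xm))// mulnC leq_mul2l; apply/orP; right.
  exact: ltn_expl.
by rewrite expnMn -expnM leq_mul2l leq_exp2l ?mx ?orbT.
Qed.

Lemma size_divisors_split (p N : nat) : prime p -> 0 < N ->
  size (divisors N) <= (logn p N).+1 * size (divisors N`_p^').
Proof.
move=> pp N0.
rewrite -[(logn p N).+1](size_iota 0) -(size_allpairs (fun i d => p ^ i * d)).
apply: uniq_leq_size (divisors_uniq N) _ => d; rewrite -dvdn_divisors// => dN.
have d0 := dvdn_gt0 N0 dN.
apply/allpairsP; exists (logn p d, d`_p^'); split=> /=.
- by rewrite -/(iota 0 (logn p N).+1) mem_iota/= add0n ltnS dvdn_leq_log.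
- by rewrite -dvdn_divisors ?part_gt0// partn_dvd.
- by rewrite -p_part partnC.
Qed.

(** Downward induction on the least prime [k] allowed in [N]. Primes [p >= 2^m] cost nothing, since
    [(l + 1)^m <= 2^(l m) <= p^l]; each of the finitely many smaller primes costs the constant
    factor [2 m^m]. *)
Lemma divisors_bound_ge (m k : nat) : 0 < m -> exists C : nat, forall N : nat, 0 < N ->
  (forall p, prime p -> p %| N -> k <= p) -> size (divisors N) ^ m <= C * N.
Proof.
move=> m0; have [j] := ubnP (2 ^ m - k); elim: j k => // j IH k kj.
have [k2|k2] := leqP (2 ^ m) k.
  exists 1 => N; have [M NM] := ubnP N; elim: M N NM => // M IHM N NM N0 pN.
  have [->|N1] := eqVneq N 1; first by rewrite -[divisors 1]/[:: 1] exp1n.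
  have N2 : 1 < N by lia.
  have pp := pdiv_prime N2; set p := pdiv N in pp.
  have pdN : p %| N by exact: pdiv_dvd.
  rewrite (leq_trans (_ : _ <= ((logn p N).+1 * size (divisors N`_p^')) ^ m))//.
    by rewrite leq_exp2r// size_divisors_split.
  rewrite expnMn mul1n -[X in _ <= X](partnC p N0) leq_mul//.
    rewrite p_part (leq_trans (_ : _ <= (2 ^ logn p N) ^ m))//.
      by rewrite leq_exp2r// ltn_expl.
    rewrite -expnM mulnC expnM.
    have [->//|l0] := posnP (logn p N).
    by rewrite leq_exp2r// (leq_trans k2)// pN.
  rewrite -[X in _ <= X]mul1n IHM ?part_gt0//.
    have : N`_p^' < N.
      rewrite -[X in _ < X](partnC p N0) ltn_Pmull ?part_gt0// p_part.
      by rewrite -(exp1n (logn p N)) ltn_exp2r ?prime_gt1// logn_gt0 mem_primes pp N0 pdN.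
    by lia.
  by move=> r rp rN; apply: pN => //; apply: dvdn_trans rN (dvdn_part _ _).
have [C HC] := IH k.+1 (ltac:(lia)).
have [kp|knp] := boolP (prime k); last first.
  exists C => N N0 pN; apply: HC => // p pp /(pN p pp); rewrite leq_eqVlt => /orP[/eqP E|//].
  by move: knp; rewrite E pp.
exists (C * (2 * m ^ m)) => N N0 pN.
rewrite (leq_trans (_ : _ <= ((logn k N).+1 * size (divisors N`_k^')) ^ m))//.
  by rewrite leq_exp2r// size_divisors_split.
rewrite expnMn -[X in _ <= _ * X](partnC k N0).
have A : (logn k N).+1 ^ m <= 2 * m ^ m * N`_k.
  rewrite (leq_trans (expn_le_exp2 _ m0))// p_part expnS mulnCA mulnA leq_mul2l.
  have [->|l0] := posnP (logn k N); first by rewrite orbT.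
  by rewrite leq_exp2r ?prime_gt1 ?orbT.
have B : size (divisors N`_k^') ^ m <= C * N`_k^'.
  apply: HC; first exact: part_gt0.
  move=> p pp pN'; have := pN p pp (dvdn_trans pN' (dvdn_part _ _)).
  rewrite leq_eqVlt => /orP[/eqP E|//].
  have /pnatP := part_pnat k^' N; rewrite part_gt0 => /(_ isT) /(_ p pp pN').
  by rewrite !inE E eqxx.
by rewrite (leq_trans (leq_mul A B))//; apply: eq_leq; lia.
Qed.

Lemma divisors_bound (m : nat) : 0 < m -> exists C : nat, forall N : nat, 0 < N ->
  size (divisors N) ^ m <= C * N.
Proof. by move=> /(divisors_bound_ge 0)[C HC]; exists C => N N0; apply: HC. Qed.

End divisor_bound.

(** * Counting integral matrices of determinant [Q^2] near the scalar [Q] *)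

Section near_identity_count.
Local Open Scope ring_scope.

Definition zrange (N : nat) : seq int := [seq i%:Z - N%:Z | i <- iota 0 (2 * N).+1].

Lemma mem_zrange (N : nat) (z : int) : `|z| <= N%:Z -> z \in zrange N.
Proof.
move=> zN; apply/mapP; exists (absz (z + N%:Z)); last by lia.
by rewrite mem_iota; lia.
Qed.

Lemma size_zrange N : size (zrange N) = (2 * N).+1.
Proof. by rewrite size_map size_iota. Qed.

Definition zdivisors (N : int) : seq int :=
  [seq d%:Z | d <- divisors (absz N)] ++ [seq - d%:Z | d <- divisors (absz N)].

Lemma mem_zdivisors (N b c : int) : N != 0 -> b * c = N -> b \in zdivisors N.
Proof.
move=> N0 E; have dv : (absz b \in divisors (absz N)).
  by rewrite -dvdn_divisors ?absz_gt0// -E abszM dvdn_mulr.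
rewrite mem_cat; apply/orP; have [b0|b0] := leP 0 b.
  by left; apply/mapP; exists (absz b) => //; lia.
by right; apply/mapP; exists (absz b) => //; lia.
Qed.

Variables (Q Y tau : nat).
Hypothesis YQ : (2 * Y <= Q)%N.
Hypothesis Q0 : (0 < Q)%N.
Hypothesis tauP : forall N : nat, (0 < N <= Q ^ 2)%N -> (size (divisors N) <= tau)%N.

Definition near_identity (P : mat int) := [&& mdet P == (Q%:Z) ^+ 2, `|ma P - Q%:Z| <= Y%:Z,
  `|mb P| <= Y%:Z, `|mc P| <= Y%:Z & `|md P - Q%:Z| <= Y%:Z].

(* Off-diagonal product nonzero: the trace defect [t] and [m = a - d] determine [bc], up to the
   divisor [b]. *)
Definition generic_near : seq (mat int) :=
  flatten [seq (let a := ((t + 2 * Q%:Z + m) %/ 2)%Z in let d := ((t + 2 * Q%:Z - m) %/ 2)%Z in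
     let N := a * d - Q%:Z ^+ 2 in
     if (N != 0) && (`|N| <= Y%:Z ^+ 2) then [seq (a, b, (N %/ b)%Z, d) | b <- zdivisors N] else [::])
   | t <- zrange (3 * Y ^ 2 %/ Q), m <- zrange (2 * Y)].

(** The case [b c = 0], where [a d = Q^2] and one off-diagonal entry is free. Positive divisors
    suffice, because [a] lies within [Y <= Q / 2] of [Q]. *)
Definition triangular_near : seq (mat int) :=
  [seq (a%:Z, v, 0, (Q ^ 2 %/ a)%N%:Z) | a <- divisors (Q ^ 2), v <- zrange Y] ++
  [seq (a%:Z, 0, v, (Q ^ 2 %/ a)%N%:Z) | a <- divisors (Q ^ 2), v <- zrange Y].

Lemma size_flatten_le (T : eqType) (s : seq (seq T)) (k : nat) :
  (forall x, x \in s -> (size x <= k)%N) -> (size (flatten s) <= size s * k)%N.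
Proof.
elim: s => //= x s IH H; rewrite size_cat mulSn leq_add ?H ?mem_head//.
by apply: IH => y ys; apply: H; rewrite inE ys orbT.
Qed.

Lemma size_near :
  (size (generic_near ++ triangular_near) <= 8 * tau * (3 * Y ^ 2 %/ Q).+1 * (4 * Y).+1)%N.
Proof.
have Y2 : (Y ^ 2 <= Q ^ 2)%N by rewrite leq_exp2r//; lia.
rewrite size_cat.
have G : (size generic_near <= (2 * (3 * Y ^ 2 %/ Q)).+1 * (4 * Y).+1 * (tau + tau))%N.
  rewrite (leq_trans (size_flatten_le (k := tau + tau) _))//; last first.
    by rewrite size_allpairs !size_zrange mulnA.
  move=> s /allpairsP[[t m] /= [_ _ ->]]; case: ifP => // /andP[N0 NY].
  by rewrite size_map size_cat !size_map leq_add// tauP//; lia.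
have Tr : (size triangular_near <= tau * (2 * Y).+1 + tau * (2 * Y).+1)%N.
  rewrite size_cat !size_allpairs size_zrange leq_add// leq_mul2r tauP ?orbT//.
    by rewrite expn_gt0 Q0 leqnn.
  by rewrite expn_gt0 Q0 leqnn.
move: (3 * Y ^ 2 %/ Q)%N G Tr => T G Tr; nia.
Qed.

Lemma near_mem P : near_identity P -> P \in generic_near ++ triangular_near.
Proof.
move: P => [[[a b] c] d]; rewrite /near_identity /mdet /ma /mb /mc /md /=.
move=> /and5P[/eqP D aQ bY cY dQ].
rewrite mem_cat; apply/orP.
have [bc0|bc0] := eqVneq (b * c) 0; last left.
  right; have ad : a * d = Q%:Z ^+ 2 by lia.
  have [a0 d0] : 0 < a /\ 0 < d by lia.
  have aa : (absz a)%:Z = a by lia.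
  have dd : (Q ^ 2 %/ absz a)%N%:Z = d.
    have -> : (Q ^ 2 = absz d * absz a)%N by nia.
    by rewrite mulnK; lia.
  have av : absz a \in divisors (Q ^ 2).
    rewrite -dvdn_divisors ?expn_gt0 ?Q0//.
    have -> : (Q ^ 2 = absz d * absz a)%N by nia.
    exact: dvdn_mull.
  rewrite mem_cat; apply/orP; move/eqP: bc0; rewrite mulf_eq0 => /orP[]/eqP E; [right|left].
    by apply/allpairsP; exists (absz a, c); split; rewrite /= ?mem_zrange// aa dd E.
  by apply/allpairsP; exists (absz a, b); split; rewrite /= ?mem_zrange// aa dd E.
have ht : `|a + d - 2 * Q%:Z| <= (3 * Y ^ 2 %/ Q)%N%:Z.
  have tT : (absz (a + d - 2 * Q%:Z)%R * Q <= 3 * Y ^ 2)%N.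
    (* The trace defect [t] satisfies [t (t + 4 Q) = (a - d)^2 + 4 b c]. The right side is at most
       [8 Y^2] and [t + 4 Q >= 3 Q], so [t] is of size [Y^2 / Q] and not merely of size [Y]. *)
    have E : (a + d - 2 * Q%:Z) * (a + d - 2 * Q%:Z + 4 * Q%:Z) = (a - d) ^+ 2 + 4 * (b * c).
      rewrite (_ : b * c = a * d - Q%:Z ^+ 2); last by lia.
      ring.
    have A : `|a - d| <= 2 * Y%:Z by lia.
    have A2 : (a - d) ^+ 2 <= 4 * Y%:Z ^+ 2.
      by rewrite -real_normK ?num_real// (_ : 4 * _ = (2 * Y%:Z) ^+ 2) ?ler_pXn2r ?nnegrE//; ring.
    have B : `|b * c| <= Y%:Z ^+ 2 by rewrite normrM expr2 ler_pM.
    have A3 : 0 <= (a - d) ^+ 2 by rewrite sqr_ge0.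
    set t := a + d - 2 * Q%:Z in E *.
    have tY : `|t| <= 2 * Y%:Z by rewrite /t; lia.
    have t4 : 3 * Q%:Z <= t + 4 * Q%:Z by lia.
    have : `|t| * (3 * Q%:Z) <= 8 * Y%:Z ^+ 2.
      apply: (@le_trans _ _ (`|t| * (t + 4 * Q%:Z))); first by rewrite ler_wpM2l.
      rewrite -[t + _]ger0_norm; last by lia.
      rewrite -normrM E; lia.
    by lia.
  by have := leq_div2r Q tT; rewrite mulnK// => h; lia.
have N : a * d - Q%:Z ^+ 2 = b * c by lia.
apply/flattenP; exists [seq (a, b', ((b * c) %/ b')%Z, d) | b' <- zdivisors (b * c)].
  apply/allpairsP; exists (a + d - 2 * Q%:Z, a - d); split=> /=.
  - exact: mem_zrange.
  - by apply: mem_zrange; lia.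
  - rewrite (_ : _ + (a - d) = a * 2); last by ring.
    rewrite (_ : _ - (a - d) = d * 2); last by ring.
    by rewrite !mulzK// N bc0 normrM expr2 ler_pM.
apply/mapP; exists b; first exact: mem_zdivisors bc0 erefl.
by rewrite mulrC mulzK//; apply: contraNneq bc0 => ->; rewrite mul0r.
Qed.

End near_identity_count.

(** The number of candidates at one level of divisibility, weighted by [s = q^j]: here [a] bounds
    the trace defect and [y] the entries after division by [s]. The bound depends on [s Q] and [Y]
    only, hence is the same at all levels. *)
Lemma level_bound (s Q Y y a : nat) : (0 < s)%N -> (y * s <= Y)%N -> (a * Q <= 3 * y ^ 2)%N ->
  (2 * Y <= s * Q)%N ->
  (s * (a.+1 * (4 * y).+1) * (s * Q) <= 12 * Y ^ 3 + 4 * (s * Q) ^ 2)%N.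
Proof.
move=> s0 yY aQ YQ.
have e1 : (s * a * (s * Q) <= 3 * Y ^ 2)%N.
  rewrite (_ : s * a * (s * Q) = s ^ 2 * (a * Q))%N; last by ring.
  rewrite (leq_trans (leq_mul (leqnn _) aQ))//.
  rewrite (_ : s ^ 2 * (3 * y ^ 2) = 3 * (y * s) ^ 2)%N; last by ring.
  by rewrite leq_mul2l leq_exp2r.
have yY' : (y <= Y)%N by rewrite (leq_trans _ yY)// leq_pmulr.
have [->|Q0] := posnP Q; first by rewrite !muln0.
set W := (s * Q)%N in e1 YQ *.
have e2 : (s * (4 * y).+1 <= 4 * Y + W)%N.
  have : (s <= W)%N by rewrite leq_pmulr.
  lia.
rewrite (_ : s * (a.+1 * (4 * y).+1) * W = s * a * W * (4 * y).+1 + s * (4 * y).+1 * W)%N; last by ring.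
rewrite (leq_trans (leq_add (leq_mul e1 (_ : _ <= (4 * Y).+1)%N) (leq_mul e2 (leqnn W))))//; first by lia.
clear -YQ; nia.
Qed.

(** * Words close to a scalar matrix *)

Section near_words.
Local Open Scope ring_scope.
Variables (q D X C : nat) (S : seq (mat int)).
Hypothesis q_prime : prime q.
Hypothesis X0 : (0 < X)%N.
Hypothesis Xq : (X ^ 2 <= q)%N.
Hypothesis D66 : (66 < D)%N.
Hypothesis SU : uniq S.
Hypothesis S0 : (0 < size S)%N.
Hypothesis S1 : forall g, g \in S -> sized q X g.
Hypothesis S2 : forall g h, g \in S -> h \in S -> close D X g h.
Hypothesis SC : (q <= C * size S)%N.

Lemma primitive_part (P : mat int) : mdet P != 0 ->
  exists j P1, P = mscale (q%:Z ^+ j) P1 /\ ~~ mdvd q P1.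
Proof.
have [n] := ubnP (absz (mdet P)); elim: n P => // n IH P Pn P0.
have [/mdvdP[P' E]|nP] := boolP (mdvd q P); last by exists 0%N, P; rewrite expr0 mscale1.
have d' : mdet P = q%:Z ^+ 2 * mdet P' by rewrite E mdetZ.
have P0' : mdet P' != 0 by apply: contraNneq P0 => h; rewrite d' h mulr0.
have q1 := prime_gt1 q_prime.
have [|j [P1 [E1 nP1]]] := IH P' _ P0'.
  move: Pn; rewrite d' abszM abszX/=; have : (0 < absz (mdet P'))%N by rewrite absz_gt0.
  by nia.
by exists j.+1, P1; split=> //; rewrite E E1 mscaleA exprS.
Qed.

Lemma count_le_sum (T : eqType) (a : pred T) (s L : seq T) :
  (forall x, x \in s -> a x -> x \in L) -> (count a s <= \sum_(x <- L) count_mem x s)%N.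
Proof.
elim: s => [|y s IH] H; first by rewrite /= big1.
rewrite /= big_split/= leq_add//; last by apply: IH => x xs; apply: H; rewrite inE xs orbT.
case ay : (a y) => //; have yL := H y (mem_head _ _) ay.
by rewrite (big_rem y)//= eqxx.
Qed.

Lemma sum_seq_le (T : eqType) (L : seq T) (F : T -> nat) (B : nat) :
  (forall x, x \in L -> (F x <= B)%N) -> (\sum_(x <- L) F x <= size L * B)%N.
Proof.
elim: L => [|x L IH] H; first by rewrite big_nil.
rewrite big_cons mulSn leq_add ?H ?mem_head//.
by apply: IH => y yL; apply: H; rewrite inE yL orbT.
Qed.

(** Nearness up to sign: the coordinates of a cell are ratios of entries and do not see the sign of
    a matrix. *)
Definition near_pm (Q Y : nat) (P : mat int) :=
  near_identity Q Y P || near_identity Q Y (mscale (-1) P).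

(** Primitive candidates for the quotient by [q^j] of a near word of length [4k]: such a quotient
    has determinant [(q^(2k - j))^2] and lies within [Y %/ q^j] of the scalar [+-q^(2k - j)]. *)
Let lst k Y (j : nat) := [seq P <-
   (generic_near (q ^ (2 * k - j)) (Y %/ q ^ j) ++ triangular_near (q ^ (2 * k - j)) (Y %/ q ^ j)) ++
   [seq mscale (-1) P | P <- generic_near (q ^ (2 * k - j)) (Y %/ q ^ j) ++
                             triangular_near (q ^ (2 * k - j)) (Y %/ q ^ j)]
   | ~~ mdvd q P].

Lemma near_identity_scale (Q Q' Y c : nat) (P : mat int) : (0 < c)%N -> (Q = c * Q')%N ->
  near_identity Q Y (mscale c%:Z P) -> near_identity Q' (Y %/ c) P.
Proof.
move=> c0 QE; move: P => [[[x y] z] t].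
rewrite /near_identity /mscale mdetZ /ma /mb /mc /md /= => /and5P[/eqP dP h1 h2 h3 h4].
have K (w : int) : `|c%:Z * w| <= Y%:Z -> `|w| <= (Y %/ c)%N%:Z.
  rewrite normrM => h; have : (absz w * c <= Y)%N by lia.
  by move/(leq_div2r c); rewrite mulnK//; lia.
apply/and5P; split; [|apply: K|exact: K|exact: K|apply: K].
- apply/eqP; apply: (@mulfI _ (c%:Z ^+ 2)); first by rewrite expf_neq0//; lia.
  by rewrite dP QE PoszM exprMn.
- by rewrite mulrBr -PoszM -QE.
- by rewrite mulrBr -PoszM -QE.
Qed.

(** A near word is [q^j P] with [P] primitive and [j <= 2k]. The multiplicity [2^(4k) |S|^j] from
    [count_words] becomes [q^j] relative to all [|S|^(4k)] words, because [q <= C |S|]. With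
    [Q = q^(2k)] the proportion of near words is thus of order [(Y / Q)^3 + 1 / Q], up to constants
    to the power [k] and the divisor count: the volume of a ball plus the granularity of the
    lattice. *)
Lemma count_near_words (k Y tau : nat) : (2 * Y <= q ^ (2 * k))%N ->
  (forall N : nat, (0 < N <= (q ^ (2 * k)) ^ 2)%N -> (size (divisors N) <= tau)%N) ->
  (count (near_pm (q ^ (2 * k)) Y) (words S true (4 * k)) * (q ^ (2 * k)) ^ 3 <=
   (2 * k).+1 * 16 * (2 * C) ^ (4 * k) * size S ^ (4 * k) * tau * (12 * Y ^ 3 + 4 * (q ^ (2 * k)) ^ 2))%N.
Proof.
move=> YQ tauP; set Q := (q ^ (2 * k))%N in YQ tauP *.
have q0 : (0 < q)%N := prime_gt0 q_prime.
have Q0 : (0 < Q)%N by rewrite expn_gt0 q0.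
pose L := flatten [seq [seq mscale (q%:Z ^+ j) P | P <- lst k Y j] | j <- iota 0 (2 * k).+1].
have sub P : P \in words S true (4 * k) -> near_pm Q Y P -> P \in L.
  move=> /(det_words S1) dP nP.
  have [|j [P1 [PE nP1]]] := @primitive_part P.
    by rewrite dP expf_neq0//; lia.
  have jk : (j <= 2 * k)%N.
    have : (q ^ (2 * j) %| q ^ (4 * k))%N.
      have : (q%:Z ^+ (2 * j) %| q%:Z ^+ (4 * k))%Z.
        by rewrite -dP PE mdetZ -exprM mulnC dvdz_mulr// dvdzz.
      by rewrite dvdzE !abszX.
    by rewrite dvdn_Pexp2l ?prime_gt1//; lia.
  apply/flattenP; exists [seq mscale (q%:Z ^+ j) P | P <- lst k Y j].
    by apply/mapP; exists j => //; rewrite mem_iota; lia.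
  apply/mapP; exists P1 => //; rewrite mem_filter nP1/=.
  have Qj : Q = (q ^ j * q ^ (2 * k - j))%N by rewrite -expnD subnKC.
  have qj0 : (0 < q ^ j)%N by rewrite expn_gt0 q0.
  have qje : q%:Z ^+ j = (q ^ j)%N%:Z by rewrite -!natz natrX.
  have Yj : (2 * (Y %/ q ^ j) <= q ^ (2 * k - j))%N.
    rewrite -(leq_pmul2l qj0) -Qj; have := leq_trunc_div Y (q ^ j); lia.
  rewrite mem_cat; apply/orP; move: nP => /orP[]; rewrite PE qje.
    move=> /(near_identity_scale qj0 Qj) h; left; apply: near_mem h => //.
    by rewrite expn_gt0 q0.
  rewrite mscaleA mulrC -mscaleA => /(near_identity_scale qj0 Qj) h; right.
  apply/mapP; exists (mscale (-1) P1); last by rewrite mscaleA mulrNN mulr1 mscale1.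
  by apply: near_mem h => //; rewrite expn_gt0 q0.
rewrite (leq_trans (leq_mul (count_le_sum sub) (leqnn _)))//.
have -> : (\sum_(x <- L) count_mem x (words S true (4 * k)) =
   \sum_(0 <= j < (2 * k).+1) \sum_(P <- lst k Y j) count_mem (mscale (q%:Z ^+ j) P) (words S true (4 * k)))%N.
  by rewrite big_flatten big_map /index_iota subn0; apply: eq_bigr => j _; rewrite big_map.
pose F := (16 * (2 * C) ^ (4 * k) * size S ^ (4 * k) * tau * (12 * Y ^ 3 + 4 * Q ^ 2))%N.
suff H j : (j < (2 * k).+1)%N ->
  ((\sum_(P <- lst k Y j) count_mem (mscale (q%:Z ^+ j) P) (words S true (4 * k))) * Q ^ 3 <= F)%N.
  rewrite big_distrl/= big_nat_cond.
  rewrite (@leq_trans (\sum_(0 <= j < (2 * k).+1 | ((0 <= j < (2 * k).+1)%N) && true) F)%N)//.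
    by apply: leq_sum => j /andP[/andP[_ jk] _]; exact: H.
  by rewrite -big_nat_cond sum_nat_const_nat subn0 /F; apply: eq_leq; lia.
move=> jk.
have Qj : Q = (q ^ j * q ^ (2 * k - j))%N by rewrite -expnD subnKC.
have qj0 : (0 < q ^ j)%N by rewrite expn_gt0 q0.
have Yj' := leq_trunc_div Y (q ^ j).
set Qj' := (q ^ (2 * k - j))%N in Qj; set y := (Y %/ q ^ j)%N in Yj'.
have Qj0 : (0 < Qj')%N by rewrite expn_gt0 q0.
have sz : (size (lst k Y j) <= 2 * (8 * tau * (3 * y ^ 2 %/ Qj').+1 * (4 * y).+1))%N.
  rewrite size_filter (leq_trans (count_size _ _))// size_cat size_map addnn -mul2n leq_mul2l/=.
  apply: size_near => //; first by rewrite -(leq_pmul2l qj0) -/Qj' -Qj -/y; lia.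
  move=> N /andP[N0 NQ]; apply: tauP; rewrite N0 (leq_trans NQ)//.
  by rewrite leq_exp2r// Qj leq_pmull.
have b1 : (\sum_(P <- lst k Y j) count_mem (mscale (q%:Z ^+ j) P) (words S true (4 * k)) <=
    size (lst k Y j) * (2 ^ (4 * k) * size S ^ j))%N.
  apply: sum_seq_le => P.
  rewrite mem_filter => /andP[nP _]; exact: (count_words q_prime X0 Xq D66 SU S0 S1 S2).
have b2 : (size S ^ j * Q ^ 2 <= q ^ j * (C ^ (4 * k) * size S ^ (4 * k)))%N.
  have e4 : (4 * k = j + (4 * k - j))%N by clear -jk; lia.
  have -> : (Q ^ 2 = q ^ j * q ^ (4 * k - j))%N by rewrite -expnM -expnD -e4 mulnAC.
  rewrite mulnCA leq_mul2l; apply/orP; right.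
  rewrite [in X in (_ <= _ * X)%N]e4 expnD mulnCA leq_mul2l; apply/orP; right.
  rewrite (leq_trans (_ : _ <= (C * size S) ^ (4 * k - j))%N)//.
    by case: (4 * k - j)%N => // u; rewrite leq_exp2r.
  rewrite expnMn leq_mul2r; apply/orP; right.
  by rewrite leq_pexp2l ?leq_subr//; case: C SC => //; lia.
have b3 : (q ^ j * ((3 * y ^ 2 %/ Qj').+1 * (4 * y).+1) * Q <= 12 * Y ^ 3 + 4 * Q ^ 2)%N.
  by rewrite Qj; apply: level_bound => //; rewrite ?leq_trunc_div// -Qj.
rewrite (leq_trans (leq_mul (leq_trans b1 (leq_mul sz (leqnn _))) (leqnn _)))//.
rewrite /F expnMn.
rewrite (_ : 2 * (8 * tau * (3 * y ^ 2 %/ Qj').+1 * (4 * y).+1) * (2 ^ (4 * k) * size S ^ j) * Q ^ 3 =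
  16 * 2 ^ (4 * k) * tau * ((3 * y ^ 2 %/ Qj').+1 * (4 * y).+1) * Q * (size S ^ j * Q ^ 2))%N; last by ring.
rewrite (leq_trans (leq_mul (leqnn _) b2))//.
rewrite (_ : 16 * 2 ^ (4 * k) * tau * ((3 * y ^ 2 %/ Qj').+1 * (4 * y).+1) * Q * (q ^ j * (C ^ (4 * k) * size S ^ (4 * k))) =
   16 * 2 ^ (4 * k) * tau * (C ^ (4 * k) * size S ^ (4 * k)) * (q ^ j * ((3 * y ^ 2 %/ Qj').+1 * (4 * y).+1) * Q))%N; last by ring.
rewrite (leq_trans (leq_mul (leqnn _) b3))//.
by apply: eq_leq; ring.
Qed.

End near_words.

(** * Counting along increasing partial matchings of the integers *)

Section counting.
Local Open Scope nat_scope.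
Implicit Types (X Y Z : pred nat).

Definition cnt (n : nat) X := \sum_(i < n) (X i : nat).

Lemma cnt_le n X Y : (forall i, i < n -> X i -> Y i) -> cnt n X <= cnt n Y.
Proof. by move=> H; apply: leq_sum => i _; case Xi : (X i) => //; rewrite (H i). Qed.

Lemma cnt_diff n X Y : (forall i, i < n -> X i -> Y i) ->
  cnt n Y = cnt n X + cnt n (fun i => Y i && ~~ X i).
Proof.
move=> H; rewrite -big_split/=; apply: eq_bigr => i _.
by case Xi : (X i); [rewrite (H i)|rewrite andbT].
Qed.

Lemma cnt_tri n X Y Z : cnt n (fun i => X i && ~~ Z i) <=
  cnt n (fun i => X i && ~~ Y i) + cnt n (fun i => Y i && ~~ Z i).
Proof. by rewrite -big_split/=; apply: leq_sum => i _; case: (X i); case: (Y i); case: (Z i). Qed.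

Lemma cnt_le_diff n X Y : cnt n X <= cnt n Y + cnt n (fun i => X i && ~~ Y i).
Proof. by rewrite -big_split/=; apply: leq_sum => i _; case: (X i); case: (Y i). Qed.

(** An increasing partial bijection: equal sources force equal targets and conversely, since [<] is
    irreflexive. One such relation is a monotone matching for the natural orders. *)
Definition strict (E : rel nat) := forall i j i' j', E i i' -> E j j' -> (i < j) = (i' < j').

Definition img n (E : rel nat) X j := has (fun i => X i && E i j) (iota 0 n).

Lemma imgP n (E : rel nat) X j : reflect (exists i, [/\ i < n, X i & E i j]) (img n E X j).
Proof.
apply: (iffP hasP) => [[i ii /andP[Xi Eij]]|[i [i_n Xi Eij]]].
  by exists i; split=> //; move: ii; rewrite mem_iota add0n.
by exists i; rewrite ?mem_iota ?Xi.
Qed.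

Lemma cnt_img n E X : strict E -> cnt n (img n E X) <= cnt n X.
Proof.
move=> sE; apply: (@leq_trans (\sum_(j < n) \sum_(i < n) ((X i && E i j) : nat))).
  apply: leq_sum => j _; case: imgP => // -[i [i_n Xi Eij]].
  by rewrite (bigD1 (Ordinal i_n))//= Xi Eij.
rewrite exchange_big/=; apply: leq_sum => i _; case Xi : (X i); last by rewrite big1.
rewrite /= -(big_mkord xpredT (fun j => (E i j : nat))) /index_iota subn0.
rewrite (_ : \sum_(_ <- _) _ = count (E i) (iota 0 n)); last first.
  by rewrite -sum1_count [RHS]big_mkcond/=; apply: eq_bigr => j _; case: (E i j).
apply: count_good_le1 (iota_uniq _ _) _ => j j' _ _ h h'.
have := sE _ _ _ _ h h'; have := sE _ _ _ _ h' h; rewrite ltnn; lia.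
Qed.

End counting.

(** The final estimate of the block construction: [A] is the size of the set, [de] the excess of its
    neighbourhood, [t] the part in the smallest of [s] blocks, [W] the image of this part and [u]
    its gain. If [de] is small, all blocks carry nearly [t] points, and [u >= eps t] forces [de] to
    be at least of order [eps A / s^3]. *)
Lemma block_arith (R : realFieldType) (eps s d t A de u W : R) : (0 < eps -> eps <= 1 ->
  2 <= s -> 0 <= d -> d <= s -> 0 <= t -> 0 <= de -> (1 + eps) * t <= W -> W <= t + u ->
  A <= s * (t + 2 * s * de) -> s * t + u <= A + de + 2 * d * (2 * s * de) ->
  (1 + eps / (9 * s ^+ 3)) * A <= A + de)%R.
Proof.
move=> e0 e1 s2 d0 dds t0 de0 h1 h2 h3 h4.
have s0 : (0 < s)%R by lra.
have hu : (eps * t <= u)%R by move: h1 h2; lra.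
have k1 : ((s + eps) * t <= A + de + 4 * (d * s * de))%R by move: h4 hu; lra.
have k2 : (s * ((s + eps) * t) <= s * (A + de + 4 * (d * s * de)))%R by rewrite ler_pM2l.
have k3 : ((s + eps) * A <= (s + eps) * (s * (t + 2 * s * de)))%R by rewrite ler_pM2l//; lra.
have k4 : (eps * A <= de * (s + 4 * (d * s ^+ 2) + 2 * (s ^+ 2 * (s + eps))))%R by move: k2 k3; lra.
have k5 : (d * s ^+ 2 <= s * s ^+ 2)%R by apply: ler_wpM2r => //; apply: sqr_ge0.
have k6 : (s ^+ 2 * eps <= s ^+ 2 * 1)%R by apply: ler_wpM2l => //; apply: sqr_ge0.
have k7 : (2 * s ^+ 2 <= s * s ^+ 2)%R by apply: ler_wpM2r => //; apply: sqr_ge0.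
have k8 : (2 * s <= s * s)%R by apply: ler_wpM2r => //; apply: ltW.
have k9 : (s + 4 * (d * s ^+ 2) + 2 * (s ^+ 2 * (s + eps)) <= 9 * s ^+ 3)%R.
  by move: k5 k6 k7 k8 s2; lra.
have k10 := le_trans k4 (ler_wpM2l de0 k9).
have s3 : (0 < 9 * s ^+ 3)%R by rewrite mulr_gt0// exprn_gt0.
by rewrite mulrDl mul1r lerD2l mulrAC ler_pdivrMr.
Qed.

(** * From [d] monotone matchings to three: blocks along a path *)

Section block_graph.
Local Open Scope nat_scope.
Variables (n m d : nat) (E : nat -> rel nat).
Hypothesis n0 : 0 < n.
Local Notation s := (2 * m).
Hypothesis ds : d + 2 <= s.
Hypothesis sE : forall k, k < d -> strict (E k).

(** Blocks [1] to [d] carry one matching each, all others the identity. As [d + 2 <= s], both end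
    blocks are identity blocks, which closes the chain of inclusions between the blocks. *)
Definition layer p : rel nat := if (0 < p) && (p <= d) then E p.-1 else (fun i j => i == j).
Definition rel1 : rel nat := fun i j => (i %/ n == j %/ n) && layer (i %/ n) (i %% n) (j %% n).
Definition rel2 : rel nat := fun i j => j == i + n.
Definition rel3 : rel nat := fun i j => i == j + n.
Definition block_rel : rel nat := fun i j => [|| rel1 i j, rel2 i j | rel3 i j].

Lemma layer_strict p : strict (layer p).
Proof.
rewrite /layer; case: ifP => [/andP[p0 pd]|_]; last by move=> i j i' j' /eqP -> /eqP ->.
by apply: sE; lia.
Qed.

Lemma rel1_strict : strict rel1.
Proof.
have lex i j : (i < j) = (i %/ n < j %/ n) || (i %/ n == j %/ n) && (i %% n < j %% n).
  have hi := divn_eq i n; have hj := divn_eq j n.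
  have mi := ltn_pmod i n0; have mj := ltn_pmod j n0.
  move: (i %/ n) (i %% n) (j %/ n) (j %% n) hi hj mi mj => p x p' y -> -> xn yn.
  have [pp|pp|->] /= := ltngtP p p'.
  - by apply/idP; nia.
  - by apply/negbTE; rewrite -leqNgt; nia.
  - by rewrite ltn_add2l.
move=> i j i' j' /andP[/eqP p1 l1] /andP[/eqP p2 l2]; rewrite (lex i j) (lex i' j') -p1 -p2.
case: eqP => [e|_]; rewrite ?orbF//; congr (_ || _).
by rewrite -e in l2; apply: layer_strict l1 l2.
Qed.

Lemma rel2_strict : strict rel2.
Proof. by move=> i j i' j' /eqP -> /eqP ->; rewrite ltn_add2r. Qed.

Lemma rel3_strict : strict rel3.
Proof. by move=> i j i' j' /eqP -> /eqP ->; rewrite ltn_add2r. Qed.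

Variable a : pred nat.
Let nb := img (s * n) block_rel a.
Let Sb p i := a (p * n + i).
Let Nb p j := nb (p * n + j).

Lemma blk p i : i < n -> ((p * n + i) %/ n = p) /\ ((p * n + i) %% n = i).
Proof. by move=> i_n; rewrite divnMDl// divn_small// addn0 modnMDl modn_small. Qed.

Lemma blk_lt p i : p < s -> i < n -> p * n + i < s * n.
Proof. by move=> ps i_n; nia. Qed.

Let nb_up p j : p.+1 < s -> j < n -> Sb p j -> Nb p.+1 j.
Proof.
move=> ps jn h; apply/imgP; exists (p * n + j); split=> //; first by apply: blk_lt => //; lia.
by rewrite /block_rel /rel2 mulSn; apply/or3P/Or32; apply/eqP; lia.
Qed.

Let nb_down p j : p.+1 < s -> j < n -> Sb p.+1 j -> Nb p j.
Proof.
move=> ps jn h; apply/imgP; exists (p.+1 * n + j); split=> //; first exact: blk_lt.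
by rewrite /block_rel /rel3 mulSn; apply/or3P/Or33; apply/eqP; lia.
Qed.

Let nb_layer p i j : p < s -> i < n -> j < n -> Sb p i -> layer p i j -> Nb p j.
Proof.
move=> ps i_n jn h l; apply/imgP; exists (p * n + i); split=> //; first exact: blk_lt.
have [e1 e2] := blk p i_n; have [e3 e4] := blk p jn.
by apply/or3P/Or31; rewrite /rel1 e1 e2 e3 e4 eqxx.
Qed.

Let nb_first j : j < n -> Sb 0 j -> Nb 0 j.
Proof. by move=> jn h; apply: nb_layer h _ => //; [lia|rewrite /layer/=]. Qed.

Let nb_last j : j < n -> Sb s.-1 j -> Nb s.-1 j.
Proof.
move=> jn h; apply: nb_layer h _ => //; first by lia.
by rewrite /layer ifF//; apply/negbTE; lia.
Qed.

(** Pairs the blocks [2i] and [2i+1]. This permutes the blocks, and [N_p] always contains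
    [S_(pi p)]; hence the excess of the whole neighbourhood is the sum [dlt] of the local
    excesses. *)
Let pi p := if odd p then p.-1 else p.+1.

Let pi_sub p j : p < s -> j < n -> Sb (pi p) j -> Nb p j.
Proof.
move=> ps jn; rewrite /pi; case po : (odd p).
  case: p ps po => // p ps _ /=; exact: nb_up.
by apply: nb_down => //; lia.
Qed.

Let dlt := \sum_(p < s) cnt n (fun j => Nb p j && ~~ Sb (pi p) j).

Lemma sum_pairs_nat (F : nat -> nat) k : \sum_(p < 2 * k) F p = \sum_(i < k) (F (2 * i) + F (2 * i).+1).
Proof.
elim: k => [|k IH]; first by rewrite muln0 !big_ord0.
rewrite (_ : 2 * k.+1 = (2 * k).+2); last by lia.
by rewrite !big_ord_recr/= IH addnA.
Qed.

Let sum_N : \sum_(p < s) cnt n (Nb p) = \sum_(p < s) cnt n (Sb p) + dlt.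
Proof.
have -> : \sum_(p < s) cnt n (Sb p) = \sum_(p < s) cnt n (Sb (pi p)).
  rewrite (sum_pairs_nat (fun p => cnt n (Sb p))) (sum_pairs_nat (fun p => cnt n (Sb (pi p)))).
  by apply: eq_bigr => i _; rewrite /pi /= mul2n odd_double/= addnC.
rewrite -big_split/=; apply: eq_bigr => p _; apply: cnt_diff => j jn; exact: pi_sub.
Qed.

(** If [N_p] also contains [S_p'], then [S_p'] lies in [S_(pi p)] up to [dlt] points. The second
    neighbour on the path gives this from [2i+1] to [2i+3] and from [2i+2] to [2i]; the identity on
    the end blocks gives it from [0] to [1] and from [s-1] to [s-2]. These inclusions form one cycle
    [0, 1, 3, ..., s-1, s-2, ..., 2, 0] through all blocks, so any two blocks agree up to [O(s dlt)]
    points. *)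
Let D p p' := cnt n (fun j => Sb p j && ~~ Sb p' j).

Let D_tri p p1 p2 : D p p2 <= D p p1 + D p1 p2. Proof. exact: cnt_tri. Qed.

Let D_link p p' : p < s -> (forall j, j < n -> Sb p' j -> Nb p j) -> D p' (pi p) <= dlt.
Proof.
move=> ps H; rewrite /dlt (bigD1 (Ordinal ps))//= (leq_trans _ (leq_addr _ _))//.
by apply: cnt_le => j jn /andP[h1 h2]; rewrite H.
Qed.

Let pi_even i : pi (2 * i) = (2 * i).+1. Proof. by rewrite /pi mul2n odd_double. Qed.
Let pi_odd i : pi (2 * i).+1 = 2 * i. Proof. by rewrite /pi /= mul2n odd_double. Qed.
Let dbl i : 2 * i.+1 = (2 * i).+2. Proof. lia. Qed.

Let D_odd i : (2 * i.+1).+1 < s -> D (2 * i).+1 (2 * i.+1).+1 <= dlt.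
Proof.
move=> i_s; rewrite -(pi_even i.+1); apply: D_link => [|j jn h]; first by lia.
by rewrite dbl; apply: nb_up => //; lia.
Qed.

Let D_evn i : 2 * i.+1 < s -> D (2 * i.+1) (2 * i) <= dlt.
Proof.
move=> i_s; rewrite -(pi_odd i); apply: D_link => [|j jn h]; first by lia.
by apply: nb_down => //; [lia|rewrite -dbl].
Qed.

Let D_up i : (2 * i).+1 < s -> D 0 (2 * i).+1 <= i.+1 * dlt.
Proof.
elim: i => [|i IH] i_s.
  rewrite mul1n; have := @D_link 0 0; apply; first by lia.
  by move=> j jn; exact: nb_first.
apply: leq_trans (D_tri _ (2 * i).+1 _) _; rewrite mulSn addnC leq_add//; first exact: D_odd.
by apply: IH; lia.
Qed.

Let D_last i : (2 * i).+1 < s -> D (2 * i).+1 s.-1 <= (m - i) * dlt.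
Proof.
have [k] := ubnP (m - i); elim: k i => // k IH i ki i_s.
have [E1|E1] := eqVneq (2 * i).+1 s.-1.
  by rewrite E1 /D /cnt big1// => j _; rewrite andbN.
apply: leq_trans (D_tri _ (2 * i.+1).+1 _) _.
have -> : m - i = (m - i.+1).+1 by lia.
rewrite mulSn leq_add//; first by apply: D_odd; lia.
by apply: IH; lia.
Qed.

Let D_even i : 2 * i < s -> D s.-1 (2 * i) <= (m - i) * dlt.
Proof.
have [k] := ubnP (m - i); elim: k i => // k IH i ki i_s.
have [E1|E1] := eqVneq (2 * i) s.-2.
  have -> : m - i = 1 by lia.
  have e1 : s.-1 = (2 * i).+1 by lia.
  rewrite mul1n -(pi_odd i) -e1.
  by apply: D_link => [|j jn]; [lia|exact: nb_last].
apply: leq_trans (D_tri _ (2 * i.+1) _) _.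
have -> : m - i = (m - i.+1).+1 by lia.
rewrite mulSn addnC leq_add//; first by apply: D_evn; lia.
by apply: IH; lia.
Qed.

Let D_down i : 2 * i < s -> D (2 * i) 0 <= i * dlt.
Proof.
elim: i => [|i IH] i_s; first by rewrite /D /cnt big1// => j _; rewrite muln0 andbN.
apply: leq_trans (D_tri _ (2 * i) _) _; rewrite mulSn leq_add//; first exact: D_evn.
by apply: IH; lia.
Qed.

Let m0 : 0 < m. Proof. lia. Qed.
Let last_odd : s.-1 = (2 * m.-1).+1. Proof. lia. Qed.
Let twice x : x <= m * dlt + m * dlt -> x <= s * dlt.
Proof. by rewrite -mulnDl addnn -mul2n. Qed.

Let parity p : exists k, p = 2 * k \/ p = (2 * k).+1.
Proof.
exists p./2; have := odd_double_half p; rewrite -mul2n; case: (odd p) => pE; [right|left].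
  by rewrite -[LHS]pE.
by rewrite -[LHS]pE.
Qed.

Let D_from0 p : p < s -> D 0 p <= s * dlt.
Proof.
have [k [->|->]] := parity p => ks; apply: twice; last first.
  by apply: leq_trans (D_up ks) _; rewrite -mulnDl leq_mul2r; apply/orP; right; lia.
apply: leq_trans (D_tri _ s.-1 _) _; apply: leq_add.
  have h : D 0 (2 * m.-1).+1 <= m.-1.+1 * dlt by apply: D_up; lia.
  by move: h; rewrite -last_odd prednK.
by apply: leq_trans (D_even ks) _; rewrite leq_mul2r; apply/orP; right; lia.
Qed.

Let D_to0 p : p < s -> D p 0 <= s * dlt.
Proof.
have [k [->|->]] := parity p => ks; apply: twice.
  by apply: leq_trans (D_down ks) _; rewrite -mulnDl leq_mul2r; apply/orP; right; lia.
apply: leq_trans (D_tri _ s.-1 _) _; apply: leq_add.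
  by apply: leq_trans (D_last ks) _; rewrite leq_mul2r; apply/orP; right; lia.
by have := @D_even 0; rewrite muln0 subn0; apply; lia.
Qed.

Let D_all p p' : p < s -> p' < s -> D p p' <= 2 * s * dlt.
Proof.
move=> ps ps'; rewrite (leq_trans (cnt_tri _ _ (Sb 0) _))//.
by rewrite (leq_trans (leq_add (D_to0 ps) (D_from0 ps')))// addnn -mul2n mulnA.
Qed.

Definition union_rel : rel nat := fun i j => has (fun k => E k i j) (iota 0 d).

(** Block [k+1] receives [S_k] along the path and the image of [S_(k+1)] under [E k]; both [S_k] and
    [S_(k+1)] are close to [S_x]. *)
Let layer_gain x k : x < s -> k < d ->
  cnt n (Sb x) + cnt n (fun j => img n (E k) (Sb x) j && ~~ Sb x j) <=
  cnt n (Nb k.+1) + 2 * (2 * s * dlt).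
Proof.
move=> xs kd; have ks : k.+1 < s by lia.
pose X := fun j => Sb x j && Sb k j.
pose Y := fun j => img n (E k) (fun i => Sb x i && Sb k.+1 i) j && ~~ Sb x j.
have h1 : cnt n X + cnt n Y <= cnt n (Nb k.+1).
  rewrite -big_split/=; apply: leq_sum => j _; rewrite /X /Y.
  case: (boolP (Sb x j)) => /= [xj|_].
    rewrite andbF addn0; case: (boolP (Sb k j)) => // kj.
    by rewrite nb_up.
  rewrite andbT; case: imgP => // -[i [i_n /andP[_ Ski] Eij]].
  by rewrite (nb_layer ks i_n (ltn_ord j) Ski)// /layer /= kd.
have h2 : cnt n (Sb x) <= cnt n X + D x k.
  rewrite -big_split/=; apply: leq_sum => j _; rewrite /X.
  by case: (Sb x j); case: (Sb k j).
have h3 : cnt n (fun j => img n (E k) (Sb x) j && ~~ Sb x j) <= cnt n Y + D x k.+1.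
  rewrite (leq_trans _ (leq_add (leqnn _) (cnt_img n (fun i => Sb x i && ~~ Sb k.+1 i) (sE kd))))//.
  rewrite -big_split/=; apply: leq_sum => j _; rewrite /Y.
  case: (boolP (Sb x j)) => [_|_]; first by rewrite !andbF.
  rewrite !andbT; case: imgP => // -[i [i_n xi Eij]].
  case: (boolP (Sb k.+1 i)) => ki.
    by rewrite (_ : img _ _ _ _ = true)//; apply/imgP; exists i; rewrite xi ki.
  by rewrite [X in _ + X](_ : _ = 1) ?leq_addl// (_ : img _ _ _ _ = true)//; apply/imgP; exists i; rewrite xi ki.
have := D_all xs (ltnW ks); have := D_all xs ks; lia.
Qed.

Let sum_blocks_nat (X : pred nat) : cnt (s * n) X = \sum_(p < s) cnt n (fun i => X (p * n + i)).
Proof.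
elim: (s) => [|k IH]; first by rewrite mul0n /cnt !big_ord0.
rewrite big_ord_recr/= -IH mulSn addnC /cnt -!(big_mkord xpredT (fun i => (X i : nat))).
rewrite (@big_cat_nat _ _ _ (k * n) 0 (k * n + n))//=; last exact: leq_addr.
congr (_ + _); rewrite -{1}[k * n]add0n big_addn addnC addnK.
by rewrite -(big_mkord xpredT (fun i => (X (k * n + i) : nat))); apply: eq_bigr => i _; rewrite addnC.
Qed.

(** Take for [x] the block with the fewest points: it is at most half full whenever the whole set
    is. Summing [layer_gain] over [k < d] collects the gain of [union_rel], and each remaining block
    contributes at least the minimum. *)
Lemma block_count : exists x, [/\ x < s,
  s * cnt n (Sb x) <= cnt (s * n) a,
  cnt (s * n) a <= s * (cnt n (Sb x) + 2 * s * dlt),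
  cnt (s * n) nb = cnt (s * n) a + dlt &
  s * cnt n (Sb x) + cnt n (fun j => img n union_rel (Sb x) j && ~~ Sb x j) <=
  cnt (s * n) nb + 2 * d * (2 * s * dlt)].
Proof.
have s0 : 0 < s by lia.
case: (@arg_minnP _ (Ordinal s0) xpredT (fun p : 'I_s => cnt n (Sb p)) isT) => x _ xmin.
exists x; rewrite !sum_blocks_nat -/Nb; split=> //.
- rewrite -[X in X * _](card_ord s) -sum_nat_const; apply: leq_sum => p _; exact: xmin.
- rewrite -[X in _ <= X * _](card_ord s) -sum_nat_const; apply: leq_sum => p _.
  by apply: leq_trans (cnt_le_diff _ _ (Sb x)) _; rewrite leq_add2l; exact: D_all.
have gain k : k < d -> cnt n (Sb x) + cnt n (fun j => img n (E k) (Sb x) j && ~~ Sb x j) <=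
  cnt n (Nb k.+1) + 2 * (2 * s * dlt) by exact: layer_gain.
have rest p : p < s -> cnt n (Sb x) <= cnt n (Nb p).
  move=> ps; have ps' : pi p < s by rewrite /pi; case po : (odd p); lia.
  apply: leq_trans (xmin (Ordinal ps') isT) _; apply: cnt_le => j jn; exact: pi_sub.
have un : cnt n (fun j => img n union_rel (Sb x) j && ~~ Sb x j) <=
   \sum_(k < d) cnt n (fun j => img n (E k) (Sb x) j && ~~ Sb x j).
  rewrite /cnt exchange_big/=; apply: leq_sum => j _.
  case: (boolP (Sb x j)) => [_|xj]; first by rewrite andbF.
  rewrite andbT; case: imgP => // -[i [i_n xi /hasP[k kd Ekij]]].
  move: kd; rewrite mem_iota add0n => kd.
  rewrite (bigD1 (Ordinal kd))//= (_ : img n (E k) _ _ = true)//.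
  by apply/imgP; exists i.
apply: leq_trans (leq_add (leqnn _) un) _.
rewrite -(big_mkord xpredT (fun p => cnt n (Nb p))) big_ltn//.
rewrite (@big_cat_nat _ _ _ d.+1 1 s)//=; last by lia.
rewrite big_add1/= big_mkord.
have g1 : \sum_(k < d) (cnt n (Sb x) + cnt n (fun j => img n (E k) (Sb x) j && ~~ Sb x j)) <=
   \sum_(k < d) (cnt n (Nb k.+1) + 2 * (2 * s * dlt)) by apply: leq_sum => k _; exact: gain.
have g2 : (s - d.+1) * cnt n (Sb x) <= \sum_(d.+1 <= p < s) cnt n (Nb p).
  rewrite -sum_nat_const_nat big_nat_cond [X in _ <= X]big_nat_cond.
  by apply: leq_sum => p /andP[/andP[_ ps] _]; exact: rest.
have g3 := rest 0 s0.
move: g1 g2 g3; rewrite !big_split/= !sum_nat_const !card_ord.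
move: (\sum_(k < d) cnt n (Nb k.+1)) (\sum_(d.+1 <= p < s) cnt n (Nb p)) (\sum_(_ < d) _) => u1 u2 u3.
move: (cnt n (Sb x)) (cnt n (Nb 0)) (2 * s * dlt) => t u0 be g1 g2 g3.
have -> : s * t = t + d * t + (s - d.+1) * t by rewrite -{2}[t]mul1n -!mulnDl; congr (_ * _); lia.
lia.
Qed.

Lemma block_expansion (R : realFieldType) (eps : R) : (0 < eps)%R -> (eps <= 1)%R ->
  (forall t : pred nat, 2 * cnt n t <= n ->
     ((1 + eps) * (cnt n t)%:R <= (cnt n (img n union_rel t))%:R :> R)%R) ->
  2 * cnt (s * n) a <= s * n ->
  ((1 + eps / (9 * s%:R ^+ 3)) * (cnt (s * n) a)%:R <= (cnt (s * n) nb)%:R :> R)%R.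
Proof.
move=> e0 e1 H an; have [x [xs h1 h2 h3 h4]] := block_count.
have xn : 2 * cnt n (Sb x) <= n.
  have s0 : 0 < s by lia.
  by rewrite -(leq_pmul2l s0) mulnCA (leq_trans _ an)// leq_mul2l h1 orbT.
have U := H _ xn.
have g1 : ((cnt n (img n union_rel (Sb x)))%:R <=
   (cnt n (Sb x))%:R + (cnt n (fun j => img n union_rel (Sb x) j && ~~ Sb x j))%:R :> R)%R.
  by rewrite -natrD ler_nat; exact: cnt_le_diff.
have s2 : (2 <= s%:R :> R)%R by rewrite ler_nat; lia.
have dds : (d%:R <= s%:R :> R)%R by rewrite ler_nat; lia.
rewrite h3 natrD; rewrite h3 in h4.
move: h2 h4; rewrite -!(ler_nat R) => h2 h4.
apply: (@block_arith R eps s%:R d%:R _ _ _ _ _ e0 e1 s2 _ dds _ _ U g1).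
- exact: ler0n.
- exact: ler0n.
- exact: ler0n.
- by rewrite -!natrM -natrD -natrM.
- by rewrite -!natrM -!natrD.
Qed.

End block_graph.

(** * From relations on integers to bipartite graphs *)

Section graph_of_relation.
Local Open Scope nat_scope.
Variable n : nat.

Definition graph_of (E : rel nat) : bigraph n n := fun v w => E v w.

Lemma strict_matching (E : rel nat) : strict E ->
  is_monotone_matching 1 1 [set e : 'I_n * 'I_n | E e.1 e.2].
Proof.
move=> sE; split=> [e f|e f]; rewrite !inE => h1 h2; last first.
  by rewrite !perm1 (sE _ _ _ _ h1 h2) => -[] h; rewrite ltnNge (ltnW h).
move=> ef; have a1 := sE _ _ _ _ h1 h2; have a2 := sE _ _ _ _ h2 h1.
apply/andP; split; apply/negP => /eqP/(congr1 val)/= e1; case/negP: ef; apply/eqP;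
  case: e f e1 h1 h2 a1 a2 => [x y] [x' y']/= e1 h1 h2 a1 a2; congr pair; apply: val_inj => //=.
- by move: a1 a2; rewrite e1 ltnn; case: ltngtP.
- by move: a1 a2; rewrite e1 ltnn; case: ltngtP.
Qed.

Lemma union_monotone (E : 'I_3 -> rel nat) (F : rel nat) : (forall k, strict (E k)) ->
  (forall i j, F i j = [|| E 0%R i j, E 1%R i j | E 2%:R%R i j]) -> d_monotone 3 (graph_of F).
Proof.
move=> sE FE; exists 1%g, 1%g, (fun k => [set e : 'I_n * 'I_n | E k e.1 e.2]); split=> [k|v w].
  exact: strict_matching.
rewrite /graph_of FE; split=> [/or3P[] h|[k]].
- by exists 0%R; rewrite inE.
- by exists 1%R; rewrite inE.
- by exists 2%:R%R; rewrite inE.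
rewrite inE /= => h; apply/or3P; case: k h => [[|[|[|]]]//] k3 h.
- by apply: Or31; rewrite (_ : 0%R = Ordinal k3)//; apply: val_inj.
- by apply: Or32; rewrite (_ : 1%R = Ordinal k3)//; apply: val_inj.
- by apply: Or33; rewrite (_ : 2%:R%R = Ordinal k3)//; apply: val_inj.
Qed.

Lemma expander_of (R : realFieldType) (eps : R) (E : rel nat) :
  (forall a : pred nat, 2 * cnt n a <= n ->
     ((1 + eps) * (cnt n a)%:R <= (cnt n (img n E a))%:R :> R)%R) ->
  bip_expander eps (graph_of E).
Proof.
move=> H; split=> // S Sn; pose a i := [exists v in S, val v == i].
have aE (v : 'I_n) : a v = (v \in S).
  apply/existsP/idP => [[u /andP[uS /eqP/val_inj <-]]//|vS].
  by exists v; rewrite vS eqxx.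
have cS : cnt n a = #|S|.
  by rewrite /cnt -sum1_card [RHS]big_mkcond/=; apply: eq_bigr => i _; rewrite aE; case: (i \in S).
have cN : cnt n (img n E a) = #|nbhd (graph_of E) S|.
  rewrite /cnt -sum1_card [RHS]big_mkcond/=; apply: eq_bigr => j _; rewrite inE.
  rewrite (_ : img n E a j = [exists v in S, graph_of E v j]); first by case: ifP.
  apply/imgP/existsP => [[i [i_n ai Eij]]|[v /andP[vS vj]]].
    by exists (Ordinal i_n); rewrite -aE/= ai.
  by exists v; rewrite ltn_ord aE.
by rewrite -cS -cN; apply: H; rewrite cS mulnC.
Qed.

End graph_of_relation.

Lemma block_expander (R : realFieldType) (eps : R) (n m d : nat) (E : nat -> rel nat) :
  0 < n -> d + 2 <= 2 * m -> (forall k, k < d -> strict (E k)) ->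
  (0 < eps)%R -> (eps <= 1)%R ->
  (forall t : pred nat, 2 * cnt n t <= n ->
     ((1 + eps) * (cnt n t)%:R <= (cnt n (img n (union_rel d E) t))%:R :> R)%R) ->
  exists G : bigraph (2 * m * n) (2 * m * n),
    bip_expander (eps / (9 * (2 * m)%:R ^+ 3))%R G /\ d_monotone 3 G.
Proof.
move=> n0 dm sE e0 e1 H; exists (@graph_of _ (block_rel n d E)); split.
  by apply: expander_of => a; exact: block_expansion.
(* The third relation is the default value of [nth]. *)
apply: (@union_monotone _ (fun k : 'I_3 => nth (rel3 n) [:: rel1 n d E; rel2 n] k)) => //.
move=> k; move: (nat_of_ord k) => {k} [|[|k]]; rewrite [nth _ _ _]/=.
- exact: (rel1_strict n0 dm sE).
- exact: rel2_strict.
- by case: k => [|k]; exact: rel3_strict.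
Qed.

Import numFieldNormedType.Exports.
Local Open Scope classical_set_scope.
Local Open Scope ring_scope.

(** * Square-integrable real functions on the line *)

Section L2.
Context (R : realType).
Local Notation mu := (@lebesgue_measure R).
Implicit Types (f g h : R -> R).

Definition integ f : R := \int[mu]_x f x.
Definition intble f := mu.-integrable setT (EFin \o f).
Definition L2 f := measurable_fun setT f /\ intble (fun x => f x ^+ 2).
Definition ip f g : R := integ (fun x => f x * g x).
(** Equality off a finite set rather than almost everywhere: the exceptional points are poles and
    their preimages, and finiteness survives composition with Moebius maps. *)
Definition eqf f g := exists s : seq R, forall x, x \notin s -> f x = g x.

Lemma intbleP f : intble f -> measurable_fun setT f.
Proof. by move=> /integrableP[/measurable_EFinP]. Qed.

Lemma intble_le f g : measurable_fun setT f -> intble g ->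
  (forall x, `|f x| <= g x) -> intble f.
Proof.
move=> mf ig fg; apply: (@le_integrable _ _ R mu setT _ _ (EFin \o g)) => //.
  exact/measurable_EFinP.
by move=> x _ /=; rewrite lee_fin (le_trans (fg x))// ler_norm.
Qed.

Lemma intbleD f g : intble f -> intble g -> intble (fun x => f x + g x).
Proof. by move=> i1 i2; have := integrableD measurableT i1 i2; apply: eq_integrable. Qed.

Lemma intbleZ (k : R) f : intble f -> intble (fun x => k * f x).
Proof. by move=> i1; have := integrableZl measurableT k i1; apply: eq_integrable. Qed.

Lemma intD f g : intble f -> intble g -> integ (fun x => f x + g x) = integ f + integ g.
Proof. by move=> i1 i2; rewrite /integ RintegralD. Qed.

Lemma intZ (k : R) f : intble f -> integ (fun x => k * f x) = k * integ f.
Proof. by move=> i1; rewrite /integ RintegralZl. Qed.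

Lemma int_ge0 f : (forall x, 0 <= f x) -> 0 <= integ f.
Proof. by move=> f0; apply: Rintegral_ge0. Qed.

Lemma int_le f g : intble f -> intble g -> (forall x, f x <= g x) -> integ f <= integ g.
Proof. by move=> i1 i2 fg; apply: le_Rintegral. Qed.

Lemma mu_seq (s : seq R) : mu.-negligible [set` s].
Proof.
have cs : countable ([set` s] : set R) by apply: finite_set_countable; exact: finite_seq.
exists [set` s]; split=> //.
  by apply: countable_measurable => //; exact: measurable_set1.
exact: countable_lebesgue_measure0.
Qed.

Lemma eqf_ae f g : eqf f g -> ae_eq mu setT (EFin \o f) (EFin \o g).
Proof.
move=> [s fg]; have [A [mA A0 sA]] := mu_seq s; exists A; split=> //.
apply: subset_trans sA => x /= /not_implyP[_]; apply: contra_notP => /negP /fg fgx.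
by rewrite fgx.
Qed.

Lemma int_eqf f g : measurable_fun setT f -> measurable_fun setT g ->
  eqf f g -> integ f = integ g.
Proof.
move=> mf mg /eqf_ae fg; congr fine.
by apply: (@ae_eq_integral _ (measurableTypeR R) R mu setT _ (EFin \o f)) => //;
  exact/measurable_EFinP.
Qed.

Lemma eqf_refl f : eqf f f. Proof. by exists [::]. Qed.
Lemma eqf_sym f g : eqf f g -> eqf g f.
Proof. by move=> [s h]; exists s => x /h. Qed.
Lemma eqf_trans f g h : eqf f g -> eqf g h -> eqf f h.
Proof.
move=> [s fg] [t gh]; exists (s ++ t) => x.
by rewrite mem_cat negb_or => /andP[/fg -> /gh ->].
Qed.

Lemma L2M f g : L2 f -> L2 g -> intble (fun x => f x * g x).
Proof.
move=> [mf f2] [mg g2]; apply: (intble_le _ (intbleD f2 g2)).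
  exact: measurable_funM.
move=> x; rewrite ler_norml; have := sqr_ge0 (f x + g x); have := sqr_ge0 (f x - g x).
have := sqr_ge0 (f x); have := sqr_ge0 (g x); nra.
Qed.

Lemma L2D f g : L2 f -> L2 g -> L2 (fun x => f x + g x).
Proof.
move=> Lf Lg; have [mf f2] := Lf; have [mg g2] := Lg; split; first exact: measurable_funD.
apply: (intble_le _ (intbleD (intbleZ 2 f2) (intbleZ 2 g2))).
  by apply: measurable_funX; exact: measurable_funD.
move=> x; rewrite ger0_norm ?sqr_ge0//; have := sqr_ge0 (f x - g x); nra.
Qed.

Lemma L2Z (k : R) f : L2 f -> L2 (fun x => k * f x).
Proof.
move=> [mf f2]; split; first exact: measurable_funM.
have := intbleZ (k ^+ 2) f2; apply: eq_integrable => // x _ /=.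
by rewrite exprMn.
Qed.

Lemma L2B f g : L2 f -> L2 g -> L2 (fun x => f x - g x).
Proof.
move=> Lf Lg; have := L2D Lf (L2Z (-1) Lg).
by congr L2; apply/funext => x; rewrite mulN1r.
Qed.

Lemma intble0 : intble (fun=> 0).
Proof. exact: integrable0. Qed.

Lemma L20 : L2 (fun=> 0).
Proof.
split=> //; have := intble0; by congr intble; apply/funext => x; rewrite expr0n.
Qed.

Lemma L2sum (I : Type) (r : seq I) (F : I -> R -> R) :
  (forall i, L2 (F i)) -> L2 (fun x => \sum_(i <- r) F i x).
Proof.
move=> LF; elim: r => [|i r IH].
  by have := L20; congr L2; apply/funext => x; rewrite big_nil.
have := L2D (LF i) IH; congr L2; apply/funext => x; by rewrite big_cons.
Qed.

Lemma ipC f g : ip f g = ip g f.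
Proof. by congr (integ _); apply/funext => x; rewrite mulrC. Qed.

Lemma ipDl f g h : L2 f -> L2 g -> L2 h ->
  ip (fun x => f x + g x) h = ip f h + ip g h.
Proof.
move=> Lf Lg Lh; rewrite /ip -intD; [|exact: L2M|exact: L2M].
by congr (integ _); apply/funext => x; rewrite mulrDl.
Qed.

Lemma ipZl (k : R) f g : L2 f -> L2 g -> ip (fun x => k * f x) g = k * ip f g.
Proof.
move=> Lf Lg; rewrite /ip -intZ; last exact: L2M.
by congr (integ _); apply/funext => x; rewrite mulrA.
Qed.

Lemma ipBl f g h : L2 f -> L2 g -> L2 h ->
  ip (fun x => f x - g x) h = ip f h - ip g h.
Proof.
move=> Lf Lg Lh; rewrite -[- ip g h]mulN1r -ipZl// -ipDl//; last exact: L2Z.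
by congr (ip _ h); apply/funext => x; rewrite mulN1r.
Qed.

Lemma ipDr f g h : L2 f -> L2 g -> L2 h ->
  ip h (fun x => f x + g x) = ip h f + ip h g.
Proof. by move=> *; rewrite ipC ipDl// ipC (ipC g). Qed.
Lemma ipBr f g h : L2 f -> L2 g -> L2 h ->
  ip h (fun x => f x - g x) = ip h f - ip h g.
Proof. by move=> *; rewrite ipC ipBl// ipC (ipC g). Qed.
Lemma ipZr (k : R) f g : L2 f -> L2 g -> ip f (fun x => k * g x) = k * ip f g.
Proof. by move=> *; rewrite ipC ipZl// ipC. Qed.

Lemma ip0l f : ip (fun=> 0) f = 0.
Proof.
rewrite /ip (_ : (fun x => _) = (fun=> 0)); last by apply/funext => x; rewrite mul0r.
by rewrite /integ /Rintegral integral0.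
Qed.

Lemma ip_suml (I : Type) (r : seq I) (F : I -> R -> R) h :
  (forall i, L2 (F i)) -> L2 h ->
  ip (fun x => \sum_(i <- r) F i x) h = \sum_(i <- r) ip (F i) h.
Proof.
move=> LF Lh; elim: r => [|i r IH].
  rewrite big_nil -[RHS](ip0l h); congr (ip _ h); by apply/funext => x; rewrite big_nil.
rewrite big_cons -IH -ipDl//; last exact: L2sum.
by congr (ip _ h); apply/funext => x; rewrite big_cons.
Qed.

Lemma ip_sumr (I : Type) (r : seq I) (F : I -> R -> R) h :
  (forall i, L2 (F i)) -> L2 h ->
  ip h (fun x => \sum_(i <- r) F i x) = \sum_(i <- r) ip h (F i).
Proof. by move=> LF Lh; rewrite ipC ip_suml//; apply: eq_bigr => i _; rewrite ipC. Qed.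

Lemma ip_ge0 f : 0 <= ip f f.
Proof. by apply: int_ge0 => x; rewrite -expr2 sqr_ge0. Qed.

Lemma ip_eqf f f' g g' : L2 f -> L2 f' -> L2 g -> L2 g' ->
  eqf f f' -> eqf g g' -> ip f g = ip f' g'.
Proof.
move=> [mf _] [mf' _] [mg _] [mg' _] [s sf] [t tg].
apply: int_eqf; try exact: measurable_funM.
by exists (s ++ t) => x; rewrite mem_cat negb_or => /andP[/sf -> /tg ->].
Qed.

Lemma cauchy_schwarz f g : L2 f -> L2 g -> ip f g ^+ 2 <= ip f f * ip g g.
Proof.
move=> Lf Lg.
have Q t : 0 <= ip f f - 2 * t * ip f g + t ^+ 2 * ip g g.
  have := ip_ge0 (fun x => f x - t * g x).
  have Ltg := L2Z t Lg.
  rewrite ipBl//; last exact: L2B.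
  rewrite !ipBr// !ipZr// !ipZl// (ipC g f).
  by move/le_trans; apply; rewrite le_eqVlt; apply/orP; left; apply/eqP; ring.
have [g0|g0] := eqVneq (ip g g) 0.
  rewrite g0 mulr0; have [fg0|fg0] := eqVneq (ip f g) 0.
    by rewrite fg0 expr0n.
  (* With [ip g g = 0] the nonnegative form is affine in [t], and this value of [t] would make it
     [-1]. *)
  have := Q ((ip f f + 1) / (2 * ip f g)); rewrite g0 mulr0 addr0.
  rewrite [2 * _ * _](_ : _ = ip f f + 1); first by lra.
  by field.
have gp : 0 < ip g g by rewrite lt_neqAle eq_sym g0 ip_ge0.
have := Q (ip f g / ip g g).
rewrite [X in 0 <= X](_ : _ = (ip f f * ip g g - ip f g ^+ 2) / ip g g); last by field.
by rewrite pmulr_lge0 ?invr_gt0// subr_ge0.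
Qed.

End L2.

(** * Change of variables from the measure of intervals *)

Section push.
Context (R : realType).
Local Notation mu := (@lebesgue_measure R).
Variables (p J : R -> R).
Hypotheses (mp : measurable_fun setT p) (mJ : measurable_fun setT J).
Hypothesis J0 : forall x, 0 <= J x.

(** The image under [p] of the measure with density [J]. Once it agrees with Lebesgue measure on
    intervals the two are equal, and the change of variables holds for all nonnegative measurable
    functions, without cutting the line at the singularities of [p]. *)
Definition push (A : set (measurableTypeR R)) : \bar R := (\int[mu]_(x in p @^-1` A) (J x)%:E)%E.

Let mpre (A : set R) : measurable A -> measurable (p @^-1` A).
Proof. by move=> mA; rewrite -[_ @^-1` _]setTI; exact: mp. Qed.

Let push0 : push set0 = 0%E.
Proof. by rewrite /push preimage_set0 integral_set0. Qed.

Let push_ge0 A : (0 <= push A)%E.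
Proof. by apply: integral_ge0 => x _; rewrite lee_fin. Qed.

Import HBNNSimple.

Let push_sigma_additive : semi_sigma_additive push.
Proof.
move=> /= F mF tF mUF; rewrite /push; apply: cvg_toP.
  apply: ereal_nondecreasing_is_cvgn => m n mn.
  by apply: lee_sum_nneg_natr => // k _ _; exact: push_ge0.
rewrite preimage_bigcup ge0_integral_bigcup//=.
- by move=> k; exact: (mpre (mF k)).
- by apply: measurable_funTS; exact/measurable_EFinP.
- by move=> x _; rewrite lee_fin.
- apply/trivIsetP => i j _ _ ij; move/trivIsetP: tF => /(_ i j Logic.I Logic.I ij) Fij.
  by rewrite -preimage_setI Fij preimage_set0.
Qed.

HB.instance Definition _ := isMeasure.Build _ _ _ push push0 push_ge0 push_sigma_additive.

Lemma pushU A B : measurable A -> measurable B -> A `&` B = set0 ->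
  push (A `|` B) = (push A + push B)%E.
Proof. by move=> mA mB AB; exact: measureU. Qed.

Hypothesis push_itv : forall a b, a < b -> push `]a, b] = (b - a)%:E.

Lemma push_lebesgue A : measurable A -> push A = mu A.
Proof.
move=> mA; apply/esym/lebesgue_measure_unique => // _ [[a b]] _ <- /=.
rewrite lebesgue_measure_itv /= lte_fin; case: ifPn => [ab|]; first by rewrite push_itv.
rewrite -leNgt => ba; rewrite set_itv_ge ?push0//.
by rewrite bnd_simp -leNgt.
Qed.

Let push_indic (A : set R) : measurable A ->
  (\int[mu]_x (\1_A (p x) * J x)%:E = \int[mu]_x (\1_A x)%:E)%E.
Proof.
move=> mA; transitivity (push A); last by rewrite integral_indic// setIT push_lebesgue.
rewrite /push [RHS]integral_mkcond.
apply: eq_integral => x _; rewrite patchE indicE.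
have -> : (x \in p @^-1` A) = (p x \in A) by [].
by case: (p x \in A); rewrite ?mul1r ?mul0r.
Qed.

Let push_nnsfun (f : {nnsfun R >-> R}) :
  (\int[mu]_x (f (p x) * J x)%:E = \int[mu]_x (f x)%:E)%E.
Proof.
have mf k : measurable (f @^-1` [set k]) by exact: measurable_funPTI.
transitivity (\int[mu]_x (\sum_(k \in range f)
    (k * (\1_(f @^-1` [set k]) (p x) * J x))%:E))%E.
  apply: eq_integral => x _; rewrite fimfunE fsumEFin//; congr (_%:E).
  rewrite mulrC fsbig_distrr//=; apply: eq_fsbigr => k _.
  by rewrite mulrC mulrA.
rewrite ge0_integral_fsum//; last 2 first.
- move=> k; apply/measurable_EFinP; apply: measurable_funM => //.
  apply: measurable_funM => //; apply: measurableT_comp => //.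
- move=> k x _; rewrite lee_fin indicE.
  case: (boolP (p x \in _)) => [|_]; last by rewrite mul0r mulr0.
  by rewrite inE/= => <-; rewrite mul1r mulr_ge0.
under [RHS]eq_integral do rewrite fimfunE -fsumEFin//.
rewrite ge0_integral_fsum//; last 2 first.
- move=> k; apply/measurable_EFinP; apply: measurable_funM => //.
  by apply: measurable_indic; exact: mf.
- move=> k x _; rewrite lee_fin indicE.
  case: (boolP (x \in _)) => [|_]; last by rewrite mulr0.
  by rewrite inE/= => <-; rewrite mulr1.
apply: eq_fsbigr => k kf.
have k0 : 0 <= k by move: kf; rewrite inE => -[x _ <-].
under [LHS]eq_integral do rewrite EFinM.
under [RHS]eq_integral do rewrite EFinM.
rewrite !ge0_integralZl//.
- by rewrite push_indic.
- by apply/measurable_EFinP; apply: measurable_indic; exact: mf.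
- apply/measurable_EFinP/measurable_funM => //; apply: measurableT_comp => //.
- by move=> x _; rewrite lee_fin mulr_ge0.
Qed.

Lemma push_integral (G : R -> R) : measurable_fun setT G -> (forall x, 0 <= G x) ->
  (\int[mu]_x (G (p x) * J x)%:E = \int[mu]_x (G x)%:E)%E.
Proof.
move=> mG G0.
have mG' : measurable_fun setT (EFin \o G) by exact/measurable_EFinP.
pose f_ := nnsfun_approx measurableT mG'.
have mfn n : measurable_fun setT (f_ n : R -> R) by [].
have ndf (x : R) m n : (m <= n)%N -> f_ m x <= f_ n x.
  by move=> mn; exact/lefP/nd_nnsfun_approx.
have cf x : (f_ n x)%:E @[n --> \oo] --> (G x)%:E.
  by apply: (cvg_nnsfun_approx measurableT mG') => // y _; rewrite lee_fin.
transitivity (limn (fun n => \int[mu]_x (f_ n (p x) * J x)%:E))%E.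
  rewrite -monotone_convergence//=.
  - apply: eq_integral => x _; apply/esym/cvg_lim => //=.
    under eq_fun do rewrite EFinM.
    by rewrite EFinM; apply: cvgeM => //; exact: cvg_cst.
  - by move=> n; apply/measurable_EFinP/measurable_funM => //; exact: measurableT_comp.
  - by move=> n x _; rewrite lee_fin mulr_ge0.
  - move=> x _ m n mn; rewrite lee_fin ler_wpM2r//; exact: ndf.
under eq_fun do rewrite push_nnsfun.
rewrite -monotone_convergence//=.
- by apply: eq_integral => x _; apply/cvg_lim => //=; exact: cf.
- by move=> n; apply/measurable_EFinP; exact: mfn.
- by move=> n x _; rewrite lee_fin.
- by move=> x _ m n mn; rewrite lee_fin; exact: ndf.
Qed.

End push.

(** * Change of variables for affine maps and for the inversion *)

Section affine_inversion.
Context (R : realType).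
Local Notation mu := (@lebesgue_measure R).

Lemma measurable_invr : measurable_fun setT (@GRing.inv R).
Proof.
have m0 : measurable [set x : R | x != 0].
  rewrite (_ : [set x | _] = ~` [set 0]); first exact: measurableC.
  by apply/seteqP; split=> x /= /eqP.
have -> : [set: R] = [set x : R | x != 0] `|` [set 0].
  apply/seteqP; split=> x //= _; by case: (eqVneq x 0) => h; [right|left].
apply/measurable_funU => //; split; last exact: measurable_fun_set1.
apply: subspace_continuous_measurable_fun => //.
apply: continuous_in_subspaceT => x; rewrite inE/= => x0.
exact: inv_continuous.
Qed.

Lemma integral_affine (a b : R) (G : R -> R) : 0 < a ->
  measurable_fun setT G -> (forall x, 0 <= G x) ->
  (\int[mu]_x (G (a * x + b) * a)%:E = \int[mu]_x (G x)%:E)%E.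
Proof.
move=> a0 mG G0; apply: (push_integral (p := fun x => a * x + b) (J := fun=> a)) => //.
- by apply: measurable_funD => //; exact: measurable_funM.
- by move=> _; exact: ltW.
move=> c d cd; rewrite /push.
have -> : (fun x => a * x + b) @^-1` `]c, d] = `](c - b) / a, (d - b) / a]%classic.
  apply/seteqP; split=> x /=; rewrite !in_itv/= ltr_pdivrMr// ler_pdivlMr//.
    by rewrite ltrBlDr lerBrDr mulrC.
  by rewrite ltrBlDr lerBrDr mulrC.
rewrite integral_cst//= lebesgue_measure_itv/= lte_fin.
rewrite ltr_pM2r ?invr_gt0// ltrD2r cd -EFinD -EFinM; congr (_%:E).
by field; rewrite gt_eqF.
Qed.

(** The inversion, with derivative [x^-2]. The convention [0^-1 = 0] makes it fix [0], a point of
    measure zero. *)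
Let F (x : R) := - x^-1.

Let derF (x : R) : x != 0 -> is_derive x 1 F ((x ^+ 2)^-1).
Proof.
move=> x0; have := is_deriveN (is_deriveV x0 (is_derive_id x 1)).
by rewrite scaleNr opprK /GRing.scale/= mulr1.
Qed.

Let tail (y : R) : 0 < y ->
  (\int[mu]_(x in `[y, +oo[) ((x ^+ 2)^-1)%:E = (y^-1)%:E)%E.
Proof.
move=> y0; rewrite (@ge0_continuous_FTC2y R (fun x => (x ^+ 2)^-1) F y 0).
- by rewrite /F -EFinB sub0r opprK.
- by move=> x _; rewrite invr_ge0 sqr_ge0.
- apply: continuous_in_subspaceT => x; rewrite inE/= in_itv/= andbT => yx.
  by apply: cvgV; [rewrite sqrf_eq0 gt_eqF// (lt_le_trans y0)|exact: exprn_continuous].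
- rewrite -oppr0; apply: cvgN; apply/(@gtr0_cvgV0 R R); last exact: cvg_id.
  exact: nbhs_pinfty_gt.
- move=> x yx; have := @derF x; rewrite gt_eqF ?(lt_trans y0)// => /(_ isT) [] //.
- apply: cvg_at_right_filter; apply: cvgN; apply: inv_continuous; exact: lt0r_neq0.
- move=> x; rewrite in_itv/= andbT => yx; rewrite derive1E.
  by have := @derF x; rewrite gt_eqF ?(lt_trans y0)// => /(_ isT) [].
Qed.

Let tailN (y : R) : 0 < y ->
  (\int[mu]_(x in `]-oo, (- y)%R]) ((x ^+ 2)^-1)%:E = (y^-1)%:E)%E.
Proof.
move=> y0; rewrite ge0_integration_by_substitutionNy.
- by rewrite -tail//; apply: eq_integral => x _; rewrite /= sqrrN.
- apply: continuous_in_subspaceT => x; rewrite inE/= in_itv/= => yx.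
  apply: cvgV; last exact: exprn_continuous.
  by rewrite sqrf_eq0 lt_eqF// (le_lt_trans yx)// oppr_lt0.
- by move=> x _; rewrite invr_ge0 sqr_ge0.
Qed.

Let mF : measurable_fun setT F.
Proof. by apply: measurableT_comp => //; exact: measurable_invr. Qed.

Let mJ : measurable_fun setT (fun x : R => (x ^+ 2)^-1).
Proof. by apply: measurableT_comp; [exact: measurable_invr|exact: exprn_measurable]. Qed.

Let nu := push F (fun x => (x ^+ 2)^-1).

Let nu_pos (b : R) : 0 < b -> nu `]0, b] = b%:E.
Proof.
move=> b0; rewrite /nu /push -[in RHS](invrK b) -tailN ?invr_gt0//; congr (integral _ _ _).
apply/seteqP; split=> x /=; rewrite /F !in_itv/=.
  rewrite oppr_gt0 invr_lt0 => /andP[x0]; rewrite lerNl => h.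
  by rewrite -(invrK x) -invrN lef_nV2// ?posrE ?negrE ?oppr_lt0 ?invr_lt0.
move=> xb; have x0 : x < 0 by rewrite (le_lt_trans xb)// oppr_lt0 invr_gt0.
by rewrite oppr_gt0 invr_lt0 x0/= lerNl -(invrK (- b)) lef_nV2// ?negrE ?invrN// oppr_lt0 invr_gt0.
Qed.

Let nu_neg (a : R) : a < 0 -> nu `]a, 0[ = (- a)%:E.
Proof.
move=> a0; rewrite /nu /push -[in RHS](invrK (- a)) -tail ?invr_gt0 ?oppr_gt0//.
rewrite -[in RHS]integral_itv_obnd_cbnd; last first.
  by apply/measurable_EFinP; exact: measurable_funTS.
congr (integral _ _ _).
apply/seteqP; split=> x /=; rewrite /F !in_itv/= andbT.
  rewrite oppr_lt0 invr_gt0 => /andP[h x0]; rewrite -(invrK x) ltf_pV2 ?posrE ?oppr_gt0 ?invr_gt0//.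
  by rewrite ltrNr.
move=> xa; have x0 : 0 < x by rewrite (lt_trans _ xa)// invr_gt0 oppr_gt0.
by rewrite oppr_lt0 invr_gt0 x0 andbT ltrNr -(invrK (- a)) ltf_pV2// ?posrE ?invr_gt0 ?oppr_gt0.
Qed.

Let nu0 : nu [set 0] = 0%E.
Proof.
rewrite /nu /push (_ : F @^-1` [set 0] = [set 0]) ?integral_set1//.
apply/seteqP; split=> x /=; first by move/eqP; rewrite /F oppr_eq0 invr_eq0 => /eqP.
by move=> ->; rewrite /F invr0 oppr0.
Qed.

Let J0 (x : R) : 0 <= (x ^+ 2)^-1. Proof. by rewrite invr_ge0 sqr_ge0. Qed.

Let nuU A B : measurable A -> measurable B -> A `&` B = set0 ->
  nu (A `|` B) = (nu A + nu B)%E.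
Proof. exact: pushU. Qed.

Let nu_neg' (a : R) : a < 0 -> nu `]a, 0] = (- a)%:E.
Proof.
move=> a0; rewrite -[RHS]adde0 -nu0 -nu_neg// -nuU//.
  congr nu; apply/seteqP; split=> x /=; rewrite !in_itv/=.
    by move=> /andP[ax]; rewrite le_eqVlt => /orP[/eqP ->|x0]; [right|left; rewrite ax x0].
  by case=> [/andP[-> /ltW ->]//|->]; rewrite a0 lexx.
by apply/seteqP; split=> x //=; rewrite in_itv/= => -[/andP[_ x0] x00]; rewrite x00 ltxx in x0.
Qed.

(** The preimage of an interval with end point [0] is a half line, up to a null set, and [x^-2]
    integrates explicitly there; every other interval is a union or a difference of two such
    intervals. *)
Lemma integral_inversion (G : R -> R) :
  measurable_fun setT G -> (forall x, 0 <= G x) ->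
  (\int[mu]_x (G (- x^-1) * (x ^+ 2)^-1)%:E = \int[mu]_x (G x)%:E)%E.
Proof.
move=> mG G0; apply: (push_integral (p := F) (J := fun x => (x ^+ 2)^-1)) => //.
have cut a c b : a < c -> c < b -> (nu `]a, b] = nu `]a, c] + nu `]c, b])%E.
  move=> ac cb; rewrite -nuU//.
    congr nu; apply/seteqP; split=> x /=; rewrite !in_itv/=.
      by move=> /andP[ax xb]; case: (leP x c) => xc; [left|right]; rewrite ?ax ?xb.
    by case=> /andP[h1 h2]; rewrite ?h1 ?h2 ?andbT/= ?(le_trans h2 (ltW cb)) ?(lt_trans ac h1).
  apply/seteqP; split=> x //=; rewrite !in_itv/= => -[/andP[_ h1] /andP[h2 _]].
  by move: h2; rewrite ltNge h1.
move=> a b ab; rewrite -/nu.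
have [b0|b0] := leP b 0.
  move: b0; rewrite le_eqVlt => /orP[/eqP b0|b0]; first by rewrite b0 nu_neg' ?sub0r// -b0.
  have := nu_neg' (lt_trans ab b0); have := nu_neg' b0.
  rewrite (@cut a b 0)// => ->; case: (nu `]a, b]) => //= r; rewrite -EFinD => -[h].
  by congr (_%:E); lra.
have [a0|a0] := ltP a 0.
  by rewrite (@cut a 0)// nu_neg'// nu_pos// -EFinD; congr (_%:E); lra.
move: a0; rewrite le_eqVlt => /orP[/eqP a0|a0]; first by rewrite -a0 nu_pos// subr0.
have := nu_pos b0; have := nu_pos a0.
rewrite (@cut 0 a b)// => ->; case: (nu `]a, b]) => //= r; rewrite -EFinD => -[h].
by congr (_%:E); lra.
Qed.

End affine_inversion.

(** * The unitary action of real matrices on functions *)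

Section mobius.
Context (R : realType).
Local Notation mu := (@lebesgue_measure R).
Implicit Types (f h : R -> R) (g k : mat R).

Definition den g (x : R) := mc g * x + md g.
Definition mob g (x : R) := (ma g * x + mb g) / den g x.
(** The factor [sqrt (det g) / |c x + d|] is the square root of the derivative of the Moebius map,
    which makes [T g] unitary. Composition reverses the order: [T g (T h f)] is [T (h g) f] off the
    poles. *)
Definition T g f (x : R) := Num.sqrt (mdet g) * f (mob g x) / `|den g x|.

Lemma measurable_den g : measurable_fun setT (den g).
Proof. by apply: measurable_funD => //; exact: measurable_funM. Qed.

Lemma measurable_mob g : measurable_fun setT (mob g).
Proof.
apply: measurable_funM.
  by apply: measurable_funD => //; exact: measurable_funM.
by apply: measurableT_comp; [exact: measurable_invr|exact: measurable_den].
Qed.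

Lemma measurable_T g f : measurable_fun setT f -> measurable_fun setT (T g f).
Proof.
move=> mf; apply: measurable_funM.
  apply: measurable_funM => //; apply: measurableT_comp => //; exact: measurable_mob.
apply: measurableT_comp; first exact: measurable_invr.
by apply: measurableT_comp => //; exact: measurable_den.
Qed.

Lemma mobius_integral g (G : R -> R) : 0 < mdet g ->
  measurable_fun setT G -> (forall x, 0 <= G x) ->
  (\int[mu]_x (G (mob g x) * (mdet g / den g x ^+ 2))%:E = \int[mu]_x (G x)%:E)%E.
Proof.
move=> D0 mG G0; have [c0|c0] := eqVneq (mc g) 0.
  have d0 : md g != 0.
    by apply/eqP => d0; move: D0; rewrite /mdet c0 d0 !mulr0 subr0 ltxx.
  have Dk : mdet g / md g ^+ 2 = ma g / md g by rewrite /mdet c0; field.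
  have k0 : 0 < ma g / md g by rewrite -Dk divr_gt0// exprn_even_gt0.
  rewrite -(integral_affine (mb g / md g) k0 mG G0).
  apply: eq_integral => x _; congr (_%:E).
  rewrite /mob /den c0 mul0r add0r Dk; congr (G _ * _).
  by rewrite mulrDl mulrAC.
(* Here [(a x + b) / (c x + d)] equals [a / c - k / (x + d / c)]: the inversion between two affine
   maps. *)
pose k := mdet g / mc g ^+ 2.
have k0 : 0 < k by rewrite divr_gt0// exprn_even_gt0.
rewrite -(integral_affine (ma g / mc g) k0 mG G0).
pose H y := G (k * y + ma g / mc g) * k.
have H0 y : 0 <= H y by rewrite mulr_ge0// ltW.
have mH : measurable_fun setT H.
  apply: measurable_funM => //; apply: measurableT_comp => //.
  by apply: measurable_funD => //; exact: measurable_funM.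
rewrite -(integral_inversion mH H0).
have H'0 y : 0 <= H (- y^-1) * (y ^+ 2)^-1 by rewrite mulr_ge0// invr_ge0 sqr_ge0.
have mH' : measurable_fun setT (fun y : R => H (- y^-1) * (y ^+ 2)^-1).
  apply: measurable_funM.
    by apply: measurableT_comp => //; apply: measurableT_comp => //; exact: measurable_invr.
  by apply: measurableT_comp; [exact: measurable_invr|exact: exprn_measurable].
rewrite -(integral_affine (md g / mc g) ltr01 mH' H'0).
apply: eq_integral => x _; congr (_%:E); rewrite mulr1 /H mul1r.
have -> : x + md g / mc g = den g x / mc g by rewrite /den; field.
have [z|z] := eqVneq (den g x) 0.
  by rewrite z mul0r expr0n /= invr0 !mulr0.
rewrite -mulrA; congr (G _ * _); last by rewrite /k; field; rewrite c0 z.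
by rewrite /mob /k /mdet; move: z; rewrite /den => z; field; rewrite c0 z.
Qed.

Lemma sqr_T g f x : 0 < mdet g ->
  T g f x ^+ 2 = f (mob g x) ^+ 2 * (mdet g / den g x ^+ 2).
Proof.
move=> D0; rewrite /T !exprMn sqr_sqrtr ?ltW// exprVn real_normK ?num_real//.
ring.
Qed.

Lemma L2_T g f : 0 < mdet g -> L2 f -> L2 (T g f).
Proof.
move=> D0 [mf f2]; split; first exact: measurable_T.
have mT := measurable_T g mf.
apply/integrableP; split; first by apply/measurable_EFinP; exact: measurable_funX.
have := f2 => /integrableP[_].
under eq_integral do rewrite /= ger0_norm ?sqr_ge0//.
under [X in _ -> (X < _)%E]eq_integral do rewrite /= ger0_norm ?sqr_ge0// sqr_T//.
rewrite (mobius_integral (G := fun x => f x ^+ 2))//; first exact: measurable_funX.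
by move=> x; exact: sqr_ge0.
Qed.

Let N_T g f : 0 < mdet g -> L2 f -> ip (T g f) (T g f) = ip f f.
Proof.
move=> D0 [mf f2]; rewrite /ip /integ /Rintegral; congr fine.
under eq_integral do rewrite -expr2 sqr_T//.
under [RHS]eq_integral do rewrite -expr2.
rewrite (mobius_integral (G := fun x => f x ^+ 2))//; first exact: measurable_funX.
by move=> x; exact: sqr_ge0.
Qed.

Lemma TD g f h : T g (fun x => f x + h x) = (fun x => T g f x + T g h x).
Proof. by apply/funext => x; rewrite /T mulrDr mulrDl. Qed.
Lemma TB g f h : T g (fun x => f x - h x) = (fun x => T g f x - T g h x).
Proof. by apply/funext => x; rewrite /T mulrBr mulrBl. Qed.
Lemma TZ g t f : T g (fun x => t * f x) = (fun x => t * T g f x).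
Proof. by apply/funext => x; rewrite /T mulrCA -!mulrA. Qed.
Lemma Tsum g (I : Type) (r : seq I) (F : I -> R -> R) :
  T g (fun x => \sum_(i <- r) F i x) = (fun x => \sum_(i <- r) T g (F i) x).
Proof. by apply/funext => x; rewrite /T mulr_sumr mulr_suml. Qed.

(** Polarization: the change of variables was proved for nonnegative functions, so it gives norms
    first. *)
Lemma ip_T g f h : 0 < mdet g -> L2 f -> L2 h ->
  ip (T g f) (T g h) = ip f h.
Proof.
move=> D0 Lf Lh.
have P (u v : R -> R) : L2 u -> L2 v -> ip u v =
    (ip (fun x => u x + v x) (fun x => u x + v x)
     - ip (fun x => u x - v x) (fun x => u x - v x)) / 4.
  move=> Lu Lv; have La := L2D Lu Lv; have Lb := L2B Lu Lv.
  have -> : ip (fun x => u x + v x) (fun x => u x + v x) = ip u u + 2 * ip u v + ip v v.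
    by rewrite ipDl// !ipDr// (ipC v u); ring.
  have -> : ip (fun x => u x - v x) (fun x => u x - v x) = ip u u - 2 * ip u v + ip v v.
    by rewrite ipBl// !ipBr// (ipC v u); ring.
  by field.
have LTf := L2_T D0 Lf; have LTh := L2_T D0 Lh.
rewrite (P (T g f))// (P f h)// -TD -TB !N_T//; [exact: L2B|exact: L2D].
Qed.

Lemma den_mul g (h : mat R) x : den g x != 0 -> den (mmul h g) x = den h (mob g x) * den g x.
Proof.
rewrite /den /mob /den => z; rewrite /mmul /ma /mb /mc /md /= in z *; field; exact: z.
Qed.

Lemma mob_mul g (h : mat R) x : den g x != 0 -> mob (mmul h g) x = mob h (mob g x).
Proof.
move=> z; rewrite {1}/mob den_mul// {2}/mob.
have -> : ma (mmul h g) * x + mb (mmul h g) = (ma h * mob g x + mb h) * den g x.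
  by move: z; rewrite /mob /den /mmul /ma /mb /mc /md /= => z; field; exact: z.
have [w|w] := eqVneq (den h (mob g x)) 0; first by rewrite w mul0r !invr0 !mulr0.
by field; rewrite z w.
Qed.

Lemma den_eq0 g : 0 < mdet g -> exists s : seq R, forall x, x \notin s -> den g x != 0.
Proof.
move=> D0; exists [:: - md g / mc g] => x; rewrite inE; apply: contra => /eqP.
rewrite /den => z; have c0 : mc g != 0.
  apply/eqP => c0; move: z D0; rewrite /mdet c0 mul0r add0r => ->.
  by rewrite !mulr0 subr0 ltxx.
by apply/eqP; rewrite -[x](mulfK c0) [x * _]mulrC; congr (_ / _); lra.
Qed.

Lemma T_comp g (h : mat R) f : 0 < mdet g -> 0 < mdet h ->
  eqf (T g (T h f)) (T (mmul h g) f).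
Proof.
move=> Dg Dh; have [s sP] := den_eq0 Dg; exists s => x /sP z.
rewrite /T mob_mul// den_mul// mdetM mulrC [in RHS]mulrC.
rewrite sqrtrM ?ltW// normrM invfM.
ring.
Qed.

Lemma T_scale t g f : 0 < t -> T (mscale t g) f = T g f.
Proof.
move=> t0; apply/funext => x; rewrite /T mdetZ sqrtrM ?sqr_ge0// sqrtr_sqr gtr0_norm//.
have -> : den (mscale t g) x = t * den g x by rewrite /den /mc /md /=; ring.
have -> : mob (mscale t g) x = mob g x.
  rewrite /mob /den; have -> : mc (mscale t g) * x + md (mscale t g) = t * (mc g * x + md g).
    by rewrite /mc /md /=; ring.
  have -> : ma (mscale t g) * x + mb (mscale t g) = t * (ma g * x + mb g).
    by rewrite /ma /mb /=; ring.
  by rewrite invfM mulrACA divff ?gt_eqF// mul1r.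
rewrite normrM gtr0_norm// invfM.
transitivity (t / t * (Num.sqrt (mdet g) * f (mob g x) / `|den g x|)); first by ring.
by rewrite divff ?gt_eqF// mul1r.
Qed.

Lemma T_opp g f : T (mscale (-1) g) f = T g f.
Proof.
apply/funext => x; rewrite /T mdetZ sqrrN expr1n mul1r.
have -> : den (mscale (-1) g) x = - den g x by rewrite /den /mc /md /=; ring.
have -> : mob (mscale (-1) g) x = mob g x.
  rewrite /mob; have -> : den (mscale (-1) g) x = - den g x by rewrite /den /mc /md /=; ring.
  have -> : ma (mscale (-1) g) * x + mb (mscale (-1) g) = - (ma g * x + mb g).
    by rewrite /ma /mb /=; ring.
  by rewrite invrN mulrNN.
by rewrite normrN.
Qed.

Lemma T_one f : T mone f = f.
Proof.
apply/funext => x; rewrite /T /mob /den /mdet /mone /ma /mb /mc /md /=.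
by rewrite !mul1r !mul0r !add0r !addr0 subr0 sqrtr1 normr1 !divr1 mul1r.
Qed.

Lemma eqf_T g f h : 0 < mdet g -> eqf f h -> eqf (T g f) (T g h).
Proof.
move=> D0 [s fh]; have [t tP] := den_eq0 D0.
exists (t ++ [seq mob (madj g) y | y <- s]) => x; rewrite mem_cat negb_or => /andP[/tP z xs].
rewrite /T fh//; apply: contra xs => xs; apply/mapP; exists (mob g x) => //.
rewrite -mob_mul// mmul_adjl /mob /den /mscale /ma /mb /mc /md /=.
by rewrite mulr0 mulr1 mul0r addr0 add0r mulrAC divff ?mul1r// gt_eqF.
Qed.

Lemma ip_T_adj g f h : 0 < mdet g -> L2 f -> L2 h ->
  ip (T g f) h = ip f (T (madj g) h).
Proof.
move=> D0 Lf Lh; have D0' : 0 < mdet (madj g) by rewrite mdet_adj.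
have LTh := L2_T D0' Lh; have LTf := L2_T D0 Lf.
rewrite -(ip_T D0 Lf)//; apply: ip_eqf => //; first exact: L2_T.
  exact: eqf_refl.
apply: eqf_sym; apply: (eqf_trans (T_comp h D0 D0')).
by rewrite mmul_adjl T_scale// T_one; exact: eqf_refl.
Qed.

End mobius.

(** * Step functions and maps close to the identity *)

Section step.
Context (R : realType).
Local Notation mu := (@lebesgue_measure R).

Definition ind (a b x : R) : R := ((a <= x) && (x < b))%:R.
Definition itvs (n : nat) (s t : nat -> R) (c : nat -> R) (x : R) :=
  \sum_(i < n) c i * ind (s i) (t i) x.
Definition step (n : nat) := itvs n (fun i => i%:R / n%:R) (fun i => i.+1%:R / n%:R).
Definition N (f : R -> R) := ip f f.

Lemma N_ge0 f : 0 <= N f. Proof. exact: ip_ge0. Qed.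

Lemma N_add f g : L2 f -> L2 g -> N (fun x => f x + g x) = N f + 2 * ip f g + N g.
Proof.
move=> Lf Lg; have L := L2D Lf Lg.
by rewrite /N ipDl// !ipDr// (ipC g f); ring.
Qed.

Lemma N_sub f g : L2 f -> L2 g -> N (fun x => f x - g x) = N f - 2 * ip f g + N g.
Proof.
move=> Lf Lg; have L := L2B Lf Lg.
by rewrite /N ipBl// !ipBr// (ipC g f); ring.
Qed.

Lemma N_T g f : 0 < mdet g -> L2 f -> N (T g f) = N f.
Proof. by move=> D Lf; rewrite /N ip_T. Qed.

Lemma N_eqf f g : L2 f -> L2 g -> eqf f g -> N f = N g.
Proof. by move=> Lf Lg e; apply: ip_eqf. Qed.

Lemma indE a b : ind a b = \1_(`[a, b[).
Proof.
apply/funext => x; rewrite /ind indicE; congr (nat_of_bool _)%:R.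
by apply/idP/idP => [h|]; [apply/mem_set; rewrite /= in_itv/=|rewrite inE/= in_itv/=].
Qed.

Lemma intble_ind a b : intble (ind a b).
Proof.
by rewrite indE; exact: integrable_indic_itv.
Qed.

Lemma int_ind a b : a <= b -> integ (ind a b) = b - a.
Proof.
move=> ab; rewrite indE /integ /Rintegral integral_indic// setIT.
transitivity (fine (@lebesgue_measure R [set` `[a, b[])) => //.
rewrite lebesgue_measure_itv/= lte_fin.
by case: ltP => //= ba; apply/eqP; rewrite eq_sym subr_eq0 eq_le ab ba.
Qed.

Lemma L2_ind a b : L2 (ind a b).
Proof.
have h := intble_ind a b; split; first exact: intbleP.
move: h; congr intble; apply/funext => x; rewrite /ind expr2.
by case: (_ && _); rewrite ?mulr1 ?mulr0.
Qed.

Lemma ip_ind a b : a <= b -> ip (ind a b) (ind a b) = b - a.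
Proof.
move=> ab; rewrite -(int_ind ab) /ip; congr integ; apply/funext => x; rewrite /ind.
by case: (_ && _); rewrite ?mulr1 ?mulr0.
Qed.

Lemma ip_ind0 a b a' b' : b <= a' -> ip (ind a b) (ind a' b') = 0.
Proof.
move=> ab; rewrite -[RHS](ip0l (fun=> 0 : R)) /ip; congr integ; apply/funext => x.
rewrite /ind mul0r; case: (boolP ((a <= x) && (x < b))) => [/andP[_ xb]|]; last by rewrite mul0r.
by rewrite [X in _ * X%:R](_ : _ = 0%N) ?mulr0// leNgt (lt_le_trans xb ab).
Qed.

Lemma L2_itvs n s t c : L2 (itvs n s t c).
Proof. by apply: L2sum => i; apply: L2Z; exact: L2_ind. Qed.

Lemma ip_itvs n s t c d : (forall i, s i <= t i) -> (forall i j, (i < j)%N -> t i <= s j) ->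
  ip (itvs n s t c) (itvs n s t d) = \sum_(i < n) c i * d i * (t i - s i).
Proof.
move=> st ts.
have L (e : nat -> R) (i : 'I_n) : L2 (fun x => e i * ind (s i) (t i) x).
  by apply: L2Z; exact: L2_ind.
rewrite ip_suml//; last exact: L2_itvs.
apply: eq_bigr => i _; rewrite ip_sumr//.
rewrite (bigD1 i)//= big1 ?addr0.
  by rewrite ipZl// ?ipZr// ?ip_ind ?mulrA//; exact: L2_ind.
move=> j ji; rewrite ipZl// ?ipZr//; try exact: L2_ind.
suff -> : ip (ind (s i) (t i)) (ind (s j) (t j)) = 0 by rewrite !mulr0.
case: (ltngtP i j) => ij; first by rewrite ip_ind0// ts.
  by rewrite ipC ip_ind0// ts.
by move: ji; rewrite -(inj_eq val_inj)/= ij eqxx.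
Qed.

Lemma L2_step n c : L2 (step n c). Proof. exact: L2_itvs. Qed.

Lemma ip_step n c d : ip (step n c) (step n d) = n%:R^-1 * \sum_(i < n) c i * d i.
Proof.
case: n => [|n].
  rewrite big_ord0 mulr0 /step ip_suml ?big_ord0//; last exact: L2_itvs.
  by move=> -[].
rewrite /step ip_itvs//.
- rewrite mulr_sumr; apply: eq_bigr => i _; rewrite -mulrBl -natrB// subSnn mul1r.
  by rewrite mulrC.
- by move=> i; rewrite ler_pM2r ?invr_gt0 ?ltr0Sn// ler_nat.
- by move=> i j ij; rewrite ler_pM2r ?invr_gt0 ?ltr0Sn// ler_nat.
Qed.

Lemma N_step n c : N (step n c) = n%:R^-1 * \sum_(i < n) c i ^+ 2.
Proof. by rewrite /N ip_step; congr (_ * _); apply: eq_bigr => i _; rewrite expr2. Qed.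

Definition incell (n i : nat) (x : R) := (i%:R / n%:R <= x) && (x < i.+1%:R / n%:R).

Lemma step_cell n c i x : (i < n)%N -> incell n i x -> step n c x = c i.
Proof.
move=> ni xi; rewrite /step /itvs (bigD1 (Ordinal ni))//= big1 ?addr0.
  by rewrite /ind; move: xi; rewrite /incell => ->; rewrite mulr1.
move=> j ji; rewrite /ind; have n0 : 0 < n%:R :> R by rewrite ltr0n (leq_ltn_trans _ ni).
move: xi; rewrite /incell !ler_pdivrMr// !ltr_pdivlMr// => /andP[x1 x2].
case: (boolP (_ && _)) => [/andP[y1 y2]|]; last by rewrite mulr0.
have := le_lt_trans x1 y2; have := le_lt_trans y1 x2; rewrite !ltr_nat => a b.
by move: ji; rewrite -(inj_eq val_inj)/=; move/eqP; lia.
Qed.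

Lemma step_out n c x : ~~ ((0 <= x) && (x < 1)) -> step n c x = 0.
Proof.
move=> xo; rewrite /step /itvs big1// => i _; rewrite /ind.
case: (boolP (_ && _)) => [/andP[y1 y2]|]; last by rewrite mulr0.
have n0 : 0 < n%:R :> R by rewrite ltr0n (leq_ltn_trans _ (ltn_ord i)).
case/negP: xo; rewrite (le_trans _ y1) ?divr_ge0//= (lt_le_trans y2)// ler_pdivrMr// mul1r ler_nat.
exact: ltn_ord.
Qed.

Lemma cell_ex n x : (0 < n)%N -> 0 <= x -> x < 1 -> exists2 i, (i < n)%N & incell n i x.
Proof.
move=> n0 x0 x1; have n0' : 0 < n%:R :> R by rewrite ltr0n.
have xn : 0 <= x * n%:R by rewrite mulr_ge0.
have /andP[h1 h2] := Num.Theory.truncn_itv xn.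
exists (Num.truncn (x * n%:R)).
  by rewrite -(ltr_nat R) (le_lt_trans h1)// gtr_pMl.
by rewrite /incell ler_pdivrMr// ltr_pdivlMr// h1 h2.
Qed.

Lemma N_add3 f g h k : L2 f -> L2 g -> L2 h -> L2 k ->
  (forall x, `|k x| <= f x + g x + h x) -> N k <= 3 * (N f + N g + N h).
Proof.
move=> Lf Lg Lh Lk H.
have [mf f2] := Lf; have [mg g2] := Lg; have [mh h2] := Lh; have [mk k2] := Lk.
have e u : N u = integ (fun x => u x ^+ 2) by congr integ; apply/funext => x; rewrite expr2.
rewrite !e -!intD// -?intZ//; try exact: intbleD => //; last first.
  by apply: intbleD => //; exact: intbleD.
apply: int_le => //.
  by apply: intbleZ; apply: intbleD => //; exact: intbleD.
move=> x; have := H x; rewrite ler_norml => /andP[h1 h3].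
have := sqr_ge0 (f x - g x); have := sqr_ge0 (f x - h x); have := sqr_ge0 (g x - h x).
have : 0 <= (f x + g x + h x - k x) * (f x + g x + h x + k x) by apply: mulr_ge0; lra.
nra.
Qed.

(** Dominates the step function within [rho] of the two ends of each cell, the only places where a
    move by less than [rho] can change the cell. *)
Definition collar (n : nat) (rho : R) (c : nat -> R) (x : R) :=
  itvs n (fun i => i%:R / n%:R) (fun i => i%:R / n%:R + rho) (fun i => `|c i|) x +
  itvs n (fun i => i.+1%:R / n%:R - rho) (fun i => i.+1%:R / n%:R) (fun i => `|c i|) x.

Lemma ind_ge0 a b x : 0 <= ind a b x. Proof. exact: ler0n. Qed.

Lemma itvs_ge n s t c i x : (forall j, 0 <= c j) -> (i < n)%N ->
  s i <= x -> x < t i -> c i <= itvs n s t c x.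
Proof.
move=> c0 ni sx xt; rewrite /itvs (bigD1 (Ordinal ni))//= {1}/ind sx xt mulr1 lerDl.
by apply: sumr_ge0 => j _; rewrite mulr_ge0 ?ind_ge0.
Qed.

Lemma itvs_ge0 n s t c x : (forall j, 0 <= c j) -> 0 <= itvs n s t c x.
Proof. by move=> c0; apply: sumr_ge0 => j _; rewrite mulr_ge0 ?ind_ge0. Qed.

Lemma collar_ge0 n rho c x : 0 <= collar n rho c x.
Proof. by apply: addr_ge0; apply: itvs_ge0 => j. Qed.

Lemma L2_collar n rho c : L2 (collar n rho c).
Proof. by apply: L2D; exact: L2_itvs. Qed.

Lemma N_collar n rho c : (0 < n)%N -> 0 <= rho -> rho * n%:R <= 1 ->
  N (collar n rho c) <= 4 * rho * n%:R * N (step n c).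
Proof.
move=> n0 r0 rn; have n0' : 0 < n%:R :> R by rewrite ltr0n.
have rn' : rho <= n%:R^-1 by rewrite -[n%:R^-1]mul1r ler_pdivlMr.
pose u := itvs n (fun i => i%:R / n%:R) (fun i => i%:R / n%:R + rho) (fun i => `|c i|).
pose v := itvs n (fun i => i.+1%:R / n%:R - rho) (fun i => i.+1%:R / n%:R) (fun i => `|c i|).
have S (i : nat) : i.+1%:R / n%:R = i%:R / n%:R + n%:R^-1 :> R by rewrite -natr1 mulrDl mul1r.
have mono (i j : nat) : (i < j)%N -> i%:R / n%:R + n%:R^-1 <= j%:R / n%:R :> R.
  by move=> ij; rewrite -S ler_pM2r ?invr_gt0// ler_nat.
have Nu : N u = rho * \sum_(i < n) c i ^+ 2.
  rewrite /N ip_itvs; [|by move=> i; rewrite lerDl|].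
    rewrite mulr_sumr; apply: eq_bigr => i _.
    by rewrite -expr2 real_normK ?num_real// addrAC subrr add0r mulrC.
  by move=> i j /mono; apply: le_trans; rewrite lerD2l.
have Nv : N v = rho * \sum_(i < n) c i ^+ 2.
  rewrite /N ip_itvs; [|by move=> i; rewrite gerBl|].
    rewrite mulr_sumr; apply: eq_bigr => i _.
    by rewrite -expr2 real_normK ?num_real// opprB addrCA subrr addr0 mulrC.
  by move=> i j /mono; rewrite !S; lra.
have Lu : L2 u by exact: L2_itvs.
have Lv : L2 v by exact: L2_itvs.
have : N (collar n rho c) <= 2 * N u + 2 * N v.
  have := N_ge0 (fun x => u x - v x).
  rewrite N_sub// (_ : N (collar n rho c) = N u + 2 * ip u v + N v) ?N_add//; lra.
move/le_trans; apply; rewrite Nu Nv N_step.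
rewrite [X in _ <= X](_ : _ = 4 * rho * \sum_(i < n) c i ^+ 2); first by lra.
by field; rewrite gt_eqF.
Qed.

Lemma step_collar n rho c x y : (0 < n)%N -> 0 < rho -> `|x - y| < rho ->
  step n c x = step n c y \/
  (`|step n c x| <= collar n rho c x /\ `|step n c y| <= collar n rho c y).
Proof.
move=> n0 r0 xy.
have half z w : `|z - w| < rho -> step n c z = step n c w \/ `|step n c z| <= collar n rho c z.
  rewrite ltr_norml => /andP[zw1 zw2].
  case: (boolP ((0 <= z) && (z < 1))) => [/andP[z0 z1]|zo]; last first.
    by right; rewrite step_out// normr0 collar_ge0.
  have [i ni iz] := cell_ex n0 z0 z1; rewrite (step_cell c ni iz).
  case: (boolP (incell n i w)) => [iw|]; first by left; rewrite (step_cell c ni iw).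
  move: iz; rewrite /incell => /andP[iz1 iz2]; rewrite negb_and -ltNge -leNgt => h; right.
  have P1 := @itvs_ge0 n (fun i => i%:R / n%:R) (fun i => i%:R / n%:R + rho) (fun i => `|c i|) z (fun j => normr_ge0 _).
  have P2 := @itvs_ge0 n (fun i => i.+1%:R / n%:R - rho) (fun i => i.+1%:R / n%:R) (fun i => `|c i|) z (fun j => normr_ge0 _).
  rewrite /collar; case/orP: h => h.
    rewrite -[X in X <= _]addr0 lerD//.
    apply: (@itvs_ge n _ _ (fun i => `|c i|) i) => //; lra.
  rewrite -[X in X <= _]add0r lerD//.
  apply: (@itvs_ge n _ _ (fun i => `|c i|) i) => //; lra.
case: (half x y xy) => [|hx]; first by left.
have [->|hy] := half y x (etrans (congr1 (fun t => t < rho) (distrC y x)) xy); first by left.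
by right.
Qed.

Definition near1 (kap : R) (h : mat R) :=
  [/\ `|ma h - 1| <= kap, `|mb h| <= kap, `|mc h| <= kap & `|md h - 1| <= kap].

Lemma near1_det kap h : kap <= 1 / 100 -> near1 kap h -> `|mdet h - 1| <= 21 / 10 * kap.
Proof.
move=> k1 [].
rewrite !ler_norml /mdet => /andP[a1 a2] /andP[b1 b2] /andP[c1 c2] /andP[d1 d2].
have k0 : 0 <= kap by lra.
by apply/andP; split; nra.
Qed.

Lemma sqrt_near (d t : R) : 0 <= d -> `|d - 1| <= t -> `|Num.sqrt d - 1| <= t.
Proof.
move=> d0; have s0 := sqrtr_ge0 d; have sd := sqr_sqrtr d0.
set s := Num.sqrt d in s0 sd *.
apply: le_trans; rewrite -sd.
have -> : s ^+ 2 - 1 = (s - 1) * (s + 1) by ring.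
by rewrite normrM ler_peMr ?normr_ge0// ger0_norm; lra.
Qed.

Lemma near1_point kap h x : kap <= 1 / 100 -> near1 kap h -> -1 <= x <= 2 ->
  [/\ 97 / 100 <= den h x, `|mob h x - x| <= 10 * kap &
      `|Num.sqrt (mdet h) / `|den h x| - 1| <= 6 * kap].
Proof.
move=> k1 hh; have D := near1_det k1 hh; case: hh.
rewrite !ler_norml => /andP[a1 a2] /andP[b1 b2] /andP[c1 c2] /andP[d1 d2] /andP[x1 x2].
have k0 : 0 <= kap by lra.
have C1 : -(2 * kap) <= mc h * x <= 2 * kap by apply/andP; split; nra.
have {C1} /andP[C1 C2] := C1.
have dn : 97 / 100 <= den h x by rewrite /den; lra.
have dn0 : 0 < den h x by lra.
have D0 : 0 <= mdet h by move: D; rewrite ler_norml => /andP[]; lra.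
split=> //.
  have -> : mob h x - x = ((ma h - 1) * x + mb h - mc h * x * x - (md h - 1) * x) / den h x.
    by rewrite /mob; move: dn0; rewrite /den => dn0; field; rewrite gt_eqF.
  rewrite -ler_norml normrM normfV (gtr0_norm dn0) ler_pdivrMr//.
  rewrite ler_norml.
  have A1 : -(2 * kap) <= (ma h - 1) * x <= 2 * kap by apply/andP; split; nra.
  have A2 : -(2 * kap) <= (md h - 1) * x <= 2 * kap by apply/andP; split; nra.
  have A3 : -(4 * kap) <= mc h * x * x <= 4 * kap by apply/andP; split; nra.
  move/andP: A1 => [A1 A1']; move/andP: A2 => [A2 A2']; move/andP: A3 => [A3 A3'].
  by apply/andP; split; nra.
have := sqrt_near D0 D; rewrite ler_norml => /andP[s1 s2].
set s := Num.sqrt _ in s1 s2 *.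
rewrite (gtr0_norm dn0) -[X in _ / _ - X](divff (lt0r_neq0 dn0)) -mulrBl -ler_norml.
rewrite normrM normfV (gtr0_norm dn0) ler_pdivrMr// ler_norml /den.
by apply/andP; split; rewrite /den in dn; nra.
Qed.

(** Solving [y = mob h x] for [x] gives [(d y - b) / (a - c y)], which lies in [[-1, 2]] for
    [0 <= y < 1]. Hence the neighbourhood of the pole, where no uniform bound on the cocycle is
    available, contributes nothing. *)
Lemma near1_out kap h x : kap <= 1 / 100 -> near1 kap h -> ~~ ((-1 <= x) && (x <= 2)) ->
  den h x != 0 -> ~~ ((0 <= mob h x) && (mob h x < 1)).
Proof.
move=> k1 [].
rewrite !ler_norml => /andP[a1 a2] /andP[b1 b2] /andP[c1 c2] /andP[d1 d2].
have k0 : 0 <= kap by lra.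
move=> xo z; apply/negP => /andP[y0 y1].
have E : mob h x * den h x = ma h * x + mb h by rewrite /mob -mulrA mulVf// mulr1.
set y := mob h x in y0 y1 E; rewrite /den in E.
have {}E : x * (ma h - mc h * y) = md h * y - mb h by lra.
have P : 98 / 100 <= ma h - mc h * y by nra.
have Q1 : md h * y - mb h <= 102 / 100 by nra.
have Q2 : -2 / 100 <= md h * y - mb h by nra.
move: xo; rewrite negb_and -!ltNge => /orP[xo|xo]; nra.
Qed.

(* Away from the collars [phi] and its translate agree up to the cocycle, which is within [6 kap]
   of [1]; on the collars both are dominated by the collar function. *)
Lemma near1_step n kap h c : (0 < n)%N -> 0 < kap -> kap <= 1 / 100 -> near1 kap h ->
  N (fun x => T h (step n c) x - step n c x) <= 1000 * kap * n%:R * N (step n c).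
Proof.
move=> n0 k0 k1 hh; set phi := step n c.
have D : 0 < mdet h by have := near1_det k1 hh; rewrite ler_norml => /andP[]; lra.
have n1 : 1 <= n%:R :> R by rewrite ler1n.
have Lphi : L2 phi by exact: L2_step.
have LT : L2 (T h phi) by exact: L2_T.
have Ld : L2 (fun x => T h phi x - phi x) by exact: L2B.
have Np := N_ge0 phi.
have [kn|kn] := leP (20 * kap * n%:R) 1; last first.
  have : N (fun x => T h phi x - phi x) <= 4 * N phi.
    rewrite N_sub// N_T//.
    have : 0 <= N (fun x => T h phi x + phi x) by exact: N_ge0.
    rewrite N_add// N_T//.
    lra.
  move/le_trans; apply; nra.
set rho := 20 * kap.
pose b := collar n rho c.
have Lb : L2 b by exact: L2_collar.
have LTb : L2 (T h b) by exact: L2_T.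
pose e x := 20 * kap * `|phi x|.
have Le : L2 e.
  apply: L2Z; split; first by apply: measurableT_comp => //; case: Lphi.
  case: Lphi => _; congr intble; apply/funext => x; by rewrite real_normK ?num_real.
have Ne : N e = 400 * kap ^+ 2 * N phi.
  rewrite /N /e /ip /integ -RintegralZl//; last exact: L2M.
  by congr integ; apply/funext => x /=; rewrite -[phi x * phi x]expr2 -[phi x ^+ 2](real_normK (num_real _)); ring.
have H x : `|T h phi x - phi x| <= T h b x + b x + e x.
  have b0 y : 0 <= b y by exact: collar_ge0.
  have e0 : 0 <= e x by rewrite /e !mulr_ge0// ltW.
  have Tb0 : 0 <= T h b x by rewrite /T !mulr_ge0// ?sqrtr_ge0// invr_ge0.
  case: (boolP ((-1 <= x) && (x <= 2))) => xI; last first.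
    have -> : phi x = 0.
      by apply: step_out; apply: contra xI => /andP[]; move=> p q; apply/andP; split; lra.
    have -> : T h phi x = 0.
      rewrite /T; have [->|z] := eqVneq (den h x) 0; first by rewrite normr0 invr0 mulr0.
      by rewrite /phi step_out ?(near1_out k1 hh)// mulr0 mul0r.
    by rewrite subr0 normr0; have := b0 x; lra.
  have [dn mx w] := near1_point k1 hh xI.
  set wt := _ / _ in w.
  have TE f : T h f x = wt * f (mob h x) by rewrite /T /wt mulrAC.
  rewrite !TE; have wt0 : 0 <= wt by rewrite /wt divr_ge0 ?sqrtr_ge0.
  have [E|[E1 E2]] := @step_collar n rho c (mob h x) x n0 ltac:(rewrite /rho; lra) ltac:(rewrite /rho; lra).
    rewrite -/phi in E; rewrite E -[X in _ - X]mul1r -mulrBl normrM.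
    have : 0 <= wt * b (mob h x) by rewrite mulr_ge0.
    have : `|wt - 1| * `|phi x| <= 20 * kap * `|phi x|.
      by rewrite ler_wpM2r// (le_trans w)//; lra.
    rewrite /e; have := b0 x; lra.
  rewrite (le_trans (ler_normB _ _))// normrM (ger0_norm wt0) -[X in X <= _]addr0 lerD//.
  by rewrite lerD// ler_wpM2l.
have Nb : N b <= 4 * rho * n%:R * N phi by apply: N_collar => //; rewrite /rho; lra.
apply: (le_trans (N_add3 LTb Lb Le Ld H)).
rewrite N_T// Ne; rewrite /rho in Nb.
have K2 : kap ^+ 2 <= kap * n%:R / 100 by nra.
have : 400 * kap ^+ 2 * N phi <= 4 * (kap * n%:R) * N phi by rewrite ler_wpM2r//; lra.
have : 0 <= kap * n%:R * N phi by rewrite !mulr_ge0// ltW.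
lra.
Qed.

End step.

(** * Correlations of a discrete derivative along a fine grid of translations *)

Section autocorrelation.
Context (R : realType).
Implicit Types (F : int -> R).

Lemma window_sum (n m a : nat) F : (a + n <= m)%N ->
  (forall z, F z != 0 -> (0 <= z < n%:Z)) ->
  \sum_(t < m) F (t%:Z - a%:Z) = \sum_(i < n) F i%:Z.
Proof.
move=> anm F0; rewrite -(big_mkord xpredT (fun t => F (t%:Z - a%:Z))).
have Z z : ~~ (0 <= z < n%:Z) -> F z = 0.
  by move=> h; apply/eqP; apply/negPn; apply: contra h => /F0.
rewrite (@big_cat_nat _ _ _ a)/=; [|lia|lia].
rewrite (@big_cat_nat _ _ _ (a + n) a m)/=; [|lia|lia].
rewrite [X in X + _](_ : _ = 0) ?add0r; last first.
  by rewrite big_nat big1// => i /andP[_ ia]; apply: Z; lia.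
rewrite [X in _ + X](_ : _ = 0) ?addr0; last first.
  by rewrite big_nat big1// => i /andP[ia im]; apply: Z; lia.
rewrite -{1}[a]add0n big_addn addKn big_mkord; apply: eq_bigr => i _.
by congr F; lia.
Qed.

Variables (n : nat) (c e : int -> R).
Hypothesis n0 : (0 < n)%N.
Hypothesis e0 : forall z, e z != 0 -> 0 <= z < n%:Z - 1.
Hypothesis ce : forall z, c z = e z - e (z - 1).

Lemma c_supp z : c z != 0 -> 0 <= z < n%:Z.
Proof.
rewrite ce; have [->|/e0] := eqVneq (e z) 0; last by lia.
by rewrite sub0r oppr_eq0 => /e0; lia.
Qed.

Definition energy := \sum_(i < n) e i%:Z ^+ 2.
Definition corr (j : int) := \sum_(i < n) e i%:Z * e (i%:Z + j).
Definition ccorr (j : int) := \sum_(i < n) c i%:Z * c (i%:Z + j).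

Lemma energy_ge0 : 0 <= energy. Proof. by apply: sumr_ge0 => i _; exact: sqr_ge0. Qed.

Let e_supp z : e z != 0 -> 0 <= z < n%:Z. Proof. by move=> /e0; lia. Qed.

Lemma energy_shift (j : int) : \sum_(i < n) e (i%:Z + j) ^+ 2 <= energy.
Proof.
pose b := absz j.
have -> : energy = \sum_(t < (b + n + b)%N) e (t%:Z - b%:Z) ^+ 2.
  rewrite (@window_sum n _ _ (fun z => e z ^+ 2)); [by []|lia|].
  by move=> z; rewrite sqrf_eq0 => /e_supp.
rewrite -(big_mkord xpredT (fun i => e (i%:Z + j) ^+ 2)).
rewrite -(big_mkord xpredT (fun t => e (t%:Z - b%:Z) ^+ 2)).
have bj : 0 <= b%:Z + j by rewrite /b; lia.
pose d := absz (b%:Z + j); have dE : d%:Z = b%:Z + j by rewrite /d; lia.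
have dn : (d + n <= b + n + b)%N by rewrite /b in dE *; lia.
rewrite (@big_cat_nat _ _ _ d 0 (b + n + b))/=; [|lia|lia].
rewrite (@big_cat_nat _ _ _ (d + n) d (b + n + b))/=; [|lia|lia].
rewrite [X in _ <= _ + (X + _)](_ : _ = \sum_(0 <= i < n) e (i%:Z + j) ^+ 2); last first.
  by rewrite -{1}[d]add0n big_addn addKn; apply: eq_bigr => i _; congr (e _ ^+ 2); lia.
by rewrite addrCA lerDl addr_ge0// sumr_ge0// => i _; exact: sqr_ge0.
Qed.

Lemma corr_le j : `|corr j| <= energy.
Proof.
rewrite (le_trans (ler_norm_sum _ _ _))//.
have h : \sum_(i < n) `|e i%:Z * e (i%:Z + j)| <=
    \sum_(i < n) (e i%:Z ^+ 2 + e (i%:Z + j) ^+ 2) / 2.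
  apply: ler_sum => i _; rewrite ler_norml.
  have := sqr_ge0 (e i%:Z - e (i%:Z + j)); have := sqr_ge0 (e i%:Z + e (i%:Z + j)).
  by move=> h1 h2; apply/andP; split; nra.
apply: (le_trans h); rewrite -mulr_suml big_split/=.
have := energy_shift j; rewrite -/energy; lra.
Qed.

(** As [c] is the discrete derivative of [e], its correlation is minus the second difference of that
    of [e]. This is where the oscillation of the step function enters. *)
Lemma ccorrE j : ccorr j = 2 * corr j - corr (j - 1) - corr (j + 1).
Proof.
have W (F : int -> R) (a : nat) : (a <= 2)%N -> (forall z, F z != 0 -> 0 <= z < n%:Z) ->
    \sum_(i < n) F i%:Z = \sum_(t < n + 4) F (t%:Z - a%:Z).
  by move=> a2 F0; rewrite (@window_sum n _ _ F)//; lia.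
rewrite /ccorr (W (fun z => c z * c (z + j)) 0%N)//; last first.
  by move=> z; rewrite mulf_eq0 negb_or => /andP[/c_supp].
have se (q : int) z : e z * e (z + q) != 0 -> 0 <= z < n%:Z.
  by rewrite mulf_eq0 negb_or => /andP[/e_supp].
rewrite mulr_natl mulr2n [in RHS]/corr.
rewrite {1}(W (fun z => e z * e (z + j)) 0%N)//; last exact: se.
rewrite (W (fun z => e z * e (z + j)) 1%N)//; last exact: se.
rewrite (W (fun z => e z * e (z + (j - 1))) 0%N)//; last exact: se.
rewrite (W (fun z => e z * e (z + (j + 1))) 1%N)//; last exact: se.
rewrite -big_split -sumrB -sumrB/=; apply: eq_bigr => t _.
rewrite !ce.
have -> : t%:Z - 0%:Z = t%:Z by lia.
have -> : t%:Z + j - 1 = t%:Z + (j - 1) by lia.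
have -> : t%:Z - 1%:Z + (j + 1) = t%:Z + j by lia.
have -> : t%:Z - 1%:Z + j = t%:Z + (j - 1) by lia.
ring.
Qed.

(** This is [n] times the piecewise linear interpolation of [corr] with nodes at the multiples of
    [n]. It has size [n] times the energy but a Lipschitz constant of only twice the energy. *)
Definition hh (k : int) := \sum_(s < n) corr ((k + s%:Z) %/ n%:Z)%Z.

Let nz : n%:Z != 0. Proof. lia. Qed.

Lemma hh_succ k : hh (k + 1) - hh k = corr ((k %/ n%:Z)%Z + 1) - corr (k %/ n%:Z)%Z.
Proof.
rewrite /hh; case: n n0 nz => // n' _ nz'.
rewrite big_ord_recr [X in _ - X]big_ord_recl /= addr0.
have -> : k + 1 + n'%:Z = k + n'.+1%:Z by lia.
have -> : ((k + n'.+1%:Z) %/ n'.+1%:Z)%Z = (k %/ n'.+1%:Z)%Z + 1.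
  by rewrite divzDr ?dvdzz// divzz nz'.
have -> : \sum_(i < n') corr ((k + 1 + i%:Z) %/ n'.+1%:Z)%Z =
    \sum_(i < n') corr ((k + (bump 0 i)%:Z) %/ n'.+1%:Z)%Z.
  by apply: eq_bigr => i _; congr (corr (_ %/ _)%Z); rewrite /bump /=; lia.
ring.
Qed.

Lemma hh_shift k : hh (k + n%:Z) = \sum_(s < n) corr (((k + s%:Z) %/ n%:Z)%Z + 1).
Proof.
apply: eq_bigr => s _; congr corr.
have -> : k + n%:Z + s%:Z = k + s%:Z + n%:Z by lia.
by rewrite divzDr ?dvdzz// divzz nz.
Qed.

Lemma hh_shiftN k : hh (k - n%:Z) = \sum_(s < n) corr (((k + s%:Z) %/ n%:Z)%Z - 1).
Proof.
apply: eq_bigr => s _; congr corr.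
have -> : k + s%:Z = k - n%:Z + s%:Z + n%:Z by lia.
by rewrite [in RHS]divzDr ?dvdzz// divzz nz addrK.
Qed.

Lemma hh_le k : `|hh k| <= n%:R * energy.
Proof.
rewrite (le_trans (ler_norm_sum _ _ _))//.
have : \sum_(i < n) `|corr ((k + i%:Z) %/ n%:Z)%Z| <= \sum_(i < n) energy.
  by apply: ler_sum => i _; exact: corr_le.
by rewrite sumr_const card_ord mulr_natl.
Qed.

Lemma hh_lip k k' : `|hh k - hh k'| <= 2 * energy * `|k - k'|%:~R.
Proof.
have S j : `|hh (j + 1) - hh j| <= 2 * energy.
  rewrite hh_succ (le_trans (ler_normB _ _))//.
  have := corr_le ((j %/ n%:Z)%Z + 1); have := corr_le (j %/ n%:Z)%Z; lra.
have P j (d : nat) : `|hh (j + d%:Z) - hh j| <= 2 * energy * d%:R.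
  elim: d => [|d IH]; first by rewrite addr0 subrr normr0 mulr0.
  have -> : j + d.+1%:Z = j + d%:Z + 1 by lia.
  have -> : hh (j + d%:Z + 1) - hh j = (hh (j + d%:Z + 1) - hh (j + d%:Z)) + (hh (j + d%:Z) - hh j) by ring.
  rewrite (le_trans (ler_normD _ _))// -natr1.
  have := S (j + d%:Z); lra.
have [kk|kk] := lerP k' k.
  have := P k' (absz (k - k')); have -> : k' + (absz (k - k'))%:Z = k by lia.
  move/le_trans; apply; rewrite ler_wpM2l ?mulr_ge0 ?energy_ge0//.
  by rewrite -[X in X <= _]/(((absz (k - k'))%:Z)%:~R) ler_int; lia.
have := P k (absz (k' - k)); have -> : k + (absz (k' - k))%:Z = k' by lia.
rewrite distrC => /le_trans; apply; rewrite ler_wpM2l ?mulr_ge0 ?energy_ge0//.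
by rewrite -[X in X <= _]/(((absz (k' - k))%:Z)%:~R) ler_int; lia.
Qed.

(* The correlation of the two dilated and translated copies depends only on the difference of the
   integer parts, since the average over [s] runs over a full period of the grid. *)
Lemma corr_avg (u u' : int) (F : int -> R) :
  \sum_(s < n) F (((u' + s%:Z) %/ n%:Z)%Z - ((u + s%:Z) %/ n%:Z)%Z) =
  \sum_(s < n) F ((u' - u + s%:Z) %/ n%:Z)%Z.
Proof.
pose H v v' := \sum_(s < n) F (((v' + s%:Z) %/ n%:Z)%Z - ((v + s%:Z) %/ n%:Z)%Z).
have S v v' : H (v + 1) (v' + 1) = H v v'.
  rewrite /H; case: n n0 nz => // n' _ nz'.
  rewrite big_ord_recr [in RHS]big_ord_recl /= addrC !addr0.
  have E w : w + 1 + n'%:Z = w + n'.+1%:Z by lia.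
  rewrite !E !divzDr ?dvdzz// divzz nz' /=.
  congr (F _ + _); first by lia.
  by apply: eq_bigr => i _; congr (F ((_ %/ _)%Z - (_ %/ _)%Z)); rewrite /bump /=; lia.
have P v v' (d : nat) : H (v + d%:Z) (v' + d%:Z) = H v v'.
  elim: d => [|d IH]; first by rewrite !addr0.
  have E w : w + d.+1%:Z = w + d%:Z + 1 by lia.
  by rewrite !E S.
have -> : \sum_(s < n) F (((u' + s%:Z) %/ n%:Z)%Z - ((u + s%:Z) %/ n%:Z)%Z) = H u u' by [].
transitivity (H 0 (u' - u)); last first.
  apply: eq_bigr => s _; congr F.
  have -> : ((0 + s%:Z) %/ n%:Z)%Z = 0 by rewrite add0r divz_small//; have := ltn_ord s; lia.
  by rewrite subr0.
have [u0|u0] := lerP 0 u.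
  by rewrite -(P 0 (u' - u) (absz u)); congr H; lia.
by rewrite -(P u u' (absz u)); congr H; lia.
Qed.

Lemma window_ccorr (M : nat) (p p' : int) : (absz p + n <= M)%N ->
  \sum_(t < (2 * M)%N) c (t%:Z - M%:Z + p) * c (t%:Z - M%:Z + p') = ccorr (p' - p).
Proof.
move=> pM; rewrite /ccorr.
have pMz : 0 <= M%:Z - p by lia.
rewrite -(@window_sum n (2 * M) (absz (M%:Z - p)) (fun z => c z * c (z + (p' - p))));
  [|lia|by move=> z; rewrite mulf_eq0 negb_or => /andP[/c_supp]].
by apply: eq_bigr => t _; congr (c _ * c _); lia.
Qed.

(** The sum over [t] is a full correlation, which [ccorrE] rewrites as a second difference; the sum
    over [s] leaves only [u' - u] by [corr_avg]. A unit step of [corr] becomes a step [n] of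
    [hh]. *)
Lemma hh_second_diff (u u' : int) (M : nat) : (absz u + 2 * n <= M)%N ->
  \sum_(t < (2 * M)%N) \sum_(s < n)
     c ((u + (t%:Z - M%:Z) * n%:Z + s%:Z) %/ n%:Z)%Z * c ((u' + (t%:Z - M%:Z) * n%:Z + s%:Z) %/ n%:Z)%Z
  = 2 * hh (u' - u) - hh (u' - u - n%:Z) - hh (u' - u + n%:Z).
Proof.
move=> uM; rewrite exchange_big/=.
have E v (t : int) (s : int) : ((v + t * n%:Z + s) %/ n%:Z)%Z = t + ((v + s) %/ n%:Z)%Z.
  by rewrite addrAC addrC divzMDl.
transitivity (\sum_(s < n) ccorr (((u' + s%:Z) %/ n%:Z)%Z - ((u + s%:Z) %/ n%:Z)%Z)).
  apply: eq_bigr => s _; rewrite -(@window_ccorr M); last first.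
    have := ltn_ord s; have := divz_eq (u + s%:Z) n%:Z; have := modz_ge0 (u + s%:Z) nz.
    have := ltz_pmod (u + s%:Z) (n0 : 0 < n%:Z).
    set q := (_ %/ _)%Z; set m := (_ %% _)%Z; nia.
  by apply: eq_bigr => t _; rewrite !E.
rewrite corr_avg hh_shift hh_shiftN /hh mulr_sumr -!sumrB; apply: eq_bigr => s _.
by rewrite ccorrE.
Qed.

End autocorrelation.

(** * Cancellation in sums of second differences along floor sequences *)

Section telescoping.
Context (R : realType).

Lemma telescope_le (G : int -> R) (B : R) (L : nat) (a r : int) :
  (forall z, `|G z| <= B) ->
  `|\sum_(l < L) (G (l%:Z + a) - G (l%:Z + a + r))| <= 2 * B * `|r|%:~R.
Proof.
move=> GB.
have P (d : nat) b : `|\sum_(l < L) (G (l%:Z + b) - G (l%:Z + b + d%:Z))| <= 2 * B * d%:R.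
  elim: d => [|d IH].
    by rewrite big1 ?normr0 ?mulr0// => i _; rewrite addr0 subrr.
  have -> : \sum_(l < L) (G (l%:Z + b) - G (l%:Z + b + d.+1%:Z)) =
     \sum_(l < L) (G (l%:Z + b) - G (l%:Z + b + d%:Z)) +
     \sum_(l < L) (G (l%:Z + b + d%:Z) - G (l.+1%:Z + b + d%:Z)).
    rewrite -big_split/=; apply: eq_bigr => l _; rewrite addrA subrK.
    by congr (_ - G _); lia.
  have -> : \sum_(l < L) (G (l%:Z + b + d%:Z) - G (l.+1%:Z + b + d%:Z)) =
     G (b + d%:Z) - G (L%:Z + b + d%:Z).
    elim: (L) => [|L' IHL]; first by rewrite big_ord0 add0r subrr.
    by rewrite big_ord_recr/= IHL; ring.
  rewrite (le_trans (ler_normD _ _))// -[d.+1%:R]natr1 (mulrDr (2 * B)) mulr1 lerD//.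
  rewrite (le_trans (ler_normB _ _))//.
  by have := GB (b + d%:Z); have := GB (L%:Z + b + d%:Z); lra.
have [r0|r0] := lerP 0 r.
  by have := P (absz r) a; have -> : (absz r)%:Z = r by lia.
have := P (absz r) (a + r).
have -> : \sum_(l < L) (G (l%:Z + (a + r)) - G (l%:Z + (a + r) + (absz r)%:Z)) =
    - \sum_(l < L) (G (l%:Z + a) - G (l%:Z + a + r)).
  rewrite -sumrN; apply: eq_bigr => l _; rewrite opprB; congr (G _ - G _); lia.
by rewrite normrN.
Qed.

Lemma floor_bounds (x : R) : (Num.floor x)%:~R <= x < (Num.floor x)%:~R + 1.
Proof. by have := floor_itv x; rewrite intrD. Qed.

Lemma floor_divn (y : R) (n : nat) : (0 < n)%N ->
  Num.floor (y / n%:R) = (Num.floor y %/ n%:Z)%Z.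
Proof.
move=> n0; have n0' : 0 < n%:R :> R by rewrite ltr0n.
apply: floor_def; have /andP[h1 h2] := floor_bounds y.
have nz : n%:Z != 0 by lia.
have E := divz_eq (Num.floor y) n%:Z; have m0 := modz_ge0 (Num.floor y) nz.
have m1 := ltz_pmod (Num.floor y) (n0 : 0 < n%:Z).
rewrite ler_pdivlMr// ltr_pdivrMr//.
set q := (_ %/ _)%Z in E *; set m := (_ %% _)%Z in E m0 m1.
have A : q * n%:Z <= Num.floor y by lia.
have B : Num.floor y + 1 <= (q + 1) * n%:Z by nia.
apply/andP; split.
  by rewrite (le_trans _ h1)//; move: A; rewrite -(ler_int R) intrM.
by rewrite (lt_le_trans h2)//; move: B; rewrite -(ler_int R) intrM intrD.
Qed.

(** Since [k l] is [l (x' - x)] up to 1, adding [n] to [k l] amounts to shifting [l] by about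
    [n / (x' - x)]. The shifted sum telescopes and leaves about that many boundary terms of size
    [n A]; the rounding in each of the [L] terms is paid for by the Lipschitz bound. *)
Lemma floor_diff_far (h : int -> R) (n : nat) (A B : R) (L l0 : nat) (x x' : R) (sg : R) (k : int -> int) :
  (forall z, `|h z| <= n%:R * A) -> (forall z w, `|h z - h w| <= 2 * A * `|z - w|%:~R) ->
  (0 < n)%N -> 0 < sg -> sg <= `|x' - x| -> `|x' - x| <= B ->
  (forall l : int, k l = Num.floor (l%:~R * x') - Num.floor (l%:~R * x)) ->
  `|\sum_(l < L) (2 * h (k (l%:Z + l0%:Z)) - h (k (l%:Z + l0%:Z) - n%:Z) - h (k (l%:Z + l0%:Z) + n%:Z))|
   <= 4 * A * (n%:R * (n%:R / sg + 1) + L%:R * (B + 2)).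
Proof.
move=> hb hl n0 sg0 ux uB kdef.
have n0' : 0 < n%:R :> R by rewrite ltr0n.
have A0 : 0 <= A by have := le_trans (normr_ge0 _) (hb 0); rewrite pmulr_rge0.
set u := x' - x in ux uB.
have u0 : u != 0 by rewrite -normr_gt0 (lt_le_trans sg0).
have kE l : `|(k l)%:~R - l%:~R * u| < 1.
  rewrite kdef intrB; have /andP[a1 a2] := floor_bounds (l%:~R * x').
  have /andP[b1 b2] := floor_bounds (l%:~R * x).
  by rewrite ltr_norml /u mulrBr; apply/andP; split; lra.
have half (e : int) : `|e| = 1 ->
   `|\sum_(l < L) (h (k (l%:Z + l0%:Z)) - h (k (l%:Z + l0%:Z) + e * n%:Z))|
   <= 2 * A * (n%:R * (n%:R / sg + 1) + L%:R * (B + 2)).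
  move=> e1.
  pose r := e * Num.floor (n%:R / u).
  have e1R : `|e%:~R : R| = 1 by rewrite -intr_norm e1.
  have r1 : `|r%:~R * u - e%:~R * n%:R| <= `|u|.
    have -> : r%:~R * u - e%:~R * n%:R = e%:~R * (((Num.floor (n%:R / u))%:~R - n%:R / u) * u).
      by rewrite /r intrM; field.
    rewrite normrM e1R mul1r normrM ler_piMl// ler_norml.
    have /andP[a1 a2] := floor_bounds (n%:R / u).
    by apply/andP; split; lra.
  have rb : `|r|%:~R <= n%:R / sg + 1 :> R.
    rewrite /r normrM e1 mul1r intr_norm.
    have /andP[a1 a2] := floor_bounds (n%:R / u).
    have : `|n%:R / u| <= n%:R / sg.
      by rewrite normrM normfV gtr0_norm// ler_pM2l// lef_pV2// posrE (lt_le_trans sg0).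
    rewrite ler_norml => /andP[b1 b2]; rewrite ler_norml; apply/andP; split; lra.
  have -> : \sum_(l < L) (h (k (l%:Z + l0%:Z)) - h (k (l%:Z + l0%:Z) + e * n%:Z)) =
     \sum_(l < L) (h (k (l%:Z + l0%:Z)) - h (k (l%:Z + l0%:Z + r))) +
     \sum_(l < L) (h (k (l%:Z + l0%:Z + r)) - h (k (l%:Z + l0%:Z) + e * n%:Z)).
    by rewrite -big_split/=; apply: eq_bigr => l _; rewrite addrA subrK.
  rewrite (le_trans (ler_normD _ _))// mulrDr lerD//.
    apply: (le_trans (@telescope_le (h \o k) (n%:R * A) L l0%:Z r _)); first by move=> z; exact: hb.
    by rewrite -!mulrA ler_pM2l// mulrCA ler_wpM2l// ler_pM2l.
  rewrite (le_trans (ler_norm_sum _ _ _))//.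
  rewrite [X in _ <= X](_ : _ = \sum_(l < L) 2 * A * (B + 2)); last first.
    by rewrite sumr_const card_ord -[RHS]mulr_natl mulrCA.
  apply: ler_sum => l _.
  apply: (le_trans (hl _ _)); rewrite ler_wpM2l ?mulr_ge0//.
  rewrite intr_norm.
  have -> : (k (l%:Z + l0%:Z + r) - (k (l%:Z + l0%:Z) + e * n%:Z))%:~R =
     (k (l%:Z + l0%:Z + r))%:~R - (k (l%:Z + l0%:Z))%:~R - e%:~R * n%:R :> R.
    by rewrite rmorphB rmorphD rmorphM /=; ring.
  have := kE (l%:Z + l0%:Z + r); have := kE (l%:Z + l0%:Z).
  have -> : (l%:Z + l0%:Z + r)%:~R = (l%:Z + l0%:Z)%:~R + r%:~R :> R by rewrite rmorphD.
  move: r1 uB; rewrite !ltr_norml !ler_norml => /andP[r1 r2] uB /andP[a1 a2] /andP[b1 b2].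
  have := ler_norm u; have := ler_norm (- u); rewrite normrN => u1 u2.
  have uB' : `|u| <= B by rewrite ler_norml.
  by apply/andP; split; lra.
have -> : \sum_(l < L) (2 * h (k (l%:Z + l0%:Z)) - h (k (l%:Z + l0%:Z) - n%:Z) - h (k (l%:Z + l0%:Z) + n%:Z))
  = \sum_(l < L) (h (k (l%:Z + l0%:Z)) - h (k (l%:Z + l0%:Z) + (-1) * n%:Z)) +
    \sum_(l < L) (h (k (l%:Z + l0%:Z)) - h (k (l%:Z + l0%:Z) + 1 * n%:Z)).
  by rewrite -big_split/=; apply: eq_bigr => l _; rewrite mulN1r mul1r; ring.
rewrite (le_trans (ler_normD _ _))//.
have := half 1 erefl; have := half (-1) erefl; lra.
Qed.

End telescoping.

Lemma step_floor (R : realType) n (e : int -> R) y : (0 < n)%N -> (forall z, e z != 0 -> 0 <= z < n%:Z) ->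
  step n (fun i => e i%:Z) y = e (Num.floor (y * n%:R)).
Proof.
move=> n0 e0; have n0' : 0 < n%:R :> R by rewrite ltr0n.
have Z z : ~~ (0 <= z < n%:Z) -> e z = 0.
  by move=> h; apply/eqP; apply/negPn; apply: contra h => /e0.
case: (boolP ((0 <= y) && (y < 1))) => [/andP[y0 y1]|yo]; last first.
  rewrite step_out// Z//; apply: contra yo => /andP[h1 h2].
  have /andP[f1 f2] := floor_bounds (y * n%:R).
  rewrite -(pmulr_lge0 _ n0') (le_trans _ f1) ?ler0z//=.
  rewrite -(ltr_pM2r n0') mul1r (lt_le_trans f2)//.
  have : Num.floor (y * n%:R) + 1 <= n%:Z by lia.
  by rewrite -(ler_int R) rmorphD.
have [i ni iy] := cell_ex n0 y0 y1; rewrite (step_cell _ ni iy); congr e.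
apply/esym/floor_def; move: iy => /andP[]; rewrite ler_pdivrMr// ltr_pdivlMr//.
by rewrite rmorphD/= -natr1 => -> ->.
Qed.

(** * A Bessel inequality for affine translates of the step function *)

Section bessel.
Context (R : realType).

Lemma ip_abs_le (f g F G : R -> R) : L2 f -> L2 g -> L2 F -> L2 G ->
  (forall x, `|f x * g x| <= F x * G x) -> `|ip f g| <= ip F G.
Proof.
move=> Lf Lg LF LG H; rewrite ler_norml; apply/andP; split.
  rewrite lerNl -mulN1r -ipZl//; apply: int_le; [by apply: L2M => //; exact: L2Z|exact: L2M|].
  by move=> x; rewrite mulN1r mulNr (le_trans _ (H x))// -normrN ler_norm.
apply: int_le; [exact: L2M|exact: L2M|].
by move=> x; rewrite (le_trans _ (H x))// ler_norm.
Qed.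

Lemma ip_le_sqrt (f g : R -> R) : L2 f -> L2 g -> ip f g <= Num.sqrt (N f) * Num.sqrt (N g).
Proof.
move=> Lf Lg; have := cauchy_schwarz Lf Lg.
rewrite -sqrtrM ?N_ge0// => h; rewrite (le_trans (ler_norm _))// -sqrtr_sqr ler_sqrt//.
by rewrite mulr_ge0 ?N_ge0.
Qed.

Lemma L2_abs (f : R -> R) : L2 f -> L2 (fun x => `|f x|).
Proof.
move=> [mf f2]; split; first exact: measurableT_comp.
by move: f2; congr intble; apply/funext => x; rewrite real_normK ?num_real.
Qed.

Lemma N_abs (f : R -> R) : N (fun x => `|f x|) = N f.
Proof. by congr integ; apply/funext => x; rewrite -!expr2 real_normK ?num_real. Qed.

Variables (n : nat) (c e : int -> R).
Hypothesis n0 : (0 < n)%N.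
Hypothesis e0 : forall z, e z != 0 -> 0 <= z < n%:Z - 1.
Hypothesis ce : forall z, c z = e z - e (z - 1).
Let phi := step n (fun i => c i%:Z).
Local Notation E := (energy n e).

Lemma stepE (y : R) : phi y = c (Num.floor (y * n%:R)).
Proof. exact: step_floor n0 (c_supp n0 e0 ce). Qed.

(** The affine translate of [phi] with slope [l / n^2], without the factor that makes it unitary.
    The shift is written [(t - M) n + s] so that [t] counts units of length [1 / n] and [s] runs
    over one period of the grid of mesh [1 / n^2]. *)
Definition atom (M : nat) (l t s : nat) (x : R) : R :=
  phi ((l%:R * x + ((t%:Z - M%:Z) * n%:Z + s%:Z)%:~R) / (n ^ 2)%:R).

Lemma atomE M l t s x :
  atom M l t s x = c ((Num.floor (l%:R * x) + (t%:Z - M%:Z) * n%:Z + s%:Z) %/ n%:Z)%Z.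
Proof.
have n0' : n%:R != 0 :> R by rewrite pnatr_eq0 -lt0n.
rewrite /atom stepE; congr c.
have -> : (l%:R * x + ((t%:Z - M%:Z) * n%:Z + s%:Z)%:~R) / (n ^ 2)%:R * n%:R =
   (l%:R * x + ((t%:Z - M%:Z) * n%:Z + s%:Z)%:~R) / n%:R :> R.
  by rewrite natrX; field.
rewrite floor_divn//; congr (_ %/ _)%Z.
by rewrite floorDrz ?intr_int// intrKfloor addrA.
Qed.

Definition aff (l : nat) (z : int) : mat R := (l%:R / (n ^ 2)%:R, z%:~R / (n ^ 2)%:R, 0, 1).

Lemma T_aff M l t s : (0 < l)%N ->
  T (aff l ((t%:Z - M%:Z) * n%:Z + s%:Z)) phi =
  (fun x => Num.sqrt (l%:R / (n ^ 2)%:R) * atom M l t s x).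
Proof.
move=> l0; apply/funext => x; rewrite /T /aff /mob /den /mdet /ma /mb /mc /md /=.
rewrite mul0r add0r normr1 !divr1 mulr1 mulr0 subr0; congr (_ * phi _).
by rewrite [RHS]mulrDl; congr (_ + _); exact: mulrAC.
Qed.

Lemma L2_atom M l t s : (0 < l)%N -> L2 (atom M l t s).
Proof.
move=> l0; have l0' : 0 < l%:R / (n ^ 2)%:R :> R by rewrite divr_gt0 ?ltr0n// expn_gt0 n0.
have h : L2 (T (aff l ((t%:Z - M%:Z) * n%:Z + s%:Z)) phi).
  apply: L2_T; last exact: L2_step.
  by rewrite /mdet /aff /ma /mb /mc /md /= mulr1 mulr0 subr0.
have := L2Z (Num.sqrt (l%:R / (n ^ 2)%:R))^-1 h; congr L2; apply/funext => x.
by rewrite T_aff// mulrA mulVf ?mul1r// gt_eqF// sqrtr_gt0.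
Qed.

(** The sum of squares is the pairing of [psi] with [th], the image of [psi] under the kernel
    [W x x'], the sum of [a x] times [a x'] over all atoms. By [hh_second_diff] the kernel is a sum
    of second differences over [l]: it is at most [W1] everywhere, and at most [W2] at distance [sg]
    or more by [floor_diff_far]. Cauchy-Schwarz on the band of half-width [sg] and on [[-X, X]]
    bounds [th] pointwise. *)
Lemma bessel (L l0 M : nat) (X sg : R) (psi : R -> R) :
  (0 < l0)%N -> 0 < sg -> 1 <= X -> L2 psi ->
  (forall x, ~~ ((- X <= x) && (x < X)) -> psi x = 0) ->
  (l0 + L)%:R * X + 1 + (2 * n)%:R <= M%:R ->
  \sum_(l < L) \sum_(t < (2 * M)%N) \sum_(s < n) ip (atom M (l + l0) t s) psi ^+ 2
  <= (4 * L%:R * n%:R * E * Num.sqrt (2 * sg) +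
      4 * E * (n%:R * (n%:R / sg + 1) + L%:R * (2 * X + 2)) * Num.sqrt (2 * X))
     * Num.sqrt (2 * X) * N psi.
Proof.
move=> l00 sg0 X1 Lpsi psi0 MX.
pose W1 := 4 * L%:R * n%:R * E.
pose W2 := 4 * E * (n%:R * (n%:R / sg + 1) + L%:R * (2 * X + 2)).
have E0 : 0 <= E by exact: energy_ge0.
have n0' : 0 < n%:R :> R by rewrite ltr0n.
have W10 : 0 <= W1 by rewrite /W1 !mulr_ge0.
have W20 : 0 <= W2.
  by rewrite /W2 !mulr_ge0// addr_ge0// mulr_ge0 ?addr_ge0// ?divr_ge0//; lra.
pose I : finType := ('I_L * ('I_(2 * M) * 'I_n))%type.
pose a (k : I) := atom M (k.1 + l0) k.2.1 k.2.2.
have La k : L2 (a k) by apply: L2_atom; rewrite addn_gt0 l00 orbT.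
pose v (k : I) := ip (a k) psi.
have triple (F : nat -> nat -> nat -> R) : \sum_(k : I) F k.1 k.2.1 k.2.2 =
    \sum_(l < L) \sum_(t < (2 * M)%N) \sum_(s < n) F l t s.
  under [RHS]eq_bigr do rewrite pair_bigA/=.
  by rewrite pair_bigA/=.
rewrite -(triple (fun l t s => ip (atom M (l + l0) t s) psi ^+ 2)).
pose W x x' := \sum_(k : I) a k x * a k x'.
have Wbound x x' : - X <= x -> x < X -> - X <= x' -> x' < X ->
    `|W x x'| <= W1 /\ (sg <= `|x' - x| -> `|W x x'| <= W2).
  move=> x1 x2 y1 y2.
  pose k (l : int) := Num.floor (l%:~R * x') - Num.floor (l%:~R * x).
  have WE : W x x' = \sum_(l < L) (2 * hh n e (k (l%:Z + l0%:Z)) -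
       hh n e (k (l%:Z + l0%:Z) - n%:Z) - hh n e (k (l%:Z + l0%:Z) + n%:Z)).
    rewrite /W (triple (fun l t s => atom M (l + l0) t s x * atom M (l + l0) t s x')).
    apply: eq_bigr => l _.
    rewrite /k -(@hh_second_diff _ n c e n0 e0 ce _ _ M).
      by apply: eq_bigr => t _; apply: eq_bigr => s _; rewrite !atomE.
    have lE : (l%:Z + l0%:Z)%:~R = (l + l0)%:R :> R by rewrite rmorphD natrD.
    have bx : `|(Num.floor ((l + l0)%:R * x))%:~R| <= (l0 + L)%:R * X + 1.
      have /andP[f1 f2] := floor_bounds ((l + l0)%:R * x).
      have lL : (l + l0)%:R <= (l0 + L)%:R :> R by rewrite ler_nat addnC leq_add2l ltnW.
      have : `|(l + l0)%:R * x| <= (l0 + L)%:R * X.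
        by rewrite normrM ger0_norm// ler_pM// ler_norml x1 ltW.
      by rewrite !ler_norml => /andP[g1 g2]; apply/andP; split; lra.
    rewrite lE -(ler_nat R) natrD (le_trans _ MX)// lerD2r (le_trans _ bx)//.
    by rewrite -intr_norm -abszE.
  rewrite WE; split.
    rewrite (le_trans (ler_norm_sum _ _ _))//.
    rewrite /W1 [X in _ <= X](_ : _ = \sum_(l < L) 4 * (n%:R * E)); last first.
      by rewrite sumr_const card_ord -[RHS]mulr_natl; ring.
    apply: ler_sum => l _; have H := hh_le n0 e0.
    have H1 := H (k (l%:Z + l0%:Z)); have H2 := H (k (l%:Z + l0%:Z) - n%:Z).
    have H3 := H (k (l%:Z + l0%:Z) + n%:Z).
    rewrite (le_trans (ler_normB _ _))// (le_trans (lerD (ler_normB _ _) (lexx _)))//.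
    by rewrite normrM ger0_norm//; lra.
  move=> sx; apply: (@floor_diff_far _ _ n E _ L l0 x x' sg k) => //.
  - by move=> z; exact: hh_le.
  - by move=> z w; exact: hh_lip.
  - by rewrite ler_norml; apply/andP; split; lra.
pose th x := \sum_(k : I) v k * a k x.
have Lth : L2 th by apply: L2sum => k; exact: L2Z.
have Labs := L2_abs Lpsi.
set B := W1 * Num.sqrt (2 * sg) + W2 * Num.sqrt (2 * X).
have B0 : 0 <= B by rewrite addr_ge0// mulr_ge0// sqrtr_ge0.
have thB x : - X <= x -> x < X -> `|th x| <= B * Num.sqrt (N psi).
  move=> x1 x2.
  have LW : L2 (W x) by apply: L2sum => k; exact: L2Z.
  have -> : th x = ip (W x) psi.
    rewrite /W ip_suml//; last by move=> k; exact: L2Z.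
    by apply: eq_bigr => k _; rewrite ipZl// mulrC.
  pose G y := W1 * ind (x - sg) (x + sg) y + W2 * ind (- X) X y.
  have LG1 : L2 (fun y => W1 * ind (x - sg) (x + sg) y) by apply: L2Z; exact: L2_ind.
  have LG2 : L2 (fun y => W2 * ind (- X) X y) by apply: L2Z; exact: L2_ind.
  have LG : L2 G by exact: L2D.
  apply: (le_trans (ip_abs_le LW Lpsi LG Labs _)).
    move=> y; rewrite normrM.
    case: (boolP ((- X <= y) && (y < X))) => [/andP[y1 y2]|yo]; last first.
      by rewrite (psi0 _ yo) normr0 !mulr0.
    rewrite ler_wpM2r// /G /ind y1 y2 mulr1.
    have [b1 b2] := Wbound x y x1 x2 y1 y2.
    have [/b2 h|h] := leP sg `|y - x|.
      by rewrite (le_trans h)// lerDr mulr_ge0.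
    move: h; rewrite ltr_norml => /andP[h1 h2].
    have -> : (x - sg <= y) && (y < x + sg) by apply/andP; split; lra.
    by rewrite mulr1 (le_trans b1)// lerDl.
  have il a' b' : a' <= b' -> ip (ind a' b') (fun y => `|psi y|) <= Num.sqrt (b' - a') * Num.sqrt (N psi).
    move=> ab; rewrite -(N_abs psi) -(ip_ind ab); apply: ip_le_sqrt => //; exact: L2_ind.
  rewrite /G ipDl// !ipZl//; try exact: L2_ind.
  rewrite /B mulrDl -[W1 * _ * _]mulrA -[W2 * _ * _]mulrA; apply: lerD; apply: ler_wpM2l => //.
    have := il (x - sg) (x + sg); have -> : x + sg - (x - sg) = 2 * sg by ring.
    by apply; lra.
  have := il (- X) X; have -> : X - - X = 2 * X by ring.
  by apply; lra.
have -> : \sum_(k : I) ip (atom M (k.1 + l0) k.2.1 k.2.2) psi ^+ 2 = ip th psi.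
  rewrite /th ip_suml//; last by move=> k; exact: L2Z.
  by apply: eq_bigr => k _; rewrite ipZl// expr2.
have LI : L2 (fun x => B * Num.sqrt (N psi) * ind (- X) X x) by apply: L2Z; exact: L2_ind.
apply: (le_trans (ler_norm _)); apply: (le_trans (ip_abs_le Lth Lpsi LI Labs _)).
  move=> y; rewrite normrM.
  case: (boolP ((- X <= y) && (y < X))) => [/andP[y1 y2]|yo]; last first.
    by rewrite (psi0 _ yo) normr0 !mulr0.
  by rewrite ler_wpM2r// /ind y1 y2 mulr1; exact: thB.
rewrite ipZl//; last exact: L2_ind.
have ii : ip (ind (- X) X) (fun y => `|psi y|) <= Num.sqrt (2 * X) * Num.sqrt (N psi).
  rewrite -(N_abs psi); have -> : 2 * X = N (ind (- X) X) by rewrite /N ip_ind; lra.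
  by apply: ip_le_sqrt => //; exact: L2_ind.
apply: (@le_trans _ _ (B * Num.sqrt (N psi) * (Num.sqrt (2 * X) * Num.sqrt (N psi)))).
  by rewrite ler_wpM2l// mulr_ge0// sqrtr_ge0.
have -> : N psi = Num.sqrt (N psi) ^+ 2 by rewrite sqr_sqrtr ?N_ge0.
rewrite sqrtr_sqr ger0_norm ?sqrtr_ge0//.
by rewrite le_eqVlt; apply/orP; left; apply/eqP; ring.
Qed.

End bessel.

(** * Sums of translates indexed by words, with multiplicities *)

Section flattening.
Context (R : realType).

Lemma L2sumP (I : Type) (r : seq I) (P : pred I) (F : I -> R -> R) :
  (forall i, P i -> L2 (F i)) -> L2 (fun x => \sum_(i <- r | P i) F i x).
Proof.
move=> H; elim: r => [|i r IH].
  by under eq_fun do rewrite big_nil; exact: L20.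
under eq_fun do rewrite big_cons.
case: (boolP (P i)) => [Pi|_]; last exact: IH.
by apply: L2D IH; exact: H.
Qed.

Lemma ip_sumlP (I : Type) (r : seq I) (P : pred I) (F : I -> R -> R) h :
  (forall i, P i -> L2 (F i)) -> L2 h ->
  ip (fun x => \sum_(i <- r | P i) F i x) h = \sum_(i <- r | P i) ip (F i) h.
Proof.
move=> LF Lh; elim: r => [|i r IH].
  by under eq_fun do rewrite big_nil; rewrite ip0l big_nil.
under eq_fun do rewrite big_cons; rewrite big_cons.
case: (boolP (P i)) => [Pi|_]; last exact: IH.
by rewrite ipDl ?IH//; [exact: LF|exact: L2sumP].
Qed.

Lemma ip_le_mean (f g : R -> R) : L2 f -> L2 g -> ip f g <= (N f + N g) / 2.
Proof. by move=> Lf Lg; have := N_ge0 (fun x => f x - g x); rewrite N_sub//; lra. Qed.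

Lemma N_sum_le (I : Type) (r : seq I) (F : I -> R -> R) : (forall i, L2 (F i)) ->
  N (fun x => \sum_(i <- r) F i x) <= (size r)%:R * \sum_(i <- r) N (F i).
Proof.
move=> LF; have LS := L2sum r LF; rewrite {1}/N ip_suml//.
under eq_bigr do rewrite ip_sumr//.
apply: le_trans (_ : \sum_(i <- r) \sum_(j <- r) (N (F i) + N (F j)) / 2 <= _).
  by apply: ler_sum => i _; apply: ler_sum => j _; exact: ip_le_mean.
under eq_bigr do rewrite -big_distrl/= big_split/= big_const_seq iter_addr_0 count_predT.
rewrite -big_distrl/= big_split/= sumrMnl big_const_seq iter_addr_0 count_predT.
by rewrite -mulr_natl; lra.
Qed.

Lemma N_sum_le_max (I : eqType) (r : seq I) (F : I -> R -> R) (B : R) : (forall i, L2 (F i)) ->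
  (forall i, i \in r -> N (F i) <= B) ->
  N (fun x => \sum_(i <- r) F i x) <= (size r)%:R ^+ 2 * B.
Proof.
move=> LF H; apply: le_trans (N_sum_le r LF) _; rewrite expr2 -mulrA ler_wpM2l//.
rewrite big_seq; apply: le_trans (_ : \sum_(i <- r | i \in r) B <= _); first exact: ler_sum.
by rewrite -big_seq big_const_seq iter_addr_0 count_predT mulr_natl.
Qed.

Lemma sum_key (W : eqType) (K : finType) (ws : seq W) (P : pred W) (key : W -> K) (u : K -> R) :
  \sum_(w <- ws | P w) u (key w) = \sum_k (count (fun w => P w && (key w == k)) ws)%:R * u k.
Proof.
elim: ws => [|w ws IH].
  by rewrite big_nil big1// => k _; rewrite mul0r.
rewrite big_cons IH /=; case: (P w) => /=; last by apply: eq_bigr => k _; rewrite add0n.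
under [RHS]eq_bigr do rewrite natrD mulrDl.
rewrite big_split/=; congr (_ + _).
by rewrite (bigD1 (key w))//= eqxx mul1r big1 ?addr0// => k; rewrite eq_sym => /negbTE ->; rewrite mul0r.
Qed.

Lemma cauchy_sum (K : finType) (a b : K -> R) :
  (\sum_k a k * b k) ^+ 2 <= (\sum_k a k ^+ 2) * (\sum_k b k ^+ 2).
Proof.
have D : \sum_k \sum_l (a k * b l - a l * b k) ^+ 2 =
    2 * ((\sum_k a k ^+ 2) * (\sum_k b k ^+ 2) - (\sum_k a k * b k) ^+ 2).
  have e1 : \sum_k \sum_l a k ^+ 2 * b l ^+ 2 = (\sum_k a k ^+ 2) * (\sum_k b k ^+ 2).
    by rewrite big_distrl/=; apply: eq_bigr => k _; rewrite big_distrr.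
  have e2 : \sum_k \sum_l a l ^+ 2 * b k ^+ 2 = (\sum_k a k ^+ 2) * (\sum_k b k ^+ 2).
    by rewrite exchange_big.
  have e3 : \sum_k \sum_l (a k * b k) * (a l * b l) = (\sum_k a k * b k) ^+ 2.
    by rewrite expr2 big_distrl/=; apply: eq_bigr => k _; rewrite big_distrr.
  rewrite (_ : 2 * _ = \sum_k \sum_l a k ^+ 2 * b l ^+ 2 + \sum_k \sum_l a l ^+ 2 * b k ^+ 2 -
      (\sum_k \sum_l (a k * b k) * (a l * b l) + \sum_k \sum_l (a k * b k) * (a l * b l))).
    rewrite -!big_split/= -sumrB; apply: eq_bigr => k _.
    by rewrite -!big_split/= -sumrB; apply: eq_bigr => l _; ring.
  by rewrite e1 e2 e3; ring.
have : 0 <= \sum_k \sum_l (a k * b l - a l * b k) ^+ 2.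
  by apply: sumr_ge0 => k _; apply: sumr_ge0 => l _; exact: sqr_ge0.
by rewrite D; lra.
Qed.

Variables (n : nat) (c e : int -> R).
Hypothesis n0 : (0 < n)%N.
Hypothesis e0 : forall z, e z != 0 -> 0 <= z < n%:Z - 1.
Hypothesis ce : forall z, c z = e z - e (z - 1).
Let phi := step n (fun i => c i%:Z).
Local Notation E := (energy n e).
Let Lphi : L2 phi. Proof. exact: L2_step. Qed.

Variables (L l0 M Ny : nat) (X sg : R) (W : eqType) (ws : seq W).
Variables (key : W -> 'I_L * ('I_(2 * M) * 'I_n)) (ky : W -> 'I_Ny) (nn : 'I_Ny -> mat R).
Hypothesis l00 : (0 < l0)%N.
Hypothesis sg0 : 0 < sg.
Hypothesis X1 : 1 <= X.
Hypothesis MX : (l0 + L)%:R * X + 1 + (2 * n)%:R <= M%:R.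
Hypothesis nn0 : forall y, 0 < mdet (nn y).

Definition key_aff (k : 'I_L * ('I_(2 * M) * 'I_n)) : mat R :=
  aff R n (k.1 + l0) ((k.2.1%:Z - M%:Z) * n%:Z + k.2.2%:Z).

Hypothesis key_supp : forall w, w \in ws -> forall x,
  ~~ ((- X <= x) && (x < X)) -> T (key_aff (key w)) phi x = 0.

Let Bess := (4 * L%:R * n%:R * E * Num.sqrt (2 * sg) +
      4 * E * (n%:R * (n%:R / sg + 1) + L%:R * (2 * X + 2)) * Num.sqrt (2 * X))
     * Num.sqrt (2 * X).

Let Bess0 : 0 <= Bess.
Proof.
have E0 : 0 <= E by exact: energy_ge0.
rewrite /Bess mulr_ge0 ?sqrtr_ge0// addr_ge0// !mulr_ge0 ?sqrtr_ge0//.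
have h : 0 <= n%:R / sg by rewrite divr_ge0// ltW.
have h2 : 0 <= 2 * X + 2 by rewrite addr_ge0// mulr_ge0// (le_trans ler01).
by apply: addr_ge0; apply: mulr_ge0 => //; exact: addr_ge0.
Qed.

Let W0 : 0 <= (l0 + L)%:R / (n ^ 2)%:R * Bess.
Proof. exact: mulr_ge0. Qed.

Let kdet k : 0 < mdet (key_aff k).
Proof.
rewrite /key_aff /aff /mdet /ma /mb /mc /md /= mulr1 mulr0 subr0 divr_gt0// ltr0n ?expn_gt0 ?n0//.
by rewrite addn_gt0 l00 orbT.
Qed.

Let LT k : L2 (T (key_aff k) phi). Proof. exact: L2_T. Qed.

Let coll y := \sum_k (count (fun w => (ky w == y) && (key w == k)) ws)%:R ^+ 2 : R.

(** Duality: [N F] is the sum of the pairings of [F] with the translates, weighted by multiplicity.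
    Cauchy-Schwarz over the keys and the Bessel inequality applied to [F] itself produce a factor
    [N F] that cancels. *)
Lemma N_fiber y : N (fun x => \sum_(w <- ws | ky w == y) T (key_aff (key w)) phi x) <=
   coll y * ((l0 + L)%:R / (n ^ 2)%:R * Bess).
Proof.
set F := (fun x => _); have LF : L2 F by apply: L2sumP.
pose u k := ip (T (key_aff k) phi) F.
have NF : N F = \sum_k (count (fun w => (ky w == y) && (key w == k)) ws)%:R * u k.
  by rewrite {1}/N {1}/F ip_sumlP// -(sum_key ws (fun w => ky w == y) key u).
have sF x : ~~ ((- X <= x) && (x < X)) -> F x = 0.
  by move=> xX; rewrite /F big_seq_cond big1// => w /andP[ww _]; exact: key_supp.
have n2 : 0 < (n ^ 2)%:R :> R by rewrite ltr0n expn_gt0 n0.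
have su : \sum_k u k ^+ 2 <= (l0 + L)%:R / (n ^ 2)%:R * Bess * N F.
  have := bessel n0 e0 ce l00 sg0 X1 LF sF MX; rewrite -/Bess => B.
  rewrite -mulrA; apply: le_trans (ler_wpM2l _ B); last by rewrite divr_ge0.
  have -> : \sum_k u k ^+ 2 = \sum_(l < L) \sum_(t < 2 * M) \sum_(s < n) u (l, (t, s)) ^+ 2.
    under [RHS]eq_bigr => l _ do rewrite (pair_bigA _ (fun t s => u (l, (t, s)) ^+ 2)).
    by rewrite pair_bigA; apply: eq_bigr => -[l [t s]].
  rewrite big_distrr/=; apply: ler_sum => l _; rewrite big_distrr/=; apply: ler_sum => t _.
  rewrite big_distrr/=; apply: ler_sum => s _.
  rewrite /u /key_aff /= T_aff ?addn_gt0 ?l00 ?orbT// ipZl//; last by apply: L2_atom => //; rewrite addn_gt0 l00 orbT.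
  rewrite exprMn sqr_sqrtr ?divr_ge0// ler_wpM2r ?sqr_ge0// ler_wpM2r ?invr_ge0 ?ltW//.
  by rewrite ltr_nat addnC ltn_add2l.
have C0 : 0 <= coll y by apply: sumr_ge0 => k _; exact: sqr_ge0.
have [N0|N0] := eqVneq (N F) 0.
  by rewrite N0; apply: mulr_ge0.
have Np : 0 < N F by rewrite lt_def N0 N_ge0.
rewrite -(ler_pM2r Np) -mulrA -expr2 {1}NF.
apply: le_trans (cauchy_sum _ _) _; rewrite -/(coll y) -mulrA ler_wpM2l//.
by rewrite [_ * (_ * Bess)]mulrA.
Qed.

(** The unipotent parts act unitarily and take [Ny] values, so separating them costs a factor [Ny].
    What remains after [N_fiber] is the number of pairs of words with the same unipotent part and
    the same key. *)
Lemma N_flatten :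
  N (fun x => \sum_(w <- ws) T (nn (ky w)) (T (key_aff (key w)) phi) x) <=
  Ny%:R * ((l0 + L)%:R / (n ^ 2)%:R * Bess) *
    (\sum_(w <- ws) count (fun w' => (ky w' == ky w) && (key w' == key w)) ws)%:R.
Proof.
pose F (y : 'I_Ny) := fun x => \sum_(w <- ws | ky w == y) T (key_aff (key w)) phi x.
have LF y : L2 (F y) by apply: L2sumP.
have -> : (fun x => \sum_(w <- ws) T (nn (ky w)) (T (key_aff (key w)) phi) x) =
   (fun x => \sum_(y <- index_enum 'I_Ny) T (nn y) (F y) x).
  apply/funext => x.
  have TF y : T (nn y) (F y) x = \sum_(w <- ws | ky w == y) T (nn y) (T (key_aff (key w)) phi) x.
    by rewrite {1}/T /F big_distrr/= big_distrl.
  under [RHS]eq_bigr do rewrite TF.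
  rewrite (exchange_big_dep xpredT)//=; apply: eq_bigr => w _.
  by rewrite (big_pred1 (ky w))// => y; rewrite eq_sym.
apply: le_trans (N_sum_le _ _) _; first by move=> y; exact: L2_T.
have -> : size (index_enum 'I_Ny) = Ny by rewrite -[LHS]/(size (index_enum _)) /index_enum -enumT size_enum_ord.
rewrite -mulrA ler_wpM2l//.
apply: le_trans (_ : \sum_y coll y * ((l0 + L)%:R / (n ^ 2)%:R * Bess) <= _).
  by apply: ler_sum => y _; rewrite N_T//; exact: N_fiber.
rewrite -big_distrl/= mulrC ler_wpM2l//.
rewrite natr_sum le_eqVlt; apply/orP; left; apply/eqP.
have -> : \sum_y coll y = \sum_(z : 'I_Ny * ('I_L * ('I_(2 * M) * 'I_n)))
   (count (fun w => true && ((ky w, key w) == z)) ws)%:R * (count (fun w => true && ((ky w, key w) == z)) ws)%:R :> R.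
  by rewrite pair_bigA/=; apply: eq_bigr => -[y k] _; rewrite expr2.
by rewrite -(sum_key ws xpredT (fun w => (ky w, key w)) (fun z => (count (fun w => true && ((ky w, key w) == z)) ws)%:R)).
Qed.

End flattening.

(** * Sums over alternating words *)

Section word_sums.
Variables (S : seq (mat int)) (V : nmodType).
Implicit Types (F : mat int -> V).

Lemma sum_words_cat b l1 l2 F : \sum_(P <- words S b (l1 + l2)) F P =
  \sum_(P <- words S b l1) \sum_(P' <- words S (b (+) odd l1) l2) F (mmul P P').
Proof.
elim: l1 b F => [|l1 IH] b F.
  by rewrite add0n /= big_seq1 addbF; apply: eq_bigr => P _; rewrite mmul1m.
rewrite addSn /= !big_allpairs_dep; apply: eq_bigr => e _.
rewrite (IH (~~ b) (fun P => F (mmul e P))); apply: eq_bigr => P _.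
rewrite addNb addbN; apply: eq_bigr => P' _; by rewrite mmulA.
Qed.

Lemma sum_words_rcons b l F : \sum_(P <- words S b l.+1) F P =
  \sum_(P <- words S b l) \sum_(e <- letters S (b (+) odd l)) F (mmul P e).
Proof.
rewrite -addn1 sum_words_cat; apply: eq_bigr => P _.
rewrite -[words S _ 1]/[seq mmul e P | e <- letters S (b (+) odd l), P <- [:: mone]].
by rewrite big_allpairs_dep; apply: eq_bigr => e _; rewrite big_seq1 mmulm1.
Qed.

Lemma sum_letters_adj b F :
  \sum_(e <- letters S b) F (madj e) = \sum_(e <- letters S (~~ b)) F e.
Proof. by case: b; rewrite /= big_map//; apply: eq_bigr => e _; rewrite madjK. Qed.

(** The adjugate reverses a word. The first letter of the result is the adjugate of the last letter
    of the word, which explains the parity [b (+) odd l]. *)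
Lemma sum_words_adj b l F :
  \sum_(P <- words S b l) F (madj P) = \sum_(P <- words S (b (+) odd l) l) F P.
Proof.
elim: l b F => [|l IH] b F.
  by rewrite /= !big_seq1 /madj /mone /ma /mb /mc /md /= oppr0.
rewrite [RHS]sum_words_rcons /= big_allpairs_dep.
under eq_bigr => e _ do under eq_bigr => P _ do rewrite madjM.
under eq_bigr => e _ do rewrite (IH (~~ b) (fun P => F (mmul P (madj e)))).
rewrite (sum_letters_adj b (fun e => \sum_(P <- words S (~~ b (+) odd l) l) F (mmul P e))).
rewrite exchange_big/= addbN -addNb; apply: eq_bigr => P _.
by rewrite -addbA addbb addbF.
Qed.

End word_sums.

(** * Log-convex sequences *)

Section log_convex.
Context (R : realFieldType).

(** The ratios of successive terms increase, so [a 2 / a 0] is at most every [a (l + 2) / a l]; the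
    product over even [l] telescopes. *)
Lemma log_convex_pow (a : nat -> R) (k : nat) : (forall l, 0 <= a l) ->
  (forall l, a l.+1 ^+ 2 <= a l * a l.+2) -> (0 < k)%N ->
  a 2 ^+ k * a 0 <= a (2 * k)%N * a 0 ^+ k.
Proof.
move=> a0 H k0.
have [E|n2] := eqVneq (a 2) 0.
  by rewrite E expr0n (gtn_eqF k0) mul0r mulr_ge0// exprn_ge0.
have pos l : 0 < a l.+1 -> 0 < a l /\ 0 < a l.+2.
  move=> p; have := lt_le_trans (exprn_gt0 2 p) (H l) => q.
  have := a0 l; rewrite le_eqVlt => /orP[/eqP E|p1]; first by move: q; rewrite -E mul0r ltxx.
  by split=> //; rewrite -(pmulr_rgt0 _ p1).
have p2 : 0 < a 2 by rewrite lt_def n2 a0.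
have p1 : 0 < a 1 by case: (pos 1 p2).
have ap l : 0 < a l.
  suff [] : 0 < a l /\ 0 < a l.+1 by [].
  elim: l => [|l [_ IH]]; first by split=> //; case: (pos 0 p1).
  by split=> //; case: (pos l IH).
have rat l : a 1 * a l <= a 0 * a l.+1.
  elim: l => [|l IH]; first by rewrite mulrC.
  rewrite -(ler_pM2r (ap l)) (le_trans _ (_ : a 0 * (a l.+1 ^+ 2) <= _))//.
    by rewrite mulrAC expr2 mulrA ler_wpM2r// ltW.
  by rewrite -mulrA ler_wpM2l// mulrC.
have step2 l : a 2 * a l <= a 0 * a l.+2.
  rewrite -(ler_pM2l (ap 0)).
  have H0 := rat l; have H1 := rat l.+1; have Hc := H 0%N.
  have r2 : a 2 * a l.+1 <= a 1 * a l.+2.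
    elim: l {H0 H1} => [|l IH]; first by rewrite mulrC.
    rewrite -(ler_pM2r (ap l.+1)) (le_trans _ (_ : a 1 * (a l.+2 ^+ 2) <= _))//.
      by rewrite mulrAC expr2 mulrA ler_wpM2r// ltW.
    by rewrite -mulrA [a l.+3 * _]mulrC ler_wpM2l.
  rewrite -(ler_pM2l (ap 1)).
  have e1 : a 1 * (a 0 * (a 2 * a l)) <= a 0 * a 0 * (a 2 * a l.+1).
    have -> : a 1 * (a 0 * (a 2 * a l)) = a 0 * a 2 * (a 1 * a l) by ring.
    have -> : a 0 * a 0 * (a 2 * a l.+1) = a 0 * a 2 * (a 0 * a l.+1) by ring.
    by rewrite ler_wpM2l// mulr_ge0// ltW.
  apply: le_trans e1 _.
  have -> : a 1 * (a 0 * (a 0 * a l.+2)) = a 0 * a 0 * (a 1 * a l.+2) by ring.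
  by rewrite ler_wpM2l// mulr_ge0// ltW.
elim: k k0 => // k IH _; case: k IH => [|k] IH; first by rewrite !expr1 muln1.
have {}IH := IH isT.
rewrite exprS (exprS (a 0)) -mulrA (le_trans (ler_wpM2l (ltW p2) IH))//.
have -> : (2 * k.+2 = (2 * k.+1).+2)%N by lia.
by rewrite !mulrA ler_wpM2r ?exprn_ge0// (mulrC _ (a 0%N)) step2.
Qed.

End log_convex.

(** * The averaging operators and their moments *)

Section averages.
Context (R : realType).
Variables (q : nat) (S : seq (mat int)).
Hypothesis q0 : (0 < q)%N.
Hypothesis Sdet : forall g, g \in S -> mdet g = q%:Z.
Local Notation K := ((size S)%:R : R).

Definition mR (g : mat int) : mat R := ((ma g)%:~R, (mb g)%:~R, (mc g)%:~R, (md g)%:~R).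

Lemma mR_mul g h : mR (mmul g h) = mmul (mR g) (mR h).
Proof. by rewrite /mR /mmul /ma /mb /mc /md /= !rmorphD/= !rmorphM. Qed.
Lemma mR_adj g : mR (madj g) = madj (mR g).
Proof. by rewrite /mR /madj /ma /mb /mc /md /= !rmorphN. Qed.
Lemma mR_det g : mdet (mR g) = (mdet g)%:~R.
Proof. by rewrite /mR /mdet /ma /mb /mc /md /= rmorphB/= !rmorphM. Qed.

Lemma L2_Tany g (f : R -> R) : L2 f -> L2 (T g f).
Proof.
move=> Lf; have [d|d] := ltP 0 (mdet g); first exact: L2_T.
rewrite (_ : T g f = fun=> 0); first exact: L20.
by apply/funext => x; rewrite /T ler0_sqrtr// mul0r mul0r.
Qed.

Lemma eqf_sum (I : eqType) (r : seq I) (F G : I -> R -> R) : (forall i, i \in r -> eqf (F i) (G i)) ->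
  eqf (fun x => \sum_(i <- r) F i x) (fun x => \sum_(i <- r) G i x).
Proof.
elim: r => [|i r IH] H; first by exists [::] => x _; rewrite !big_nil.
have [s1 h1] := H i (mem_head _ _).
have [|s2 h2] := IH; first by move=> j jr; apply: H; rewrite inE jr orbT.
exists (s1 ++ s2) => x; rewrite mem_cat negb_or => /andP[x1 x2].
by rewrite !big_cons h1// h2.
Qed.

Lemma letters_det b e : e \in letters S b -> mdet e = q%:Z.
Proof. by case: b => [/mapP[g /Sdet gd ->]|/Sdet//]; rewrite mdet_adj. Qed.

Lemma words_det b l P : P \in words S b l -> mdet P = q%:Z ^+ l.
Proof.
elim: l b P => [|l IH] b P; first by rewrite inE => /eqP ->; rewrite /mdet /=.
move=> /allpairsP[[e P'] /= [/letters_det de /IH dP ->]].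
by rewrite mdetM de dP exprS.
Qed.

Lemma letters_det_gt0 b e : e \in letters S b -> 0 < mdet (mR e).
Proof. by move=> /letters_det; rewrite mR_det => ->; rewrite ltr0n. Qed.

Lemma words_det_gt0 b l e : e \in words S b l -> 0 < mdet (mR e).
Proof. by move=> /words_det; rewrite mR_det => ->; rewrite rmorphXn/= exprn_gt0// ltr0n. Qed.

Definition avg (b : bool) (f : R -> R) (x : R) := K^-1 * \sum_(e <- letters S b) T (mR e) f x.

Lemma L2_avg b f : L2 f -> L2 (avg b f).
Proof. by move=> Lf; apply: L2Z; apply: L2sum => e; exact: L2_Tany. Qed.

Lemma ip_avg b f h : L2 f -> L2 h -> ip (avg b f) h = ip f (avg (~~ b) h).
Proof.
move=> Lf Lh; have LT c e g : L2 g -> L2 (T (mR e) g) by exact: L2_Tany.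
rewrite /avg ipZl ?ipZr//; [|by apply: L2sum => e; exact: L2_Tany|by apply: L2sum => e; exact: L2_Tany].
rewrite ip_suml//; last by move=> e; exact: L2_Tany.
rewrite ip_sumr//; last by move=> e; exact: L2_Tany.
rewrite -(sum_letters_adj S b (fun e => ip f (T (mR e) h))); congr (_ * _).
by apply: eq_big_seq => e eb; rewrite ip_T_adj ?mR_adj//; exact: letters_det_gt0 eb.
Qed.

(** Alternates [avg true] with its adjoint [avg false], so that [walk 2] is a nonnegative operator.
    Moving one factor across the inner product gives the log-convexity in [walk_moment]. *)
Fixpoint walk (l : nat) (f : R -> R) := if l is l'.+1 then avg (~~ odd l') (walk l' f) else f.

Lemma L2_walk l f : L2 f -> L2 (walk l f).
Proof. by move=> Lf; elim: l => //= l; exact: L2_avg. Qed.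

Lemma walk_moment l f : L2 f -> N (walk l.+1 f) ^+ 2 <= N (walk l f) * N (walk l.+2 f).
Proof.
move=> Lf; have Ll := L2_walk l Lf; have Ll2 := L2_walk l.+2 Lf.
suff -> : N (walk l.+1 f) = ip (walk l f) (walk l.+2 f) by exact: cauchy_schwarz.
by rewrite {1}/N {1}/walk -/walk ip_avg ?negbK//; [rewrite /= negbK|exact: (L2_walk l.+1)].
Qed.

Lemma walk_contract k f : (0 < k)%N -> L2 f ->
  N (walk 2 f) ^+ k * N f <= N (walk (2 * k) f) * N f ^+ k.
Proof.
move=> k0 Lf; apply: (log_convex_pow (a := fun l => N (walk l f))) => // [l|l]; first exact: N_ge0.
exact: walk_moment.
Qed.

(** Each new average acts outermost; as [T] reverses products, this appends its letter on the right
    of the word. *)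
Lemma walk_words l f : measurable_fun setT f ->
  eqf (walk l f) (fun x => K ^- l * \sum_(P <- words S true l) T (mR P) f x).
Proof.
move=> mf; elim: l => [|l IH].
  exists [::] => x _; rewrite /= big_seq1 expr0 invr1 mul1r.
  by rewrite (_ : mR mone = mone) ?T_one// /mR /mone /ma /mb /mc /md.
have E : eqf (fun x => \sum_(e <- letters S (~~ odd l)) T (mR e) (walk l f) x)
   (fun x => \sum_(e <- letters S (~~ odd l)) K ^- l * \sum_(P <- words S true l) T (mR (mmul P e)) f x).
  apply: eqf_sum => e eb; have de := letters_det_gt0 eb.
  apply: eqf_trans (eqf_T de IH) _; rewrite TZ Tsum.
  have [s hs] : eqf (fun x => \sum_(P <- words S true l) T (mR e) (T (mR P) f) x)
     (fun x => \sum_(P <- words S true l) T (mR (mmul P e)) f x).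
    apply: eqf_sum => P Pw; rewrite mR_mul; apply: T_comp => //; exact: words_det_gt0 Pw.
  by exists s => x xs; rewrite hs.
case: E => s hs; exists s => x xs.
rewrite sum_words_rcons addTb /= /avg hs// exchange_big/= -big_distrr/= mulrA; congr (_ * _).
by rewrite exprS invfM mulrC.
Qed.

End averages.

(** * Quotients of unimodular matrices with close coordinates *)

Section cell_geometry.
Context (K : realFieldType).

Lemma normM_le (x y a b : K) : `|x| <= a -> `|y| <= b -> `|x * y| <= a * b.
Proof. by move=> xa yb; rewrite normrM ler_pM. Qed.

Lemma normD_le (x y a b : K) : `|x| <= a -> `|y| <= b -> `|x + y| <= a + b.
Proof. by move=> xa yb; rewrite (le_trans (ler_normD _ _))// lerD. Qed.

Lemma normB_le (x y a b : K) : `|x| <= a -> `|y| <= b -> `|x - y| <= a + b.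
Proof. by move=> xa yb; rewrite (le_trans (ler_normB _ _))// lerD. Qed.

Lemma norm_ratio_near (u t : K) : 0 <= u -> `|u ^+ 2 - 1| <= t -> `|u - 1| <= t.
Proof.
have -> : u ^+ 2 - 1 = (u - 1) * (u + 1) by ring.
move=> u0; rewrite normrM; apply: le_trans.
by rewrite ler_peMr ?normr_ge0// ger0_norm; lra.
Qed.

(* The matrices [(a, b, c, d)] of determinant 1 are parametrized by [d], [b / d] and [c / d]. *)
Lemma unimodular_close (r del d t y d' t' y' : K) : 1 <= r -> 0 <= del ->
  d != 0 -> d' != 0 -> `|d| <= r -> `|d'| <= r ->
  d ^- 2 <= r ^+ 2 -> d' ^- 2 <= r ^+ 2 -> `|t| <= r ^+ 2 -> `|t'| <= r ^+ 2 ->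
  `|d ^- 2 - d' ^- 2| <= del -> `|t - t'| <= del -> `|y - y'| <= del ->
  exists2 s : K, (s = 1 \/ s = -1) &
  [/\ `|d' / d + t * d * d' * (y - y') - s| <= 3 * r ^+ 6 * del,
      `|d * d' * (t * (d' ^- 2 - d ^- 2) + d ^- 2 * (t - t') - t * t' * (y - y'))| <= 3 * r ^+ 6 * del,
      `|d * d' * (y - y')| <= 3 * r ^+ 6 * del &
      `|d / d' - t' * d * d' * (y - y') - s| <= 3 * r ^+ 6 * del].
Proof.
move=> r1 del0 dn dn' dr dr' lr lr' tr tr' hl ht hy.
have r0 : 0 <= r by lra.
have r2 : 1 <= r ^+ 2 by rewrite exprn_ege1.
have r24 : r ^+ 2 <= r ^+ 4 by rewrite ler_weXn2l.
have r46 : r ^+ 4 <= r ^+ 6 by rewrite ler_weXn2l.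
have r14 : 1 <= r ^+ 4 by lra.
have dd : `|d * d'| <= r ^+ 2 by rewrite expr2; exact: normM_le.
have td w : `|w| <= r ^+ 2 -> `|w * d * d' * (y - y')| <= r ^+ 4 * del.
  move=> wr; apply: normM_le => //; rewrite -mulrA (_ : r ^+ 4 = r ^+ 2 * r ^+ 2); last by ring.
  exact: normM_le.
have q1 : (d' / d) ^+ 2 - 1 = d' ^+ 2 * (d ^- 2 - d' ^- 2) by field; rewrite dn dn'.
have q2 : (d / d') ^+ 2 - 1 = - (d ^+ 2 * (d ^- 2 - d' ^- 2)) by field; rewrite dn dn'.
have sq w : `|w| <= r -> `|w ^+ 2| <= r ^+ 2 by move=> wr; rewrite normrX lerXn2r// nnegrE.
have b1 : `|(d' / d) ^+ 2 - 1| <= r ^+ 2 * del by rewrite q1; apply: normM_le => //; exact: sq.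
have b2 : `|(d / d') ^+ 2 - 1| <= r ^+ 2 * del by rewrite q2 normrN; apply: normM_le => //; exact: sq.
have e1 : r ^+ 2 * del <= r ^+ 4 * del by rewrite ler_wpM2r.
have e2 : r ^+ 4 * del <= r ^+ 6 * del by rewrite ler_wpM2r.
have e3 : 0 <= r ^+ 2 * del by rewrite mulr_ge0// exprn_ge0.
have mid : `|d * d' * (t * (d' ^- 2 - d ^- 2) + d ^- 2 * (t - t') - t * t' * (y - y'))| <= 3 * r ^+ 6 * del.
  apply: le_trans (_ : r ^+ 2 * (r ^+ 2 * del + r ^+ 2 * del + r ^+ 2 * r ^+ 2 * del) <= _); last first.
    have -> : r ^+ 2 * (r ^+ 2 * del + r ^+ 2 * del + r ^+ 2 * r ^+ 2 * del) = 2 * (r ^+ 4 * del) + r ^+ 6 * del by ring.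
    by rewrite -!mulrA; lra.
  apply: normM_le => //; apply: normB_le; last by apply: normM_le => //; exact: normM_le.
  apply: normD_le; apply: normM_le => //; first by rewrite distrC.
  by rewrite ger0_norm// invr_ge0 sqr_ge0.
have low : `|d * d' * (y - y')| <= 3 * r ^+ 6 * del.
  by rewrite (le_trans (normM_le dd hy))// -mulrA; lra.
have sum_le : r ^+ 2 * del + r ^+ 4 * del <= 3 * r ^+ 6 * del by rewrite -mulrA; move: e1 e2 e3; clear; lra.
have iv : d / d' = (d' / d)^-1 by rewrite invf_div.
have [d0|d0] := leP 0 (d' / d).
  have s1 := norm_ratio_near d0 b1.
  have s2 : `|d / d' - 1| <= r ^+ 2 * del by apply: norm_ratio_near b2; rewrite iv invr_ge0.
  exists 1; first by left.
  split=> //; [rewrite addrAC|rewrite addrAC];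
    [exact: le_trans (normD_le s1 (td _ tr)) sum_le|exact: le_trans (normB_le s2 (td _ tr')) sum_le].
have neg (u : K) : u <= 0 -> `|u ^+ 2 - 1| <= r ^+ 2 * del -> `|u - -1| <= r ^+ 2 * del.
  move=> u0 h; rewrite -normrN (_ : - (u - -1) = - u - 1); last by ring.
  by apply: norm_ratio_near; rewrite ?sqrrN// oppr_ge0.
have s1 := neg _ (ltW d0) b1.
have s2 : `|d / d' - -1| <= r ^+ 2 * del by apply: neg b2; rewrite iv invr_le0 ltW.
exists (-1); first by right.
split=> //; [rewrite addrAC|rewrite addrAC];
    [exact: le_trans (normD_le s1 (td _ tr)) sum_le|exact: le_trans (normB_le s2 (td _ tr')) sum_le].
Qed.

End cell_geometry.

(** * Words of determinant [Q^2] in one cell *)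

Section cells.
Context (R : realType).

Lemma abs_intr (z : int) (m : nat) : `|z| <= m%:Z -> `|z%:~R| <= m%:R :> R.
Proof. by rewrite -(ler_int R) intr_norm. Qed.

Definition bounded (Q r : nat) (P : mat int) := [/\ mdet P = Q%:Z ^+ 2,
  `|ma P| + `|mb P| <= (r * Q)%N%:Z & `|mc P| + `|md P| <= (r * Q)%N%:Z].

(** With [tau] and [slope], the coordinates of [P] up to scalars: [P] divided by its last entry is
    the affine matrix with rows [(lam, tau)] and [(0, 1)] times the lower unipotent matrix with
    entry [slope]. *)
Definition lam (P : mat int) : R := (mdet P)%:~R / (md P)%:~R ^+ 2.
Definition tau (P : mat int) : R := (mb P)%:~R / (md P)%:~R.
Definition slope (P : mat int) : R := (mc P)%:~R / (md P)%:~R.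

(** If [|c| <= |d|], the determinant gives [Q^2 <= (|a| + |b|) |d| <= r Q |d|], so [d] is comparable
    to [Q] and all coordinates are bounded in terms of [r]. *)
Lemma coords_bounds Q r P : (0 < Q)%N -> bounded Q r P -> `|mc P| <= `|md P| ->
  [/\ (md P)%:~R != 0 :> R, (1 <= r)%N, (Q%:R / `|(md P)%:~R|) <= r%:R :> R,
      r%:R ^- 2 <= lam P <= r%:R ^+ 2 & `|tau P| <= r%:R ^+ 2 /\ `|slope P| <= 1].
Proof.
move=> Q0 [dP abP cdP] cd.
have Qr : 0 < Q%:R :> R by rewrite ltr0n.
have key : Q%:Z ^+ 2 <= r%:Z * Q%:Z * `|md P|.
  have D : Q%:Z ^+ 2 = ma P * md P - mb P * mc P by rewrite -dP.
  have h1 : ma P * md P <= `|ma P| * `|md P| by rewrite -normrM ler_norm.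
  have h2 : - (mb P * mc P) <= `|mb P| * `|md P|.
    by rewrite (le_trans (ler_norm _))// normrN normrM ler_wpM2l.
  have h3 : (`|ma P| + `|mb P|) * `|md P| <= (r * Q)%N%:Z * `|md P| by rewrite ler_wpM2r.
  by rewrite PoszM in h3; lia.
have key' : Q%:Z <= r%:Z * `|md P|.
  by rewrite -(ler_pM2l (_ : 0 < Q%:Z))// -expr2 (le_trans key)// mulrCA mulrA.
have d0 : md P != 0 by apply/eqP => d0; move: key'; rewrite d0 normr0 mulr0; lia.
have d0' : (md P)%:~R != 0 :> R by rewrite intr_eq0.
have nd : 0 < `|(md P)%:~R| :> R by rewrite normr_gt0.
have r1 : (1 <= r)%N by case: r {abP cdP key} key' => //; rewrite mul0r; lia.
have keyR : Q%:R <= r%:R * `|(md P)%:~R| :> R.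
  by move: key'; rewrite -(ler_int R) rmorphM/= intr_norm.
have dQ : `|(md P)%:~R| <= r%:R * Q%:R :> R.
  have : `|md P| <= (r * Q)%N%:Z by rewrite (le_trans _ cdP)// lerDr.
  by move/abs_intr; rewrite natrM.
have lE : lam P = (Q%:R / `|(md P)%:~R|) ^+ 2.
  by rewrite /lam dP rmorphXn/= expr_div_n real_normK ?num_real.
have Qd : Q%:R / `|(md P)%:~R| <= r%:R :> R by rewrite ler_pdivrMr.
have rp : 0 < r%:R :> R by rewrite ltr0n.
have Qd' : r%:R^-1 <= Q%:R / `|(md P)%:~R| :> R.
  by rewrite ler_pdivlMr// mulrC ler_pdivrMr// mulrC.
split=> //.
  by rewrite lE -exprVn; apply/andP; split; rewrite lerXn2r ?nnegrE// ?divr_ge0 ?invr_ge0.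
split.
  rewrite /tau normrM normfV ler_pdivrMr//.
  have : `|mb P| <= (r * Q)%N%:Z by rewrite (le_trans _ abP)// lerDr.
  move/abs_intr; rewrite natrM => /le_trans; apply.
  by rewrite expr2 -mulrA ler_wpM2l.
by rewrite /slope normrM normfV ler_pdivrMr// mul1r -!intr_norm ler_int.
Qed.

(** Divided by [Q], both matrices have determinant 1 and [unimodular_close] applies. Its sign [s]
    becomes the sign in [near_pm], and integrality rounds the real bound down to [Y]. *)
Lemma same_cell_near Q r (del : R) (Y : nat) P P' : (0 < Q)%N -> 0 <= del ->
  bounded Q r P -> bounded Q r P' -> `|mc P| <= `|md P| -> `|mc P'| <= `|md P'| ->
  `|lam P - lam P'| <= del -> `|tau P - tau P'| <= del -> `|slope P - slope P'| <= del ->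
  3 * r%:R ^+ 6 * del * Q%:R ^+ 2 < Y.+1%:R ->
  near_pm (Q ^ 2) Y (mmul P (madj P')).
Proof.
move=> Q0 del0 bP bP' cd cd' hl ht hs hY.
have [n0 r1 Qd l1 [t1 y1]] := coords_bounds Q0 bP cd.
have [n0' _ Qd' l1' [t1' y1']] := coords_bounds Q0 bP' cd'.
have Qr : 0 < Q%:R :> R by rewrite ltr0n.
have Qn : Q%:R != 0 :> R by rewrite gt_eqF.
have [dP abP cdP] := bP; have [dP' abP' cdP'] := bP'.
have scal (Z : mat int) : bounded Q r Z -> `|(md Z)%:~R / Q%:R : R| <= r%:R.
  move=> [_ _ h]; rewrite normrM normfV [`|Q%:R|]ger0_norm// ler_pdivrMr//.
  have : `|md Z| <= (r * Q)%N%:Z by rewrite (le_trans _ h)// lerDr.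
  by move/abs_intr; rewrite natrM.
have lamE (Z : mat int) : bounded Q r Z -> ((md Z)%:~R / Q%:R) ^- 2 = lam Z.
  by move=> [h _ _]; rewrite /lam h rmorphXn/= -exprVn invf_div expr_div_n.
have aE (Z : mat int) : bounded Q r Z -> (md Z)%:~R != 0 :> R ->
    (ma Z)%:~R = (Q%:R ^+ 2 + (mb Z)%:~R * (mc Z)%:~R) / (md Z)%:~R :> R.
  move=> [h _ _] z0; have : (mdet Z)%:~R = Q%:R ^+ 2 :> R by rewrite h rmorphXn.
  rewrite /mdet rmorphB/= !rmorphM/= => <-; field; exact: z0.
have D0 : (md P)%:~R / Q%:R != 0 :> R by rewrite mulf_neq0 ?invr_eq0.
have D0' : (md P')%:~R / Q%:R != 0 :> R by rewrite mulf_neq0 ?invr_eq0.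
have [||||s s1 [e1 e2 e3 e4]] := @unimodular_close R r%:R del ((md P)%:~R / Q%:R) (tau P) (slope P)
    ((md P')%:~R / Q%:R) (tau P') (slope P') _ del0 D0 D0' (scal P bP) (scal P' bP') _ _ t1 t1' _ ht hs.
- by rewrite (ler_nat _ 1).
- by rewrite lamE//; case/andP: l1.
- by rewrite lamE//; case/andP: l1'.
- by rewrite !lamE.
set M := mmul P (madj P'); set eps := 3 * r%:R ^+ 6 * del in e1 e2 e3 e4 hY.
have a1 := aE P bP n0; have a2 := aE P' bP' n0'.
have m1 : `|(ma M)%:~R - s * Q%:R ^+ 2| <= eps * Q%:R ^+ 2 :> R.
  rewrite -ler_pdivrMr ?exprn_gt0// -[X in _ / X]ger0_norm ?sqr_ge0// -normf_div.
  apply: le_trans e1; rewrite le_eqVlt; apply/orP; left; apply/eqP; congr `|_|.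
  rewrite /M /mmul /madj /ma /mb /mc /md /= -/(ma P) -/(mb P) -/(mc P) -/(md P) -/(mc P') -/(md P').
  rewrite rmorphD/= !rmorphM/= rmorphN/= a1 /tau /slope; field.
  by rewrite n0 n0' Qn.
have m2 : `|(mb M)%:~R| <= eps * Q%:R ^+ 2 :> R.
  rewrite -ler_pdivrMr ?exprn_gt0// -[X in _ / X]ger0_norm ?sqr_ge0// -normf_div.
  apply: le_trans e2; rewrite le_eqVlt; apply/orP; left; apply/eqP; congr `|_|.
  rewrite /M /mmul /madj /ma /mb /mc /md /= -/(ma P) -/(mb P) -/(ma P') -/(mb P') -/(md P').
  rewrite rmorphD/= !rmorphM/= rmorphN/= a1 a2 /tau /slope; field.
  by rewrite n0 n0' Qn.
have m3 : `|(mc M)%:~R| <= eps * Q%:R ^+ 2 :> R.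
  rewrite -ler_pdivrMr ?exprn_gt0// -[X in _ / X]ger0_norm ?sqr_ge0// -normf_div.
  apply: le_trans e3; rewrite le_eqVlt; apply/orP; left; apply/eqP; congr `|_|.
  rewrite /M /mmul /madj /ma /mb /mc /md /= -/(mc P) -/(md P) -/(mc P') -/(md P').
  rewrite rmorphD/= !rmorphM/= rmorphN/= /slope; field.
  by rewrite n0 n0' Qn.
have m4 : `|(md M)%:~R - s * Q%:R ^+ 2| <= eps * Q%:R ^+ 2 :> R.
  rewrite -ler_pdivrMr ?exprn_gt0// -[X in _ / X]ger0_norm ?sqr_ge0// -normf_div.
  apply: le_trans e4; rewrite le_eqVlt; apply/orP; left; apply/eqP; congr `|_|.
  rewrite /M /mmul /madj /ma /mb /mc /md /= -/(mc P) -/(md P) -/(ma P') -/(mb P').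
  rewrite rmorphD/= !rmorphM/= rmorphN/= a2 /tau /slope; field.
  by rewrite n0 n0' Qn.
move: (eps * Q%:R ^+ 2) hY m1 m2 m3 m4 => W hY m1 m2 m3 m4.
have toint (z : int) : `|z%:~R| <= W :> R -> `|z| <= Y%:Z.
  by move=> /le_lt_trans/(_ hY); rewrite -intr_norm -[Y.+1%:R]/(Y.+1%:Z%:~R) ltr_int; clear; lia.
have dM : mdet M = (Q ^ 2)%N%:Z ^+ 2.
  by rewrite mdetM mdet_adj dP dP' -!natz natrX; ring.
have Q2E : Q%:R ^+ 2 = ((Q ^ 2)%N%:Z)%:~R :> R by rewrite -natrX.
case: s1 => sE; rewrite sE ?mul1r ?mulN1r ?opprK Q2E -?rmorphB -?rmorphD in m1 m4; apply/orP; [left|right].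
  by apply/and5P; split; [exact/eqP|exact: toint|exact: toint|exact: toint|exact: toint].
apply/and5P; split.
- by rewrite mdetZ dM; apply/eqP; ring.
- by rewrite /mscale /ma/= -/(ma M) mulN1r -opprD normrN; exact: toint.
- by rewrite /mscale /mb/= -/(mb M) mulN1r normrN; exact: toint.
- by rewrite /mscale /mc/= -/(mc M) mulN1r normrN; exact: toint.
- by rewrite /mscale /md/= -/(md M) mulN1r -opprD normrN; exact: toint.
Qed.

End cells.

(** * Replacing a word by a grid point of its cell *)

Section representative.
Context (R : realType).
Variables (n : nat) (c : nat -> R).
Hypothesis n0 : (0 < n)%N.
Let phi := step n c.
Let Lphi : L2 phi. Proof. exact: L2_step. Qed.

Definition nn (y : R) : mat R := (1, 0, y, 1).
Definition chart (l t y : R) : mat R := (l + t * y, t, y, 1).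

Lemma T_Zscale (t : R) g f : t != 0 -> T (mscale t g) f = T g f.
Proof.
move=> t0; have [tp|tn] := ltP 0 t; first exact: T_scale.
rewrite (_ : mscale t g = mscale (-1) (mscale (- t) g)); last by rewrite mscaleA mulN1r opprK.
by rewrite T_opp T_scale// oppr_gt0 lt_def eq_sym t0.
Qed.

Lemma T_chart (P : mat int) f : (md P)%:~R != 0 :> R ->
  T (mR R P) f = T (chart (lam R P) (tau R P) (slope R P)) f.
Proof.
move=> d0; rewrite -(@T_Zscale (md P)%:~R (chart _ _ _))//; congr (T _ f).
move: P d0 => [[[a b] e] d]; rewrite {1}/md /= => d0.
by apply: matP; rewrite /mR /mscale /chart /lam /tau /slope /mdet /ma /mb /mc /md /= ?rmorphB/= ?rmorphM/=; field.
Qed.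

Lemma chart_near (r del l t y l' t' y' : R) : 1 <= r -> 0 <= del -> 2 * r ^+ 2 * del <= 1 ->
  r ^- 2 <= l -> l <= r ^+ 2 -> `|t| <= r ^+ 2 ->
  `|l - l'| <= del -> `|t - t'| <= del -> `|y - y'| <= del ->
  0 < l' /\ near1 (16 * r ^+ 6 * del) (mscale l'^-1 (mmul (chart l t y) (madj (chart l' t' y')))).
Proof.
move=> r1 del0 rdel l1 l2 t1 hl ht hy.
have r0 : 0 < r by lra.
have rn : r != 0 by rewrite gt_eqF.
have r2 : 1 <= r ^+ 2 by rewrite exprn_ege1.
have r24 : r ^+ 2 <= r ^+ 4 by rewrite ler_weXn2l.
have r46 : r ^+ 4 <= r ^+ 6 by rewrite ler_weXn2l.
have dl : del <= r ^- 2 / 2.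
  rewrite -[r ^- 2]mul1r ler_pdivlMr// ler_pdivlMr ?exprn_gt0//; lra.
have lp : r ^- 2 / 2 <= l'.
  by move: hl; rewrite ler_norml => /andP[h1 h2]; lra.
have ri : 0 < r ^- 2 by rewrite invr_gt0 exprn_gt0.
have l'0 : 0 < l' by lra.
have ln : l' != 0 by rewrite gt_eqF.
have il : `|l'^-1| <= 2 * r ^+ 2.
  rewrite normfV ger0_norm ?(ltW l'0)// -[2 * _]invrK lef_pV2 ?posrE ?invr_gt0 ?mulr_gt0 ?exprn_gt0//.
  by rewrite invfM mulrC.
have d1 : del <= r ^+ 2 by apply: le_trans (_ : del <= 1) _ => //; nra.
have t2 : `|t'| <= 2 * r ^+ 2.
  rewrite (_ : t' = t - (t - t')); last by ring.
  by rewrite (le_trans (normB_le t1 ht))//; lra.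
have e1 : r ^+ 2 * del <= r ^+ 4 * del by rewrite ler_wpM2r.
have e2 : r ^+ 4 * del <= r ^+ 6 * del by rewrite ler_wpM2r.
have e3 : 0 <= r ^+ 2 * del by rewrite mulr_ge0// exprn_ge0// ltW.
have hl' : `|l' - l| <= del by rewrite distrC.
have la : `|l| <= r ^+ 2 by rewrite ger0_norm//; lra.
split=> //; rewrite /near1 /mscale /chart /mmul /madj /ma /mb /mc /md /=; split.
- rewrite (_ : _ - 1 = l'^-1 * ((l - l') + t * (y - y'))); last by field.
  apply: le_trans (normM_le il (normD_le hl (normM_le t1 hy))) _.
  rewrite [leLHS](_ : _ = 2 * (r ^+ 2 * del) + 2 * (r ^+ 4 * del)); last by ring.
  by rewrite -!mulrA; lra.
- rewrite (_ : l'^-1 * _ = l'^-1 * ((t * (l' - l) + l * (t - t')) - t * t' * (y - y'))); last by ring.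
  apply: le_trans (normM_le il (normB_le (normD_le (normM_le t1 hl') (normM_le la ht)) (normM_le (normM_le t1 t2) hy))) _.
  rewrite [leLHS](_ : _ = 4 * (r ^+ 4 * del) + 4 * (r ^+ 6 * del)); last by ring.
  by rewrite -!mulrA; lra.
- rewrite (_ : l'^-1 * _ = l'^-1 * (y - y')); last by ring.
  apply: le_trans (normM_le il hy) _; rewrite -!mulrA; lra.
- rewrite (_ : _ - 1 = l'^-1 * (- (t' * (y - y')))); last by field.
  apply: le_trans (normM_le il (_ : _ <= 2 * r ^+ 2 * del)) _; first by rewrite normrN; exact: normM_le.
  rewrite [leLHS](_ : _ = 4 * (r ^+ 4 * del)); last by ring.
  by rewrite -!mulrA; lra.
Qed.

(** In the chart the word is [H M'] with [M'] the grid point and [H] close to 1. As [T] reverses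
    products, [H] acts on [phi] itself, where [near1_step] applies, and the unitary [T M'] preserves
    the norm of the error. *)
Lemma rep_close (Q r : nat) (del : R) (P : mat int) (l : nat) (z : int) (y' : R) :
  (0 < Q)%N -> bounded Q r P -> `|mc P| <= `|md P| ->
  0 < del -> 16 * r%:R ^+ 6 * del <= 1 / 100 ->
  `|lam R P - l%:R / (n ^ 2)%:R| <= del -> `|tau R P - z%:~R / (n ^ 2)%:R| <= del ->
  `|slope R P - y'| <= del ->
  N (fun x => T (mR R P) phi x - T (nn y') (T (aff R n l z) phi) x) <=
    1000 * (16 * r%:R ^+ 6 * del) * n%:R * N phi.
Proof.
move=> Q0 bP cd del0 rdel hl ht hy.
have [d0 r1 _ /andP[l1 l2] [t1 _]] := coords_bounds R Q0 bP cd.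
have r1' : 1 <= r%:R :> R by rewrite (ler_nat _ 1).
have r26 : r%:R ^+ 2 <= r%:R ^+ 6 :> R by rewrite ler_weXn2l.
have r2del : 2 * r%:R ^+ 2 * del <= 1.
  have h : r%:R ^+ 2 * del <= r%:R ^+ 6 * del by rewrite ler_wpM2r// ltW.
  by rewrite -!mulrA in rdel *; lra.
set l' := l%:R / _ in hl; set t' := z%:~R / _ in ht.
have [l'0 nH] := chart_near r1' (ltW del0) r2del l1 l2 t1 hl ht hy.
set M := chart (lam R P) (tau R P) (slope R P) in nH; set M' := chart l' t' y' in nH.
set H := mscale _ _ in nH.
have lam0 : 0 < lam R P.
  by apply: lt_le_trans l1; rewrite invr_gt0 exprn_gt0// (lt_le_trans ltr01).
have dM : mdet M = lam R P by rewrite /mdet /M /chart /ma /mb /mc /md /=; ring.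
have dM' : mdet M' = l' by rewrite /mdet /M' /chart /ma /mb /mc /md /=; ring.
have dM'0 : 0 < mdet M' by rewrite dM'.
have dH : 0 < mdet H.
  rewrite /H mdetZ mdetM mdet_adj dM dM'; apply: mulr_gt0; last exact: mulr_gt0.
  by apply: exprn_gt0; rewrite invr_gt0.
have HM : mmul H M' = M.
  rewrite /H mmulZl -mmulA mmul_adjl dM' mmulZr mmulm1 mscaleA mulVf ?gt_eqF//.
  exact: mscale1.
have E1 : eqf (T (mR R P) phi) (T M' (T H phi)).
  by rewrite T_chart//; apply: eqf_sym; rewrite -/M -HM; exact: T_comp.
have daff : 0 < mdet (aff R n l z).
  by rewrite /mdet /aff /ma /mb /mc /md /= mulr1 mulr0 subr0.
have dnn : 0 < mdet (nn y') by rewrite /mdet /nn /ma /mb /mc /md /= mul1r mul0r subr0.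
have E2 : eqf (T (nn y') (T (aff R n l z) phi)) (T M' phi).
  rewrite (_ : M' = mmul (aff R n l z) (nn y')); first exact: T_comp.
  by rewrite /aff -/l' -/t'; apply: matP; rewrite /M' /chart /mmul /nn /ma /mb /mc /md /=; ring.
have dP : 0 < mdet (mR R P).
  by rewrite mR_det; case: bP => -> _ _; rewrite rmorphXn/= exprn_gt0// ltr0n.
have E3 : eqf (fun x => T (mR R P) phi x - T (nn y') (T (aff R n l z) phi) x)
   (T M' (fun x => T H phi x - phi x)).
  rewrite TB; case: E1 => s1 h1; case: E2 => s2 h2; exists (s1 ++ s2) => x.
  by rewrite mem_cat negb_or => /andP[x1 x2]; rewrite h1// h2.
have LH : L2 (fun x => T H phi x - phi x) by apply: L2B => //; exact: L2_T.
rewrite (N_eqf _ _ E3); [|by apply: L2B; do 2?apply: L2_T|exact: L2_T].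
rewrite N_T//; apply: near1_step => //; rewrite mulr_gt0// mulr_gt0// exprn_gt0//.
by rewrite (lt_le_trans ltr01).
Qed.

End representative.

Ltac nonneg := match goal with
  | |- is_true (0 <= _ + _) => apply: addr_ge0; nonneg
  | |- is_true (0 <= _ * _) => apply: mulr_ge0; nonneg
  | |- is_true (0 <= _^-1) => rewrite invr_ge0; nonneg
  | |- is_true (0 <= _ ^+ _) => apply: exprn_ge0; nonneg
  | |- is_true (0 <= Num.sqrt _) => exact: sqrtr_ge0
  | |- is_true (0 <= _%:R) => exact: ler0n
  | |- is_true (0 <= 1) => exact: ler01
  | |- _ => assumption || exact: ltW
  end.

(** * The norm of a sum over words with [|c| <= |d|] *)

Section class_bound.
Context (R : realType).

Lemma N_add2 (f g : R -> R) : L2 f -> L2 g -> N (fun x => f x + g x) <= 2 * N f + 2 * N g.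
Proof. by move=> Lf Lg; rewrite N_add//; have := ip_le_mean Lf Lg; lra. Qed.

Lemma count_sub_in (I : eqType) (s : seq I) (a b : pred I) :
  (forall x, x \in s -> a x -> b x) -> (count a s <= count b s)%N.
Proof.
elim: s => //= x s IH H; rewrite leq_add//.
  by case: (boolP (a x)) => // /(H x (mem_head _ _)) ->.
by apply: IH => y ys; apply: H; rewrite inE ys orbT.
Qed.

(** Here [v^16 = n], [sg = v^-8], [L = v^32 r^2] and [X = 6 r^4]. With this [sg] the band
    contributes [L n E sqrt(sg)], of order [v^44 E], and the far part is no larger. With
    [2 v^32 + 1] unipotent parts and [E <= v^16 P] the total is [v^92 P], against the trivial
    [v^96 P] without the gain from [sg]. *)
Lemma flatten_constants (v r E P : R) : 1 <= v -> 1 <= r -> 0 <= E -> E <= v ^+ 16 * P ->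
  (2 * v ^+ 32 + 1) * ((1 + v ^+ 32 * r ^+ 2) / v ^+ 32 *
    ((4 * (v ^+ 32 * r ^+ 2) * v ^+ 16 * E * Num.sqrt (2 * v ^- 8) +
      4 * E * (v ^+ 16 * (v ^+ 16 / v ^- 8 + 1) + v ^+ 32 * r ^+ 2 * (2 * (6 * r ^+ 4) + 2)) *
        Num.sqrt (2 * (6 * r ^+ 4))) * Num.sqrt (2 * (6 * r ^+ 4))))
  <= 60 * 1000 * r ^+ 16 * v ^+ 92 * P.
Proof.
move=> v1 r1 E0 EP.
have vp : 0 < v by lra.
have rp : 0 < r by lra.
have vX k : 1 <= v ^+ k by rewrite exprn_ege1.
have rX k : 1 <= r ^+ k by rewrite exprn_ege1.
have s1 : Num.sqrt (2 * v ^- 8) <= 2 * v ^- 4.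
  rewrite -(ler_pXn2r (n := 2)) ?nnegrE ?sqrtr_ge0//; last by rewrite mulr_ge0// invr_ge0 exprn_ge0// ltW.
  rewrite sqr_sqrtr; last by rewrite mulr_ge0// invr_ge0 exprn_ge0// ltW.
  have -> : (2 * v ^- 4) ^+ 2 = 4 * v ^- 8 by field; rewrite gt_eqF.
  have : 0 < v ^- 8 by rewrite invr_gt0 exprn_gt0.
  lra.
have s2 : Num.sqrt (2 * (6 * r ^+ 4)) <= 12 * r ^+ 4.
  rewrite -(ler_pXn2r (n := 2)) ?nnegrE ?sqrtr_ge0//; last by rewrite mulr_ge0// exprn_ge0// ltW.
  rewrite sqr_sqrtr; last by have := rX 4; lra.
  have := rX 4; move: (r ^+ 4) => w w1; nra.
have s10 := sqrtr_ge0 (2 * v ^- 8); have s20 := sqrtr_ge0 (2 * (6 * r ^+ 4)).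
set a := Num.sqrt (2 * v ^- 8) in s1 s10 *; set b := Num.sqrt (2 * _) in s2 s20 *.
have b1 : 4 * (v ^+ 32 * r ^+ 2) * v ^+ 16 * E * a <= 8 * (r ^+ 10 * E * v ^+ 44).
  apply: le_trans (_ : 4 * (v ^+ 32 * r ^+ 2) * v ^+ 16 * E * (2 * v ^- 4) <= _).
    by apply: ler_wpM2l s1; nonneg.
  rewrite (_ : _ * (2 * v ^- 4) = 8 * (r ^+ 2 * (E * v ^+ 44))); last by field; rewrite gt_eqF.
  rewrite ler_pM2l// -mulrA ler_wpM2r ?mulr_ge0// ?exprn_ge0 ?(ltW vp)//.
  by rewrite ler_weXn2l.
have b2 : 4 * E * (v ^+ 16 * (v ^+ 16 / v ^- 8 + 1) + v ^+ 32 * r ^+ 2 * (2 * (6 * r ^+ 4) + 2)) * b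
    <= 768 * (r ^+ 10 * E * v ^+ 44).
  have h1 : v ^+ 16 * (v ^+ 16 / v ^- 8 + 1) + v ^+ 32 * r ^+ 2 * (2 * (6 * r ^+ 4) + 2)
     <= 16 * (r ^+ 6 * v ^+ 44).
    have -> : v ^+ 16 * (v ^+ 16 / v ^- 8 + 1) = v ^+ 40 + v ^+ 16 by field; rewrite gt_eqF.
    have c1 k : (k <= 44)%N -> v ^+ k <= r ^+ 6 * v ^+ 44.
      move=> k44; apply: le_trans (_ : v ^+ 44 <= _); first by rewrite ler_weXn2l.
      by rewrite ler_peMl// ltW// exprn_gt0.
    have c2 k : (k <= 6)%N -> v ^+ 32 * r ^+ k <= r ^+ 6 * v ^+ 44.
      by move=> k6; rewrite mulrC ler_pM ?exprn_ge0 ?(ltW vp) ?(ltW rp)// ler_weXn2l.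
    have -> : v ^+ 32 * r ^+ 2 * (2 * (6 * r ^+ 4) + 2) = 12 * (v ^+ 32 * r ^+ 6) + 2 * (v ^+ 32 * r ^+ 2) by ring.
    by have := c1 40 isT; have := c1 16 isT; have := c2 6 isT; have := c2 2 isT; lra.
  apply: le_trans (_ : 4 * E * (16 * (r ^+ 6 * v ^+ 44)) * (12 * r ^+ 4) <= _).
    apply: ler_pM => //; last by rewrite ler_wpM2l// mulr_ge0.
    nonneg.
  by rewrite le_eqVlt; apply/orP; left; apply/eqP; ring.
have b3 : (1 + v ^+ 32 * r ^+ 2) / v ^+ 32 <= 2 * r ^+ 2.
  rewrite ler_pdivrMr ?exprn_gt0//.
  have : 1 <= v ^+ 32 * r ^+ 2 by rewrite mulr_ege1.
  rewrite (_ : 2 * r ^+ 2 * v ^+ 32 = 2 * (v ^+ 32 * r ^+ 2)); last by ring.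
  lra.
have b4 : 2 * v ^+ 32 + 1 <= 3 * v ^+ 32 by have := vX 32; lra.
have B0 : 0 <= 4 * (v ^+ 32 * r ^+ 2) * v ^+ 16 * E * a +
      4 * E * (v ^+ 16 * (v ^+ 16 / v ^- 8 + 1) + v ^+ 32 * r ^+ 2 * (2 * (6 * r ^+ 4) + 2)) * b.
  by nonneg.
have F1 := ler_pM B0 s20 (lerD b1 b2) s2.
have p0 : 0 <= (1 + v ^+ 32 * r ^+ 2) / v ^+ 32.
  by nonneg.
have F2 := ler_pM p0 (mulr_ge0 B0 s20) b3 F1.
have F3 := ler_pM (_ : 0 <= 2 * v ^+ 32 + 1) (mulr_ge0 p0 (mulr_ge0 B0 s20)) b4 F2.
apply: le_trans (F3 _) _; first by rewrite addr_ge0// mulr_ge0// exprn_ge0// ltW.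
rewrite [leLHS](_ : _ = (55 * 1000 + 872) * (r ^+ 16 * v ^+ 76 * E)); last by ring.
rewrite (_ : 60 * 1000 * r ^+ 16 * v ^+ 92 * P = 60 * 1000 * (r ^+ 16 * v ^+ 76 * (v ^+ 16 * P))); last by ring.
have h1 : r ^+ 16 * v ^+ 76 * E <= r ^+ 16 * v ^+ 76 * (v ^+ 16 * P).
  by apply: ler_wpM2l EP; nonneg.
have h2 : 0 <= r ^+ 16 * v ^+ 76 * E by nonneg.
move: h1 h2; clear; lra.
Qed.

Variables (n r Q Y : nat) (v : R) (c e : int -> R) (ws : seq (mat int)).
Hypothesis n0 : (0 < n)%N.
Hypothesis r0 : (0 < r)%N.
Hypothesis Q0 : (0 < Q)%N.
Hypothesis rn : (1600 * r ^ 6 <= n ^ 2)%N.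
Hypothesis v1 : 1 <= v.
Hypothesis vn : v ^+ 16 = n%:R.
Hypothesis e0 : forall z, e z != 0 -> 0 <= z < n%:Z - 1.
Hypothesis ce : forall z, c z = e z - e (z - 1).
Let phi := step n (fun i => c i%:Z).
Hypothesis eN : energy n e <= n%:R * N phi.
Hypothesis wsB : forall P, P \in ws -> bounded Q r P /\ `|mc P| <= `|md P|.
Hypothesis QY : 3 * r%:R ^+ 6 * (n ^ 2)%:R^-1 * Q%:R ^+ 2 < Y.+1%:R :> R.

Let n2 := (n ^ 2)%N.
Let n2gt0 : (0 < n2)%N. Proof. by rewrite expn_gt0 n0. Qed.
Let n2p : 0 < n2%:R :> R. Proof. by rewrite ltr0n. Qed.
Let L := (n2 * r ^ 2)%N.
Let Lgt0 : (0 < L)%N. Proof. by rewrite muln_gt0 n2gt0 expn_gt0 r0. Qed.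
Let M := (16 * n2 * r ^ 6)%N.
Let M0 : (0 < 2 * M)%N. Proof.
have h : (0 < r ^ 6)%N by rewrite expn_gt0 r0.
by move: n2gt0 h; rewrite /M; move: n2 (r ^ 6)%N; clear => a b; nia.
Qed.
Let Ny := (2 * n2).+1.
Let X : R := 6 * r%:R ^+ 4.
Let del : R := n2%:R^-1.
Let r1R : 1 <= r%:R :> R. Proof. by rewrite (ler_nat _ 1). Qed.
Let Lphi : L2 phi. Proof. exact: L2_step. Qed.

Let kl (P : mat int) : nat := Num.truncn (n2%:R * lam R P).
Let kz (P : mat int) : int := Num.floor (n2%:R * tau R P).
Let kyn (P : mat int) : nat := Num.truncn (n2%:R * (slope R P + 1)).
(** The slope [kl P] is positive and is stored minus one, which matches [l0 = 1]; the shift [kz P]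
    is divided by [n] with remainder to give the indices [t] and [s] of an [atom]. The default
    ordinals never occur for words of [ws], by [data]. *)
Let key (P : mat int) : 'I_L * ('I_(2 * M) * 'I_n) :=
  (insubd (Ordinal Lgt0) (kl P).-1,
   (insubd (Ordinal M0) (absz ((kz P %/ n%:Z)%Z + M%:Z)), insubd (Ordinal n0) (absz (kz P %% n%:Z)%Z))).
Let ky (P : mat int) : 'I_Ny := inord (kyn P).
Let nny (y : 'I_Ny) : mat R := nn ((y : nat)%:R / n2%:R - 1).

Let floorP (x : R) : (Num.floor x)%:~R <= x /\ x < (Num.floor x)%:~R + 1.
Proof. by have /andP[h1 h2] := floor_bounds x; split. Qed.

Let truncP (x : R) : 0 <= x -> (Num.truncn x)%:R <= x /\ x < (Num.truncn x)%:R + 1.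
Proof. by move=> x0; have /andP[h1 h2] := truncn_itv x0; rewrite natr1. Qed.

Let near_frac (x m : R) : m <= n2%:R * x -> n2%:R * x < m + 1 -> 0 <= x - m / n2%:R /\ x - m / n2%:R < del.
Proof.
move=> h1 h2; have -> : x - m / n2%:R = (n2%:R * x - m) / n2%:R by field; rewrite gt_eqF.
by split; [rewrite divr_ge0// subr_ge0|rewrite -[del]mul1r ltr_pM2r ?invr_gt0//; lra].
Qed.

Let data P : P \in ws ->
  [/\ (0 < kl P)%N /\ ((kl P).-1 < L)%N,
      n2%:R <= 2 * r%:R ^+ 2 * (kl P)%:R :> R,
      - (n2%:R * r%:R ^+ 2) - 1 <= (kz P)%:~R :> R /\ (kz P)%:~R <= n2%:R * r%:R ^+ 2 :> R,
      (absz ((kz P %/ n%:Z)%Z + M%:Z)%R < 2 * M)%N /\ 0 <= (kz P %/ n%:Z)%Z + M%:Z &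
      (kyn P < Ny)%N].
Proof.
move=> /wsB[bP cd]; have [d0 _ _ /andP[l1 l2] [t1 s1]] := coords_bounds R Q0 bP cd.
have rp : 0 < r%:R :> R by rewrite ltr0n.
have lam0 : 0 < lam R P by apply: lt_le_trans l1; rewrite invr_gt0 exprn_gt0.
have [k1 k2] := truncP (mulr_ge0 (ltW n2p) (ltW lam0)).
have [z1 z2] := floorP (n2%:R * tau R P).
have nl : 2 * r%:R ^+ 2 <= n2%:R :> R.
  have : (2 * r ^ 2 <= n2)%N.
    by rewrite (leq_trans _ rn)// leq_mul// leq_pexp2l.
  by rewrite -(ler_nat R) natrM natrX.
have e1 : n2%:R / r%:R ^+ 2 <= n2%:R * lam R P by rewrite ler_wpM2l// ltW.
have e2 : 2 <= n2%:R / r%:R ^+ 2 :> R by rewrite ler_pdivlMr ?exprn_gt0.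
have kl0 : (0 < kl P)%N by rewrite -(ltr_nat R); rewrite -/(kl P) in k2; lra.
have Ln : n2%:R * lam R P <= L%:R.
  by rewrite /L natrM natrX ler_wpM2l// ltW.
move: t1; rewrite ler_norml => /andP[t1 t2].
have zlo : - (n2%:R * r%:R ^+ 2) - 1 <= (kz P)%:~R :> R.
  have : - (n2%:R * r%:R ^+ 2) <= n2%:R * tau R P by rewrite -mulrN ler_wpM2l// ltW.
  by rewrite -/(kz P) in z2; lra.
have zhi : (kz P)%:~R <= n2%:R * r%:R ^+ 2 :> R.
  by rewrite (le_trans z1)// ler_wpM2l// ltW.
split=> //.
- split=> //; rewrite prednK//.
  by rewrite -(ler_nat R) (le_trans k1).
- rewrite -/(kl P) in k2; have : n2%:R / r%:R ^+ 2 <= 2 * (kl P)%:R :> R by lra.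
  by rewrite ler_pdivrMr ?exprn_gt0//; lra.
- have zM : - M%:Z <= kz P < M%:Z.
    have ME : M%:Z%:~R = 16 * (n2%:R * r%:R ^+ 6) :> R by rewrite /M -mulnA -pmulrn natrM (natrM _ n2) (natrX _ r).
    have r26 : n2%:R * r%:R ^+ 2 <= n2%:R * r%:R ^+ 6 :> R.
      by rewrite ler_wpM2l ?(ltW n2p)// ler_weXn2l.
    have nr : 1 <= n2%:R * r%:R ^+ 2 :> R by rewrite -natrX -natrM (ler_nat _ 1).
    by apply/andP; split; rewrite -?(ler_int R) -?(ltr_int R) ?rmorphN/= ME; lra.
  have M1 : (0 < M)%N by move: M0; rewrite muln_gt0.
  have := divz_eq (kz P) n%:Z; have := modz_ge0 (kz P) (_ : n%:Z != 0).
  have := ltz_mod (kz P) (_ : n%:Z != 0).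
  clear -zM n0 M1; set w := (_ %/ _)%Z; set s := (_ %% _)%Z => h1 h2 h3.
  have nz : n%:Z != 0 by lia.
  move: (h1 nz) (h2 nz) => {}h1 {}h2.
  have w1 : - M%:Z <= w by nia.
  have w2 : w < M%:Z by nia.
  by split; lia.
- have y0 : 0 <= slope R P + 1 by move: s1; rewrite ler_norml => /andP[]; lra.
  have y2 : slope R P + 1 <= 2 by move: s1; rewrite ler_norml => /andP[]; lra.
  have [y1 _] := truncP (mulr_ge0 (ltW n2p) y0).
  rewrite /Ny ltnS -(ler_nat R) (le_trans y1)// natrM mulrC ler_wpM2r// ltW//.
Qed.

Let keyE P : P \in ws -> [/\ ((key P).1 : nat) = (kl P).-1,
   ((key P).2.1 : nat)%:Z = (kz P %/ n%:Z)%Z + M%:Z, ((key P).2.2 : nat)%:Z = (kz P %% n%:Z)%Z &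
   (ky P : nat) = kyn P].
Proof.
move=> /data[[k1 k2] _ _ [z1 z2] y1].
have nz : n%:Z != 0 by rewrite -lt0n.
split; rewrite /key /ky /= ?val_insubd ?inordK//.
- by rewrite k2.
- by rewrite z1; lia.
- have h1 := modz_ge0 (kz P) nz; have h2 := ltz_mod (kz P) nz.
  rewrite (_ : (_ < n)%N); first by clear -h1; lia.
  by clear -h1 h2; lia.
- by rewrite y1.
Qed.

Let affE P : P \in ws -> key_aff R 1 (key P) = aff R n (kl P) (kz P).
Proof.
move=> Pw; have [e1 e2 e3 _] := keyE Pw; have [[k1 _] _ _ _ _] := data Pw.
rewrite /key_aff e1 addn1 prednK// e2 e3 addrK; congr aff.
by rewrite -divz_eq.
Qed.

Let close P : P \in ws -> [/\ 0 <= lam R P - (kl P)%:R / n2%:R /\ lam R P - (kl P)%:R / n2%:R < del,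
   0 <= tau R P - (kz P)%:~R / n2%:R /\ tau R P - (kz P)%:~R / n2%:R < del &
   0 <= slope R P + 1 - (kyn P)%:R / n2%:R /\ slope R P + 1 - (kyn P)%:R / n2%:R < del].
Proof.
move=> /wsB[bP cd]; have [d0 _ _ /andP[l1 l2] [t1 s1]] := coords_bounds R Q0 bP cd.
have rp : 0 < r%:R :> R by rewrite ltr0n.
have lam0 : 0 < lam R P by apply: lt_le_trans l1; rewrite invr_gt0 exprn_gt0.
have y0 : 0 <= slope R P + 1 by move: s1; rewrite ler_norml => /andP[]; lra.
have [k1 k2] := truncP (mulr_ge0 (ltW n2p) (ltW lam0)).
have [z1 z2] := floorP (n2%:R * tau R P).
have [y1 y2] := truncP (mulr_ge0 (ltW n2p) y0).
by split; apply: near_frac.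
Qed.

Let key_near P P' : P \in ws -> P' \in ws -> (ky P' == ky P) && (key P' == key P) ->
  near_pm (Q ^ 2) Y (mmul P' (madj P)).
Proof.
move=> Pw Pw' /andP[/eqP ey /eqP ek].
have [a1 a2 a3 a4] := keyE Pw; have [b1 b2 b3 b4] := keyE Pw'.
have [[k1 _] _ _ _ _] := data Pw; have [[k1' _] _ _ _ _] := data Pw'.
have el : kl P' = kl P.
  by rewrite -(prednK k1) -(prednK k1') -a1 -b1 ek.
have ez : kz P' = kz P.
  have h1 : (kz P' %/ n%:Z)%Z = (kz P %/ n%:Z)%Z by apply: (addIr M%:Z); rewrite -a2 -b2 ek.
  have h2 : (kz P' %% n%:Z)%Z = (kz P %% n%:Z)%Z by rewrite -a3 -b3 ek.
  by rewrite (divz_eq (kz P') n%:Z) h1 h2 -divz_eq.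
have eyn : kyn P' = kyn P by rewrite -a4 -b4 ey.
have [[c1 c2] [c3 c4] [c5 c6]] := close Pw; have [[d1 d2] [d3 d4] [d5 d6]] := close Pw'.
rewrite el in d1 d2; rewrite ez in d3 d4; rewrite eyn in d5 d6.
have [bP cd] := wsB Pw; have [bP' cd'] := wsB Pw'.
apply: (same_cell_near Q0 (_ : 0 <= del) bP' bP cd' cd) => //.
- by rewrite invr_ge0 ltW.
- by rewrite ler_norml; apply/andP; split; lra.
- by rewrite ler_norml; apply/andP; split; lra.
- by rewrite ler_norml; apply/andP; split; lra.
Qed.

(** A point of the support has [l x + z] in [[0, n^2)] with [l >= n^2 / (2 r^2)] and
    [|z| <= n^2 r^2 + 1]; hence [|x| <= 6 r^4], the value of [X]. *)
Let supp P : P \in ws -> forall x, ~~ ((- X <= x) && (x < X)) -> T (key_aff R 1 (key P)) phi x = 0.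
Proof.
move=> Pw x; rewrite affE// => xX; rewrite /T (_ : phi _ = 0) ?mulr0 ?mul0r//.
apply: step_out; apply: contra xX; rewrite /mob /den /aff /ma /mb /mc /md /= -/n2 mul0r add0r divr1.
have [[k1 _] nk [z1 z2] _ _] := data Pw.
have kp : 0 < (kl P)%:R :> R by rewrite ltr0n.
rewrite (_ : _ + _ = ((kl P)%:R * x + (kz P)%:~R) / n2%:R); last by field; rewrite gt_eqF.
rewrite ler_pdivlMr// ltr_pdivrMr// mul0r mul1r => /andP[h1 h2].
have r24 : r%:R ^+ 2 <= r%:R ^+ 4 :> R by rewrite ler_weXn2l.
have r2 : 1 <= r%:R ^+ 2 :> R by rewrite exprn_ege1.
have n21 : 1 <= n2%:R :> R by rewrite (ler_nat _ 1).
have A : n2%:R * r%:R ^+ 2 <= 2 * (r%:R ^+ 4 * (kl P)%:R) :> R.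
  rewrite (_ : 2 * _ = 2 * r%:R ^+ 2 * (kl P)%:R * r%:R ^+ 2); last by ring.
  by rewrite ler_wpM2r// exprn_ge0.
have B : n2%:R <= n2%:R * r%:R ^+ 2 :> R by rewrite ler_peMr// ltW.
apply/andP; split.
  by rewrite -(ler_pM2l kp) /X; lra.
by rewrite -(ltr_pM2l kp) /X; lra.
Qed.

Let rep P := fun x => T (nny (ky P)) (T (key_aff R 1 (key P)) phi) x.

Let err P : P \in ws -> N (fun x => T (mR R P) phi x - rep P x) <=
   1000 * (16 * r%:R ^+ 6 * del) * n%:R * N phi.
Proof.
move=> Pw; rewrite /rep affE//; have [bP cd] := wsB Pw.
have [[c1 c2] [c3 c4] [c5 c6]] := close Pw; have [_ _ _ b4] := keyE Pw.
apply: (@rep_close R n (fun i => c i%:Z) n0 Q r del P (kl P) (kz P) _ Q0 bP cd) => //.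
- by rewrite invr_gt0.
- rewrite /del ler_pdivrMr//; have : (1600 * r ^ 6)%:R <= n2%:R :> R by rewrite ler_nat.
  by rewrite natrM natrX; lra.
- by rewrite -/n2 ler_norml; apply/andP; split; lra.
- by rewrite -/n2 ler_norml; apply/andP; split; lra.
- by rewrite b4 ler_norml; apply/andP; split; lra.
Qed.

(** Each word is replaced by its grid point, with an error summed by the triangle inequality. The
    grid points are handled by [N_flatten], and words with equal keys lie in one cell, so their
    number is controlled by [near_pm]. *)
Lemma class_bound :
  N (fun x => \sum_(P <- ws) T (mR R P) phi x) <=
  2 * ((size ws)%:R ^+ 2 * (16 * 1000 * r%:R ^+ 6 * v ^- 16 * N phi)) +
  2 * (60 * 1000 * r%:R ^+ 16 * v ^+ 92 * N phi *
    (\sum_(P <- ws) count (fun P' => near_pm (Q ^ 2) Y (mmul P' (madj P))) ws)%:R).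
Proof.
have vp : 0 < v by apply: lt_le_trans v1.
have v1' : 1 <= v by exact: v1.
have Lrep P : L2 (rep P) by apply: L2_Tany; apply: L2_Tany.
have LT P : L2 (T (mR R P) phi) by exact: L2_Tany.
have -> : (fun x => \sum_(P <- ws) T (mR R P) phi x) =
  (fun x => \sum_(P <- ws) (T (mR R P) phi x - rep P x) + \sum_(P <- ws) rep P x).
  apply/funext => x; rewrite -big_split/=; apply: eq_bigr => P _; by rewrite subrK.
apply: le_trans (N_add2 _ _) _; [by apply: L2sum => P; exact: L2B|exact: L2sum|].
apply: lerD; rewrite ler_pM2l//.
  have n16 : n%:R * del = v ^- 16 by rewrite /del /n2 natrX -vn; field; rewrite gt_eqF.
  have -> : 16 * 1000 * r%:R ^+ 6 * v ^- 16 * N phi = 1000 * (16 * r%:R ^+ 6 * del) * n%:R * N phi.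
    by rewrite -n16; ring.
  by apply: N_sum_le_max err => P; exact: L2B.
have sg0 : 0 < v ^- 8 by rewrite invr_gt0 exprn_gt0.
have X1 : 1 <= X.
  have : 1 <= r%:R ^+ 4 :> R by rewrite exprn_ege1.
  by rewrite /X; lra.
have MX : (1 + L)%:R * X + 1 + (2 * n)%:R <= M%:R.
  have h24 : r%:R ^+ 4 <= n2%:R * r%:R ^+ 6 :> R.
    apply: le_trans (_ : r%:R ^+ 6 <= _); first by rewrite ler_weXn2l.
    by rewrite ler_peMl ?exprn_ge0// (ler_nat _ 1).
  have h6 : 1 <= r%:R ^+ 6 :> R by rewrite exprn_ege1.
  have hn : n%:R <= n2%:R * r%:R ^+ 6 :> R.
    apply: le_trans (_ : n2%:R <= _); last by rewrite ler_peMr.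
    by rewrite ler_nat /n2 -[X in (X <= _)%N]expn1 leq_pexp2l.
  have n21 : 1 <= n2%:R :> R by rewrite (ler_nat _ 1).
  have h1 : 1 <= n2%:R * r%:R ^+ 6 :> R by rewrite mulr_ege1.
  have LE : L%:R = n2%:R * r%:R ^+ 2 :> R by rewrite /L natrM natrX.
  have ME : M%:R = 16 * (n2%:R * r%:R ^+ 6) :> R by rewrite /M -mulnA natrM (natrM _ n2) (natrX _ r).
  rewrite natrD LE ME natrM /X (_ : (_ + _) * _ = 6 * r%:R ^+ 4 + 6 * (n2%:R * r%:R ^+ 6)); last by ring.
  by lra.
have nny0 y : 0 < mdet (nny y) by rewrite /mdet /nny /nn /ma /mb /mc /md /= mul1r mul0r subr0.
have F := N_flatten n0 e0 ce ky (isT : (0 < 1)%N) sg0 X1 MX nny0 supp.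
apply: le_trans F _.
have n2E : n2%:R = v ^+ 32 :> R by rewrite /n2 natrX -vn -exprM.
apply: ler_pM => //.
- rewrite mulr_ge0// mulr_ge0// ?mulr_ge0 ?sqrtr_ge0//.
  have E0 := @energy_ge0 R n e; have X0 : 0 <= X by apply: le_trans X1.
  have iv : 0 <= n%:R / v ^- 8 by rewrite divr_ge0// invr_ge0 exprn_ge0// ltW.
  have X2 : 0 <= 2 * X + 2 by rewrite addr_ge0// mulr_ge0.
  apply: addr_ge0; apply: mulr_ge0; rewrite ?sqrtr_ge0//; first by rewrite !mulr_ge0.
  apply: mulr_ge0; first by rewrite mulr_ge0.
  by apply: addr_ge0; apply: mulr_ge0 => //; exact: addr_ge0.
- have eN' : energy n e <= v ^+ 16 * N phi by rewrite vn.
  have := flatten_constants v1' r1R (@energy_ge0 R n e) eN'.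
  rewrite -/n2 n2E -vn natrD -[Ny]addn1 natrD natrM n2E.
  by rewrite /L natrM n2E natrX.
rewrite ler_nat big_seq [X in (_ <= X)%N]big_seq; apply: leq_sum => P Pw.
by apply: count_sub_in => P' Pw'; exact: key_near.
Qed.
End class_bound.

(** * The size of words, and pairs of words in one cell *)

Section word_geometry.
Variables (q D X C : nat) (S : seq (mat int)).
Hypothesis q_prime : prime q.
Hypothesis X0 : (0 < X)%N.
Hypothesis Xq : (X ^ 2 <= q)%N.
Hypothesis D132 : (132 <= D)%N.
Hypothesis S1 : forall g, g \in S -> sized q X g.
Hypothesis S2 : forall g h, g \in S -> h \in S -> close D X g h.

Definition rows_le (B : int) (P : mat int) :=
  `|ma P| + `|mb P| <= B /\ `|mc P| + `|md P| <= B.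

Lemma rows_mul (A B : int) g h : 0 <= A -> rows_le A g -> rows_le B h -> rows_le (A * B) (mmul g h).
Proof.
move: g h => [[[a b] c] d] [[[a' b'] c'] d']; rewrite /rows_le /mmul /ma /mb /mc /md /= => A0 [h1 h2] [k1 k2].
have row (x y : int) : `|x| + `|y| <= A -> `|x * a' + y * c'| + `|x * b' + y * d'| <= A * B.
  move=> xy; apply: le_trans (_ : `|x| * (`|a'| + `|b'|) + `|y| * (`|c'| + `|d'|) <= _).
    by rewrite !mulrDr -!normrM addrACA lerD// ler_normD.
  apply: le_trans (_ : (`|x| + `|y|) * B <= _).
    by rewrite mulrDl lerD// ler_wpM2l.
  by rewrite ler_wpM2r// (le_trans _ k1)// addr_ge0.
by split; exact: row.
Qed.

(** The product is the scalar [q] plus entries of size at most [66 X^2 / D <= q / 2]. Thus [k] pairs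
    of letters lose only a factor [2^k] against the determinant. *)
Lemma rows_pair g h : g \in S -> h \in S -> rows_le (2 * q%:Z) (mmul (madj g) h).
Proof.
move=> gs hs; have [dg a1 b1 c1 d1] := S1 gs; have [e1 e2 e3 e4] := S2 hs gs.
have b1' : `|- mb g| <= 33 * X%:Z by rewrite normrN.
have c1' : `|- mc g| <= 33 * X%:Z by rewrite normrN.
have D66 : (66 < D)%N by lia.
have CB := comb_bound q_prime X0 Xq D66.
have f1 := CB _ _ _ _ d1 b1' e1 e3; have f2 := CB _ _ _ _ d1 b1' e2 e4.
have f3 := CB _ _ _ _ c1' a1 e1 e3; have f4 := CB _ _ _ _ c1' a1 e2 e4.
rewrite adj_mulE dg /rows_le /ma /mb /mc /md /= -/(ma g) -/(mb g) -/(mc g) -/(md g) -/(ma h) -/(mb h) -/(mc h) -/(md h).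
have K (w : int) : `|w| * D%:Z <= 66 * X%:Z * X%:Z -> 2 * `|w| <= q%:Z.
  have : 0 <= `|w| by [].
  move: `|w| => u u0 hu; clear -Xq D132 u0 hu; nia.
move: (K _ f1) (K _ f2) (K _ f3) (K _ f4) => {f1 f2 f3 f4}.
move: (_ + _) (_ + _) (_ + _) (_ + _) => w1 w2 w3 w4; clear; lia.
Qed.

Lemma words_bounded k P : P \in words S true (2 * k) -> bounded (q ^ k) (2 ^ k) P.
Proof.
suff : P \in words S true (2 * k) -> rows_le ((2 * q%:Z) ^+ k) P.
  move=> H Pw; have [h1 h2] := H Pw.
  have E : ((2 ^ k * q ^ k)%N%:Z) = (2 * q%:Z) ^+ k.
    by rewrite -expnMn -!natz natrX natrM.
  split; rewrite ?E//; rewrite (det_words S1 Pw) -!natz natrX -exprM mulnC//.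
elim: k P => [|k IH] P; first by rewrite inE => /eqP ->.
rewrite (_ : (2 * k.+1 = (2 * k).+2)%N); last by lia.
move=> /allpairsP[[e P'] /= [/mapP[g gs ->] /allpairsP[[h P''] /= [hs Pw ->]] ->]].
by rewrite mmulA exprS; apply: rows_mul; [rewrite mulr_ge0|exact: rows_pair|exact: IH].
Qed.

(** Right multiplication by a rotation of order four. It exchanges the columns up to sign, so it
    carries [|d| < |c|] into the chart [|c| <= |d|], and it leaves [P' madj P] unchanged. *)
Definition flip (P : mat int) : mat int := (mb P, - ma P, md P, - mc P).

Lemma flip_bounded Q r P : bounded Q r P -> bounded Q r (flip P).
Proof.
rewrite /bounded /flip /mdet /ma /mb /mc /md /= => -[dP h1 h2].
split; rewrite ?normrN ?[`|_| + `|P.1.1.1|]addrC ?[`|_| + `|P.1.2|]addrC//.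
by rewrite -dP; ring.
Qed.

Lemma flip_adj P P' : mmul (flip P') (madj (flip P)) = mmul P' (madj P).
Proof. by apply: matP; rewrite /flip /mmul /madj /ma /mb /mc /md /=; ring. Qed.

(** Adjugation permutes the words of the even length [2k], so [P' madj P] runs over all words of
    length [4k] with the right multiplicity. *)
Lemma collisions k (a : pred (mat int)) :
  (\sum_(P <- words S true (2 * k)) count (fun P' => a (mmul P' (madj P))) (words S true (2 * k)) =
   count a (words S true (4 * k)))%N.
Proof.
have cE (b : pred (mat int)) s : count b s = (\sum_(x <- s) (b x : nat))%N.
  by rewrite -sum1_count big_mkcond/=; apply: eq_bigr => x _; case: (b x).
have o2 : odd (2 * k) = false by rewrite mul2n odd_double.
rewrite cE (_ : (4 * k = 2 * k + 2 * k)%N); last by clear; lia.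
under eq_bigr do rewrite cE.
rewrite exchange_big/= (sum_words_cat S true (2 * k) (2 * k) (fun P => nat_of_bool (a P))).
apply: eq_bigr => P' _.
rewrite (sum_words_adj S true (2 * k) (fun P => nat_of_bool (a (mmul P' P)))).
by rewrite o2.
Qed.

End word_geometry.

Lemma leq_three_pow k : ((2 * k).+1 <= 3 ^ k)%N.
Proof. by elim: k => // m IH; rewrite expnS; lia. Qed.

(** * The spectral gap *)

Section gap.
Context (R : realType).
Variables (q D X C Ct : nat) (S : seq (mat int)).
Hypothesis q_prime : prime q.
Hypothesis X0 : (0 < X)%N.
Hypothesis Xq : (X ^ 2 <= q)%N.
Hypothesis D132 : (132 <= D)%N.
Hypothesis SU : uniq S.
Hypothesis S0 : (0 < size S)%N.
Hypothesis S1 : forall g, g \in S -> sized q X g.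
Hypothesis S2 : forall g h, g \in S -> h \in S -> close D X g h.
Hypothesis SC : (q <= C * size S)%N.
Hypothesis Ct0 : (0 < Ct)%N.
Hypothesis CtP : forall N : nat, (0 < N)%N -> (size (divisors N) ^ 256 <= Ct * N)%N.

Variable A : R.
Hypothesis A_big : 128 * 1000 + 480 * 1000 * (16 * 328) <= A.
(** Its [k]-th power dominates all constants lost at length [4k], and [gap_const^64 <= q] turns it
    into [q^(k/64) <= n^(1/16) = v]. *)
Definition gap_const : R := A * (Ct%:R * 3 * (16 * C%:R ^+ 4) * 2 ^+ 34).
Hypothesis qB : gap_const ^+ 64 <= q%:R.

Variables (n : nat) (c e : int -> R).
Hypothesis qn : (q <= n)%N.
Hypothesis e0 : forall z, e z != 0 -> 0 <= z < n%:Z - 1.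
Hypothesis ce : forall z, c z = e z - e (z - 1).
Let phi := step n (fun i => c i%:Z).
Hypothesis eN : energy n e <= n%:R * N phi.
Let Lphi : L2 phi. Proof. exact: L2_step. Qed.
Local Notation K := ((size S)%:R : R).

Let Cpos : (0 < C)%N.
Proof.
rewrite lt0n; apply/eqP => C0; move: SC (prime_gt0 q_prime); rewrite C0 mul0n leqn0 => /eqP ->.
by [].
Qed.

Section level.
Variables (k : nat) (v : R).
Hypothesis k0 : (0 < k)%N.
Hypothesis qk : (q ^ k <= n ^ 4)%N.
Hypothesis qk1 : (n ^ 4 < q ^ k.+1)%N.
Hypothesis v1 : 1 <= v.
Hypothesis vn : v ^+ 16 = n%:R.
Local Notation r := (2 ^ k)%N.
Local Notation Q := (q ^ k)%N.
Local Notation ws := (words S true (2 * k)).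

(** Collects the number of levels, the factor [(2 C)^(4k)], the divisor constant and the powers of
    [r = 2^k]: the exponent 34 is 16 from [class_bound] plus 18 from [Y^3]. *)
Let G : R := (2 * k).+1%:R * (16 * C%:R ^+ 4) ^+ k * Ct%:R * 2 ^+ (34 * k).

Let A1 : 1600 <= A.
Proof. by apply: le_trans A_big; lra. Qed.

Let A0 : 0 <= A. Proof. by move: A1; lra. Qed.

Let Gv : A * G <= v.
Proof.
have A1' : 1 <= A by move: A1; lra.
have b0 : 0 <= gap_const.
  by rewrite /gap_const; repeat apply: mulr_ge0 => //; rewrite exprn_ge0.
have C1 : 1 <= C%:R :> R by rewrite (ler_nat _ 1).
have Ct1 : 1 <= Ct%:R :> R by rewrite (ler_nat _ 1).
have vp : 0 < v by apply: lt_le_trans v1.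
apply: le_trans (_ : gap_const ^+ k <= _); last first.
  rewrite -(@ler_pXn2r _ 64)// ?nnegrE ?exprn_ge0// ?(ltW vp)//.
  rewrite -exprM mulnC exprM (le_trans (_ : _ <= q%:R ^+ k))//.
    by rewrite lerXn2r ?nnegrE ?exprn_ge0.
  rewrite (_ : (64 = 16 * 4)%N)// exprM vn -!natrX ler_nat//.
have p3 : (2 * k).+1%:R <= 3 ^+ k :> R.
  by rewrite -natrX ler_nat leq_three_pow.
have c16 : 1 <= 16 * C%:R ^+ 4 :> R.
  have h : 1 <= C%:R ^+ 4 :> R by rewrite exprn_ege1.
  by move: h; lra.
have -> : gap_const ^+ k = A ^+ k * (Ct%:R * 3 * (16 * C%:R ^+ 4) * 2 ^+ 34) ^+ k by rewrite -exprMn.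
apply: ler_pM => //.
- by rewrite /G; repeat apply: mulr_ge0 => //; rewrite exprn_ge0// mulr_ge0// exprn_ge0.
- by rewrite -[X in X <= _]expr1 ler_weXn2l.
rewrite (_ : Ct%:R * 3 * (16 * C%:R ^+ 4) = 3 * (16 * C%:R ^+ 4) * Ct%:R); last by rewrite -mulrA mulrC.
rewrite exprMn [(_ * Ct%:R) ^+ k]exprMn [(3 * _) ^+ k]exprMn -exprM /G.
apply: ler_pM => //; rewrite ?mulr_ge0 ?exprn_ge0 ?mulr_ge0 ?exprn_ge0//.
apply: ler_pM => //; rewrite ?mulr_ge0 ?exprn_ge0 ?mulr_ge0 ?exprn_ge0//.
  by rewrite ler_wpM2r// exprn_ge0// mulr_ge0// exprn_ge0.
by rewrite -[X in X <= _]expr1 ler_weXn2l.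
Qed.

Let C1 : 1 <= 16 * C%:R ^+ 4 :> R.
Proof.
have : 1 <= C%:R ^+ 4 :> R by rewrite exprn_ege1// (ler_nat _ 1).
by lra.
Qed.

Let Gr : 2 ^+ (34 * k) <= G.
Proof.
rewrite /G ler_peMl ?exprn_ge0// mulr_ege1 ?(ler_nat _ 1)// mulr_ege1 ?(ler_nat _ 1)//.
by rewrite exprn_ege1.
Qed.

Let r6 : (1600 * r ^ 6 <= n ^ 2)%N.
Proof.
rewrite -(ler_nat R) natrX -vn -exprM natrM natrX natrX -exprM.
have v32 : v <= v ^+ 32 by rewrite -[X in X <= _]expr1 ler_weXn2l.
have r34 : 2 ^+ (k * 6) <= 2 ^+ (34 * k) :> R by rewrite ler_weXn2l ?ler1n// mulnC leq_mul2r orbT.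
have r1 : 1 <= 2 ^+ (k * 6) :> R by rewrite exprn_ege1// ler1n.
rewrite (_ : 16 * 2 = 32)%N//.
have h := ler_pM (ler0n R 1600) (exprn_ge0 (k * 6) (ler0n R 2)) A1 (le_trans r34 Gr).
exact: le_trans (le_trans h Gv) v32.
Qed.

Let n2E : (n ^ 2)%:R = v ^+ 32 :> R. Proof. by rewrite natrX -vn -exprM. Qed.

Let vp : 0 < v. Proof. exact: lt_le_trans v1. Qed.

Let Y := Num.truncn (3 * r%:R ^+ 6 * (n ^ 2)%:R^-1 * Q%:R ^+ 2 : R).
Let ct := Num.truncn (Ct%:R * v).
Let Qq : R := (q ^ (2 * k))%:R.

Let q0 : (0 < q)%N. Proof. exact: prime_gt0. Qed.
Let Qq0 : 0 < Qq. Proof. by rewrite ltr0n expn_gt0 q0. Qed.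
Let QqE : Q%:R ^+ 2 = Qq. Proof. by rewrite /Qq -natrX -expnM mulnC. Qed.

Let Ypos : 0 <= 3 * r%:R ^+ 6 * (n ^ 2)%:R^-1 * Q%:R ^+ 2 :> R.
Proof. by rewrite !mulr_ge0. Qed.

Let YE : Y%:R <= 3 * r%:R ^+ 6 * v ^- 32 * Qq.
Proof. by rewrite -n2E -QqE; have /andP[] := truncn_itv Ypos. Qed.

Let Y_le : (2 * Y <= q ^ (2 * k))%N.
Proof.
rewrite -(ler_nat R) natrM -/Qq; apply: le_trans (_ : 2 * (3 * r%:R ^+ 6 * v ^- 32 * Qq) <= _).
  by rewrite ler_pM2l.
have : 6 * r%:R ^+ 6 * v ^- 32 <= 1 :> R.
  rewrite -n2E ler_pdivrMr ?ltr0n ?expn_gt0 ?(leq_trans q0 qn)// mul1r.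
  have := r6; rewrite -(ler_nat R) natrM (natrX _ r); have : 0 <= r%:R ^+ 6 :> R by rewrite exprn_ge0.
  by lra.
move=> /(ler_wpM2r (ltW Qq0)); rewrite mul1r; lra.
Qed.

Let ct_le : ct%:R <= Ct%:R * v.
Proof. by have /andP[] := truncn_itv (mulr_ge0 (ler0n R Ct) (ltW vp)). Qed.

(** Here [N <= q^(4k) <= n^16 = v^256], so the divisor bound with exponent 256 costs a single factor
    [v]. *)
Let ctP N : (0 < N <= (q ^ (2 * k)) ^ 2)%N -> (size (divisors N) <= ct)%N.
Proof.
move=> /andP[N0 NQ]; rewrite /ct truncn_ge_nat ?mulr_ge0 ?(ltW vp)//.
rewrite -(@ler_pXn2r _ 256)// ?nnegrE ?mulr_ge0 ?(ltW vp)//.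
have := CtP N0; rewrite -(ler_nat R) natrX natrM => /le_trans; apply.
have Nv : N%:R <= v ^+ 256.
  rewrite (_ : 256 = 16 * (4 * 4))%N// exprM vn -natrX ler_nat (leq_trans NQ)//.
  rewrite [(n ^ _)%N]expnM (_ : (q ^ (2 * k)) ^ 2 = (q ^ k) ^ 4)%N ?leq_exp2r//.
  by rewrite -!expnM mulnAC mulnC.
rewrite exprMn ler_pM ?exprn_ge0//.
by rewrite -[X in X <= _]expr1 ler_weXn2l ?(ler_nat _ 1).
Qed.

(** As [q <= n], the inequality [n^4 < q^(k+1)] gives [q^k >= n^3]. So the granularity [1 / Qq] does
    not exceed the volume [n^-6 = v^-96] of a cell. *)
Let Qv : v ^+ 96 <= Qq.
Proof.
rewrite /Qq (_ : 96 = 16 * 6)%N// exprM vn -natrX ler_nat.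
have n3 : (n ^ 3 <= q ^ k)%N.
  rewrite -(leq_pmul2l q0) -expnS (leq_trans _ (ltnW qk1))// expnS.
  by rewrite leq_mul2r qn orbT.
by rewrite (_ : n ^ 6 = (n ^ 3) ^ 2)%N ?[(2 * k)%N]mulnC ?(expnM q) ?leq_exp2r// -expnM.
Qed.

Let coll_bound : (count (near_pm (Q ^ 2) Y) (words S true (4 * k)))%:R <=
  K ^+ (4 * k) * (16 * 328 * (G / 2 ^+ (34 * k)) * 2 ^+ (18 * k) * v ^- 95).
Proof.
have D66 : (66 < D)%N by exact: leq_trans D132.
have H := count_near_words q_prime X0 Xq D66 SU S0 S1 S2 SC Y_le ctP.
rewrite (_ : Q ^ 2 = q ^ (2 * k))%N; last by rewrite -expnM mulnC.
have p : 0 < Qq ^+ 3 by rewrite exprn_gt0.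
rewrite -(ler_pM2r p); move: H; rewrite -(ler_nat R).
set cnt := count _ _; rewrite natrM natrX -/Qq => /le_trans; apply.
have -> : ((2 * k).+1 * 16 * (2 * C) ^ (4 * k) * size S ^ (4 * k) * ct *
    (12 * Y ^ 3 + 4 * (q ^ (2 * k)) ^ 2))%:R = (2 * k).+1%:R * 16 * (2 * C%:R) ^+ (4 * k) * K ^+ (4 * k) *
    ct%:R * (12 * Y%:R ^+ 3 + 4 * Qq ^+ 2) :> R.
  rewrite natrM; congr (_ * _); last by rewrite natrD natrM natrX natrM natrX.
  rewrite natrM; congr (_ * _); rewrite natrM natrX; congr (_ * _).
  by rewrite natrM natrX natrM natrM.
have r18 : r%:R ^+ 6 = 2 ^+ (6 * k) :> R by rewrite natrX -exprM mulnC.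
have inner : 12 * Y%:R ^+ 3 + 4 * Qq ^+ 2 <= 328 * 2 ^+ (18 * k) * v ^- 96 * Qq ^+ 3.
  have h1 : Y%:R ^+ 3 <= (3 * r%:R ^+ 6 * v ^- 32 * Qq) ^+ 3.
    by rewrite lerXn2r ?nnegrE// !mulr_ge0 ?invr_ge0 ?exprn_ge0 ?(ltW vp) ?(ltW Qq0).
  have e1 : (3 * r%:R ^+ 6 * v ^- 32 * Qq) ^+ 3 = 27 * (2 ^+ (18 * k) * v ^- 96 * Qq ^+ 3).
    rewrite r18 !exprMn -!exprVn -!exprM (_ : 6 * k * 3 = 18 * k)%N; last by clear; lia.
    by rewrite (_ : 32 * 3 = 96)%N//; ring.
  have e2 : Qq ^+ 2 <= 2 ^+ (18 * k) * v ^- 96 * Qq ^+ 3.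
    rewrite (_ : Qq ^+ 3 = Qq * Qq ^+ 2); last by rewrite exprS.
    rewrite mulrA ler_peMl ?exprn_ge0 ?(ltW Qq0)// -mulrA; apply: mulr_ege1.
      by rewrite exprn_ege1// ler1n.
    by rewrite mulrC ler_pdivlMr ?exprn_gt0// mul1r.
  by lra.
apply: le_trans (_ : (2 * k).+1%:R * 16 * (2 * C%:R) ^+ (4 * k) * K ^+ (4 * k) * (Ct%:R * v) *
   (328 * 2 ^+ (18 * k) * v ^- 96 * Qq ^+ 3) <= _).
  apply: ler_pM => //.
    by rewrite addr_ge0// mulr_ge0// exprn_ge0// ltW.
  rewrite ler_wpM2l//; repeat apply: mulr_ge0 => //; rewrite exprn_ge0// mulr_ge0.
have e3 : (2 * C%:R) ^+ (4 * k) = (16 * C%:R ^+ 4) ^+ k :> R.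
  by rewrite exprM; congr (_ ^+ k); ring.
rewrite le_eqVlt e3 /G; apply/orP; left; apply/eqP; field.
by rewrite !expf_neq0 ?(gt_eqF vp)// pnatr_eq0.
Qed.

Let class_collisions (a : pred (mat int)) (b : pred (mat int)) :
  (\sum_(P <- [seq P <- ws | b P]) count (fun P' => a (mmul P' (madj P))) [seq P <- ws | b P]
   <= count a (words S true (4 * k)))%N.
Proof.
rewrite -(@collisions S k a) big_filter big_mkcond/=; apply: leq_sum => P _.
by case: (b P) => //; rewrite count_filter; apply: sub_count => P' /andP[].
Qed.

Let wi : mat R := (0, 1, -1, 0).

Let flipE P : P \in ws -> eqf (T (mR R P) phi) (T wi (T (mR R (flip P)) phi)).
Proof.
move=> Pw; have dw : mdet wi = 1 by rewrite /mdet /wi /ma /mb /mc /md /=; ring.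
have dP : mdet P = q%:Z ^+ (2 * k) := det_words S1 Pw.
have dfP : mdet (mR R (flip P)) = mdet (mR R P).
  by rewrite /mdet /mR /flip /ma /mb /mc /md /= !rmorphN/=; ring.
apply: eqf_sym; rewrite (_ : mR R P = mmul (mR R (flip P)) wi).
  apply: T_comp; first by rewrite dw.
  by rewrite dfP mR_det dP rmorphXn/= exprn_gt0// ltr0n.
by apply: matP; rewrite /mR /flip /mmul /wi /ma /mb /mc /md /= ?rmorphN/=; ring.
Qed.

Let total := A * G * v ^- 3 : R.

(** The words are split by [|c| <= |d|], the other half being rotated into the same chart by [flip].
    In each half the replacement error has order [v^-16] and the collision term [v^92 v^-95]; with
    all constants both stay below [total], and [A G <= v] leaves [v^-2]. *)
Lemma walk_level : N (walk S (2 * k) phi) <= v ^- 2 * N phi.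
Proof.
have n0 : (0 < n)%N by exact: leq_trans q0 qn.
have r0 : (0 < r)%N by rewrite expn_gt0.
have Q0 : (0 < Q)%N by rewrite expn_gt0 q0.
have LT P : L2 (T (mR R P) phi) by exact: L2_Tany.
have P0 : 0 <= N phi by exact: N_ge0.
have QY : 3 * r%:R ^+ 6 * (n ^ 2)%:R^-1 * Q%:R ^+ 2 < Y.+1%:R :> R.
  by have /andP[] := truncn_itv Ypos.
have CL (wsx : seq (mat int)) : (forall P, P \in wsx -> bounded Q r P /\ `|mc P| <= `|md P|) ->
   (size wsx <= size S ^ (2 * k))%N ->
   (\sum_(P <- wsx) count (fun P' => near_pm (Q ^ 2) Y (mmul P' (madj P))) wsx <=
     count (near_pm (Q ^ 2) Y) (words S true (4 * k)))%N ->
   N (fun x => \sum_(P <- wsx) T (mR R P) phi x) <= K ^+ (4 * k) * (total / 4 * N phi).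
  move=> wB ws_size wc.
  apply: le_trans (class_bound n0 r0 Q0 r6 v1 vn e0 ce eN wB QY) _; rewrite -/phi.
  pose W := K ^+ (4 * k) * (G * v ^- 3 * N phi).
  have v3 : 0 <= v ^- 3 by rewrite invr_ge0 exprn_ge0// ltW.
  have W0 : 0 <= W by repeat apply: mulr_ge0 => //; rewrite exprn_ge0.
  have s2 : (size wsx)%:R ^+ 2 <= K ^+ (4 * k).
    rewrite (_ : 4 * k = 2 * k * 2)%N; last by clear; lia.
    by rewrite exprM lerXn2r ?nnegrE ?exprn_ge0// -natrX ler_nat.
  have f1 (c1 : R) : 0 <= c1 -> (size wsx)%:R ^+ 2 * (c1 * r%:R ^+ 6 * v ^- 16 * N phi) <= c1 * W.
    move=> c10.
    rewrite (_ : c1 * W = K ^+ (4 * k) * (c1 * (G * v ^- 3) * N phi)); last by rewrite /W; ring.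
    apply: ler_pM; rewrite ?exprn_ge0//.
      by repeat apply: mulr_ge0 => //; rewrite ?exprn_ge0// invr_ge0 exprn_ge0// ltW.
    rewrite ler_wpM2r// -mulrA ler_wpM2l ?mulr_ge0// ler_pM ?exprn_ge0//.
    - by rewrite invr_ge0 exprn_ge0// ltW.
    - by apply: le_trans Gr; rewrite natrX -exprM ler_weXn2l ?ler1n// mulnC leq_mul2r orbT.
    - by rewrite lef_pV2 ?posrE ?exprn_gt0// ler_weXn2l.
  have f2 (c1 : R) : 0 <= c1 -> c1 * r%:R ^+ 16 * v ^+ 92 * N phi *
     (\sum_(P <- wsx) count (fun P' => near_pm (Q ^ 2) Y (mmul P' (madj P))) wsx)%:R <= c1 * (16 * 328) * W.
    move=> c10.
    have wc' : (\sum_(P <- wsx) count (fun P' => near_pm (Q ^ 2) Y (mmul P' (madj P))) wsx)%:R <=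
        K ^+ (4 * k) * (16 * 328 * (G / 2 ^+ (34 * k)) * 2 ^+ (18 * k) * v ^- 95).
      by apply: le_trans coll_bound; rewrite ler_nat.
    have p0 : 0 <= c1 * r%:R ^+ 16 * v ^+ 92 * N phi.
      exact: mulr_ge0 (mulr_ge0 (mulr_ge0 c10 (exprn_ge0 _ (ler0n _ _))) (exprn_ge0 _ (ltW vp))) P0.
    apply: le_trans (ler_wpM2l p0 wc') _; rewrite le_eqVlt; apply/orP; left; apply/eqP.
    rewrite /W natrX -exprM (_ : 34 * k = k * 16 + 18 * k)%N; last by clear; lia.
    rewrite exprD; field.
    by rewrite (gt_eqF vp) !expf_neq0// pnatr_eq0.
  have AW := ler_wpM2r W0 A_big.
  rewrite (_ : K ^+ (4 * k) * (total / 4 * N phi) = A * W / 4); last by rewrite /W /total; field; rewrite gt_eqF.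
  have := f1 _ (mulr_ge0 (ler0n R 16) (ler0n R 1000)); have := f2 _ (mulr_ge0 (ler0n R 60) (ler0n R 1000)).
  by move: AW; clearbody W; lra.
pose ws1 := [seq P <- ws | `|mc P| <= `|md P|].
pose ws2 := [seq flip P | P <- [seq P <- ws | ~~ (`|mc P| <= `|md P|)]].
have wsz : size ws = (size S ^ (2 * k))%N by exact: size_words.
have wB P : P \in ws -> bounded Q r P.
  exact: (words_bounded q_prime X0 Xq D132 S1 S2).
have b1 : N (fun x => \sum_(P <- ws1) T (mR R P) phi x) <= K ^+ (4 * k) * (total / 4 * N phi).
  apply: CL.
  - by move=> P; rewrite mem_filter => /andP[h /wB].
  - by rewrite -wsz size_filter count_size.
  - exact: class_collisions.
have b2 : N (fun x => \sum_(P <- ws2) T (mR R P) phi x) <= K ^+ (4 * k) * (total / 4 * N phi).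
  apply: CL.
  - move=> P /mapP[P']; rewrite mem_filter => /andP[h /wB/flip_bounded b' ->]; split=> //.
    by rewrite /flip /mc /md /= normrN -/(md P') -/(mc P') ltW// ltNge.
  - by rewrite -wsz size_map size_filter count_size.
  - rewrite /ws2 big_map (leq_trans _ (class_collisions (near_pm (Q ^ 2) Y) (fun P => ~~ (`|mc P| <= `|md P|))))//.
    apply: leq_sum => P _; rewrite count_map; apply: sub_count => P' /=.
    by rewrite flip_adj.
have Lw1 : L2 (fun x => \sum_(P <- ws1) T (mR R P) phi x) by exact: L2sum.
have Lw2 : L2 (fun x => \sum_(P <- ws2) T (mR R P) phi x) by exact: L2sum.
have Lw3 : L2 (fun x => \sum_(P <- [seq P <- ws | ~~ (`|mc P| <= `|md P|)]) T (mR R P) phi x) by exact: L2sum.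
have dw : 0 < mdet wi by rewrite (_ : mdet wi = 1)// /mdet /wi /ma /mb /mc /md /=; ring.
have b3 : N (fun x => \sum_(P <- [seq P <- ws | ~~ (`|mc P| <= `|md P|)]) T (mR R P) phi x) <= K ^+ (4 * k) * (total / 4 * N phi).
  apply: le_trans b2; rewrite -(N_T dw Lw2).
  rewrite (@N_eqf _ _ (T wi (fun x => \sum_(P <- ws2) T (mR R P) phi x)))//; first exact: L2_T.
  rewrite Tsum /ws2.
  have [s hs] : eqf (fun x => \sum_(P <- [seq P <- ws | ~~ (`|mc P| <= `|md P|)]) T (mR R P) phi x)
     (fun x => \sum_(P <- [seq P <- ws | ~~ (`|mc P| <= `|md P|)]) T wi (T (mR R (flip P)) phi) x).
    by apply: eqf_sum => P; rewrite mem_filter => /andP[_ Pw]; exact: flipE.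
  by exists s => x xs; rewrite big_map hs.
have Sdet g : g \in S -> mdet g = q%:Z by move=> /S1[].
have E := walk_words q0 Sdet (2 * k) (proj1 Lphi).
have Lsum : L2 (fun x => \sum_(P <- ws) T (mR R P) phi x) by exact: L2sum.
rewrite (N_eqf (L2_walk S (2 * k) Lphi) (L2Z _ Lsum) E).
have -> : N (fun x => K ^- (2 * k) * \sum_(P <- ws) T (mR R P) phi x) =
    K ^- (4 * k) * N (fun x => \sum_(P <- ws) T (mR R P) phi x).
  rewrite /N ipZl ?ipZr//; last exact: L2Z.
  rewrite mulrA -invfM -exprD; congr (_ ^- _ * _); clear; lia.
have Kp : 0 < K ^+ (4 * k) by rewrite exprn_gt0// ltr0n.
rewrite mulrC ler_pdivrMr//.
have -> : (fun x => \sum_(P <- ws) T (mR R P) phi x) = (fun x => \sum_(P <- ws1) T (mR R P) phi x +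
   \sum_(P <- [seq P <- ws | ~~ (`|mc P| <= `|md P|)]) T (mR R P) phi x).
  by apply/funext => x; rewrite !big_filter (bigID (fun P => `|mc P| <= `|md P|)).
apply: le_trans (N_add2 Lw1 Lw3) _.
have tv : total <= v ^- 2.
  rewrite /total (_ : v ^- 2 = v * v ^- 3); last by field; rewrite gt_eqF.
  by rewrite ler_wpM2r// invr_ge0 exprn_ge0// ltW.
have := ler_wpM2r (mulr_ge0 P0 (ltW Kp)) tv.
rewrite (_ : v ^- 2 * N phi * K ^+ (4 * k) = v ^- 2 * (N phi * K ^+ (4 * k))); last by rewrite mulrA.
have E4 : K ^+ (4 * k) * (total / 4 * N phi) = (total * (N phi * K ^+ (4 * k))) / 4 by ring.
rewrite E4 in b1 b3.
by move: b1 b3; lra.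
Qed.

End level.

(** By log-convexity the gain [v^-2] at length [2k] is shared by [k] factors [walk 2]. Since
    [v^64 = n^4 >= q^k], its 32nd power is at most [q^-1] for each factor. *)
Lemma spectral_gap : N (walk S 2 phi) ^+ 32 * q%:R <= N phi ^+ 32.
Proof.
have q1 := prime_gt1 q_prime.
have n0 : (0 < n)%N by lia.
pose v : R := Num.sqrt (Num.sqrt (Num.sqrt (Num.sqrt n%:R))).
have vn : v ^+ 16 = n%:R.
  by rewrite (_ : (16 = 2 * 2 * 2 * 2)%N)// !exprM !sqr_sqrtr ?sqrtr_ge0.
have v0 : 0 <= v by exact: sqrtr_ge0.
have v1 : 1 <= v.
  rewrite -(@ler_pXn2r _ 16)// ?nnegrE// vn expr1n (ler_nat _ 1)//.
have n4 : (0 < n ^ 4)%N by rewrite expn_gt0 n0.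
have /andP[k1 k2] := trunc_log_bounds q1 n4; set k := trunc_log q (n ^ 4) in k1 k2.
have k0 : (0 < k)%N.
  case: k k2 {k1} => // h; move: h; rewrite ltnNge expn1 (leq_trans qn)//.
  by rewrite -[X in (X <= _)%N]expn1 leq_pexp2l.
have W := walk_level k0 k1 k2 v1 vn.
have [P0|P0] := eqVneq (N phi) 0.
  have := walk_moment (prime_gt0 q_prime) (fun g gs => (let: And5 h _ _ _ _ := S1 gs in h)) 0 Lphi.
  have := walk_moment (prime_gt0 q_prime) (fun g gs => (let: And5 h _ _ _ _ := S1 gs in h)) 1 Lphi.
  rewrite [walk S 0 phi]/= P0 mul0r => h2 h1.
  have z1 : N (walk S 1 phi) = 0 by apply/eqP; rewrite -sqrf_eq0 eq_le h1 sqr_ge0.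
  move: h2; rewrite z1 mul0r => h2.
  have -> : N (walk S 2 phi) = 0 by apply/eqP; rewrite -sqrf_eq0 eq_le h2 sqr_ge0.
  by rewrite !expr0n/= mul0r.
have Pp : 0 < N phi by rewrite lt_def P0 N_ge0.
have := walk_contract (prime_gt0 q_prime) (fun g gs => (let: And5 h _ _ _ _ := S1 gs in h)) k0 Lphi.
move=> /le_trans/(_ (ler_wpM2r (exprn_ge0 k (ltW Pp)) W)).
have vp : 0 < v by lra.
rewrite mulrAC ler_pM2r// => H.
set a := N (walk S 2 phi) in H *; have a0 : 0 <= a by exact: N_ge0.
rewrite -(@ler_pXn2r _ k)// ?nnegrE ?mulr_ge0 ?exprn_ge0 ?N_ge0//.
rewrite exprMn -!exprM mulnC !exprM.
have H32 : (a ^+ k) ^+ 32 <= (v ^- 2 * N phi ^+ k) ^+ 32.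
  by rewrite lerXn2r ?nnegrE ?exprn_ge0// mulr_ge0 ?invr_ge0 ?exprn_ge0 ?N_ge0.
have qv : q%:R ^+ k <= v ^+ 64.
  by rewrite (_ : (64 = 16 * 4)%N)// exprM vn -!natrX ler_nat.
apply: le_trans (ler_pM _ _ H32 qv) _; rewrite ?exprn_ge0//.
rewrite exprMn -!exprM -exprVn -exprM -/(N phi) (_ : (2 * 32 = 64)%N)// mulrAC -exprMn mulVf ?gt_eqF//.
by rewrite expr1n mul1r.
Qed.

End gap.

(** * Almost orthogonality of different scales *)

Section off_diagonal.
Context (R : realType).

Definition shift (h : R) : mat R := (1, h, 0, 1).

Lemma T_shift h f : T (shift h) f = fun x => f (x + h).
Proof.
apply/funext => x; rewrite /T /shift /mob /den /mdet /ma /mb /mc /md /=.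
by rewrite mul0r add0r mulr1 mulr0 subr0 sqrtr1 normr1 !divr1 !mul1r.
Qed.

Lemma conj_shift_near (kap h : R) g : kap <= 1 / 100 -> near1 kap g -> 0 <= h ->
  0 < mdet g /\ near1 (2 * h) (mscale (mdet g)^-1 (mmul (mmul g (shift h)) (madj g))).
Proof.
move=> k1 gn h0; have := near1_det k1 gn; rewrite ler_norml => /andP[D1 D2].
have k0 : 0 <= kap by case: gn => /(le_trans (normr_ge0 _)).
have Dp : 0 < mdet g by lra.
split=> //; have Dn : mdet g != 0 by rewrite gt_eqF.
have iD : `|(mdet g)^-1| <= 10 / 9.
  rewrite normfV ger0_norm; last exact: ltW.
  by rewrite -[10 / 9]invrK lef_pV2 ?posrE ?invr_gt0//; lra.
case: gn => a1 _ c1 _.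
have a2 : `|ma g| <= 101 / 100.
  rewrite (_ : ma g = (ma g - 1) + 1); last by ring.
  by apply: le_trans (ler_normD _ _) _; rewrite normr1; lra.
have c2 : `|mc g| <= 1 / 100 by exact: le_trans k1.
have aa := normM_le a2 a2; have ac := normM_le a2 c2; have cc := normM_le c2 c2.
have fin (w b : R) : `|w| <= b -> b <= 103 / 100 -> `|(mdet g)^-1 * (h * w)| <= 2 * h.
  move=> wb b2; apply: le_trans (normM_le iD (normM_le (_ : `|h| <= h) wb)) _; first by rewrite ger0_norm.
  have : h * b <= h * (103 / 100) by rewrite ler_wpM2l.
  lra.
have E : mscale (mdet g)^-1 (mmul (mmul g (shift h)) (madj g)) =
   (1 + (mdet g)^-1 * (h * - (ma g * mc g)), (mdet g)^-1 * (h * (ma g * ma g)),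
    (mdet g)^-1 * (h * - (mc g * mc g)), 1 + (mdet g)^-1 * (h * (ma g * mc g))).
  move: g Dn {iD a1 c1 a2 c2 aa ac cc fin D1 D2 Dp} => [[[a b] c] d].
  rewrite /mscale /mmul /shift /madj /mdet /ma /mb /mc /md /= => Dn.
  by apply: matP; rewrite /ma /mb /mc /md /=; field.
rewrite E /near1 [ma (_, _, _, _)]/= [mb (_, _, _, _)]/= [mc (_, _, _, _)]/= [md (_, _, _, _)]/=.
by rewrite ![1 + _ - 1]addrAC !subrr !add0r; split;
  [apply: fin; [rewrite normrN; exact: ac|clear; lra]|apply: fin; [exact: aa|clear; lra]|
   apply: fin; [rewrite normrN; exact: cc|clear; lra]|apply: fin; [exact: ac|clear; lra]].
Qed.

(** The fine function is the difference of [eta] and its translate by [h = 1 / n2]. Moved to the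
    other side, the translation becomes [T g] of the conjugate [H] of a translation by [h], which is
    within [2 h] of 1 and moves [phi] little at scale [n1], by [near1_step]. *)
Lemma off_diagonal (kap : R) (g : mat R) n1 (c : nat -> R) n2 (e : int -> R) :
  (0 < n1)%N -> (200 <= n2)%N -> kap <= 1 / 100 -> near1 kap g ->
  (forall z, e z != 0 -> 0 <= z < n2%:Z - 1) ->
  ip (T g (step n1 c)) (step n2 (fun i => e i%:Z - e (i%:Z - 1))) ^+ 2 <=
    2000 * (n1%:R / n2%:R) * N (step n1 c) * N (step n2 (fun i => e i%:Z)).
Proof.
move=> n10 n2h k1 gn e0.
have n20 : (0 < n2)%N by exact: leq_trans n2h.
have n2p : 0 < n2%:R :> R by rewrite ltr0n.
set phi := step n1 c; set eta := step n2 (fun i => e i%:Z); pose h : R := n2%:R^-1.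
have Lp : L2 phi by exact: L2_step.
have Le : L2 eta by exact: L2_step.
have h0 : 0 < h by rewrite invr_gt0.
have [Dg nH] := conj_shift_near k1 gn (ltW h0).
have e1 z : e z != 0 -> 0 <= z < n2%:Z by move=> /e0; lia.
have e2 z : e z - e (z - 1) != 0 -> 0 <= z < n2%:Z.
  move=> nz; have [E|/e1//] := eqVneq (e z) 0.
  have : e (z - 1) != 0 by apply: contraNneq nz => ->; rewrite E subr0.
  by move=> /e0; lia.
have psiE : step n2 (fun i => e i%:Z - e (i%:Z - 1)) = fun x => eta x - T (shift (- h)) eta x.
  apply/funext => x; rewrite T_shift /eta.
  rewrite (step_floor (e := fun z => e z - e (z - 1)))// !step_floor//.
  rewrite (_ : (x - h) * n2%:R = x * n2%:R + (- 1 : int)%:~R).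
    by rewrite floorDrz ?intr_int// intrKfloor.
  by rewrite mulrDl mulNr mulVf ?gt_eqF// rmorphN.
set H := mscale _ _ in nH.
have ds k : mdet (shift k) = 1 by rewrite /mdet /shift /ma /mb /mc /md /= mulr1 mulr0 subr0.
have adjs : madj (shift h) = shift (- h) by rewrite /madj /shift /ma /mb /mc /md /= oppr0.
have dH : 0 < mdet H.
  rewrite /H mdetZ !mdetM mdet_adj ds mulr1; apply: mulr_gt0; last exact: mulr_gt0.
  by rewrite exprn_gt0// invr_gt0.
have HM : mmul H g = mmul g (shift h).
  by rewrite /H mmulZl -!mmulA mmul_adjl !mmulZr mmulm1 mscaleA mulVf ?gt_eqF// mscale1.
have Lg : L2 (T g phi) by exact: L2_T.
have LH : L2 (T H phi) by exact: L2_T.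
have d1 : 0 < mdet (shift h) by rewrite ds.
have d2 : 0 < mdet (shift (- h)) by rewrite ds.
have Ls : L2 (T (shift h) (T g phi)) by exact: L2_T.
have -> : ip (T g phi) (step n2 (fun i => e i%:Z - e (i%:Z - 1))) =
   ip (fun x => T g phi x - T (shift h) (T g phi) x) eta.
  rewrite psiE ipBr// ?ipBl//; last exact: L2_T.
  by rewrite (ip_T_adj d1 Lg Le) adjs.
apply: le_trans (cauchy_schwarz _ Le) _; first exact: L2B.
rewrite -/(N eta) ler_wpM2r ?N_ge0//.
have E : eqf (fun x => T g phi x - T (shift h) (T g phi) x) (fun x => -1 * T g (fun y => T H phi y - phi y) x).
  rewrite TB; have [s1 h1] : eqf (T (shift h) (T g phi)) (T g (T H phi)).
    apply: eqf_trans (T_comp _ d1 Dg) _; rewrite -HM; apply: eqf_sym; exact: T_comp.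
  by exists s1 => x x1; rewrite h1// mulN1r opprB.
have LD : L2 (fun y => T H phi y - phi y) by exact: L2B.
have LTD : L2 (T g (fun y => T H phi y - phi y)) by exact: L2_T.
rewrite -[ip _ _]/(N (fun x => T g phi x - T (shift h) (T g phi) x)) (N_eqf _ _ E); [|exact: L2B|exact: L2Z].
rewrite {1}/N ipZl ?ipZr//; last exact: L2Z.
rewrite mulrA mulrNN !mul1r -/(N _) N_T//.
have k2 : 2 * h <= 1 / 100.
  have : 200 <= n2%:R :> R by rewrite (ler_nat _ 200).
  by rewrite /h => ?; rewrite -[2]invrK -invfM -[1 / 100]invrK lef_pV2 ?posrE ?mulr_gt0 ?invr_gt0//; lra.
apply: le_trans (near1_step _ n10 _ k2 nH) _; first by rewrite mulr_gt0.
rewrite -/phi ler_wpM2r ?N_ge0// /h; lra.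
Qed.

End off_diagonal.

Lemma words2P (S : seq (mat int)) P :
  P \in words S true 2 -> exists g h, [/\ g \in S, h \in S & P = mmul (madj g) h].
Proof.
rewrite -[words S true 2]/[seq mmul e P | e <- letters S true, P <- words S false 1].
move=> /allpairsP[[e P'] [/mapP[g gs E1]]].
rewrite -[words S false 1]/[seq mmul e P | e <- S, P <- [:: mone]].
move=> /allpairsP[[h P''] [hs]]; rewrite inE => /eqP E2 E3 E4; exists g, h; split=> //.
by move: E1 E2 E3 E4 => /= -> -> ->; rewrite mmulm1.
Qed.

Lemma words_near (R : realType) (q D X : nat) (S : seq (mat int)) P :
  prime q -> (0 < X)%N -> (X ^ 2 <= q)%N -> (132 <= D)%N ->
  (forall g, g \in S -> sized q X g) -> (forall g h, g \in S -> h \in S -> close D X g h) ->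
  P \in words S true 2 -> near1 (66 / D%:R : R) (mscale q%:R^-1 (mR R P)).
Proof.
move=> qp X0 Xq D132 S1 S2 /words2P[g [h [gs hs ->]]].
have D66 : (66 < D)%N by exact: leq_trans D132.
have [dg a1 b1 c1 d1] := S1 _ gs; have [e1 e2 e3 e4] := S2 _ _ hs gs.
have b1' : `|- mb g| <= 33 * X%:Z by rewrite normrN.
have c1' : `|- mc g| <= 33 * X%:Z by rewrite normrN.
have CB := comb_bound qp X0 Xq D66.
have f1 := CB _ _ _ _ d1 b1' e1 e3; have f2 := CB _ _ _ _ d1 b1' e2 e4.
have f3 := CB _ _ _ _ c1' a1 e1 e3; have f4 := CB _ _ _ _ c1' a1 e2 e4.
have q0 : 0 < q%:R :> R by rewrite ltr0n prime_gt0.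
have D0 : 0 < D%:R :> R by rewrite ltr0n (leq_trans _ D132).
have fin (w : int) : `|w| * D%:Z <= 66 * X%:Z * X%:Z -> `|q%:R^-1 * w%:~R| <= 66 / D%:R :> R.
  move=> h'; rewrite normrM normfV [`|q%:R|]ger0_norm ?(ltW q0)// mulrC ler_pdivrMr// mulrAC ler_pdivlMr//.
  have h2 : `|w| * D%:Z <= 66 * q%:Z by clear -h' Xq; lia.
  by move: h2; rewrite -(ler_int R) rmorphM/= intr_norm rmorphM.
rewrite adj_mulE dg /mscale /mR /near1 [ma (_, _, _, _)]/= [mb (_, _, _, _)]/= [mc (_, _, _, _)]/= [md (_, _, _, _)]/=.
have qv (w : int) : q%:R^-1 * (q%:Z + w)%:~R - 1 = q%:R^-1 * w%:~R :> R.
  by rewrite rmorphD mulrDr mulVf ?gt_eqF// addrAC subrr add0r.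
by split; [rewrite qv; exact: fin|exact: fin|exact: fin|rewrite qv; exact: fin].
Qed.

(** * Haar decomposition of step functions *)

Section haar.
Context (R : realType).
Implicit Types (c : nat -> R).

Definition half c i := (c (2 * i)%N + c (2 * i).+1) / 2.
Definition dif c i := (c (2 * i)%N - c (2 * i).+1) / 2.
(** A discrete primitive of the Haar part, whose values on a pair of cells are [dif] and [- dif]: it
    equals [dif] on the left cell and vanishes on the right one. Its energy is therefore comparable
    to the norm, as the spectral gap requires. *)
Definition haar_prim m c (z : int) : R :=
  if z is Posz k then if (k < 2 * m)%N && ~~ odd k then dif c k./2 else 0 else 0.
Definition haar m c := step (2 * m) (fun i => haar_prim m c i%:Z - haar_prim m c (i%:Z - 1)).

Lemma haar_prim_supp m c z : haar_prim m c z != 0 -> 0 <= z < (2 * m)%N%:Z - 1.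
Proof.
case: z => k /=; last by rewrite eqxx.
case: ifP => [/andP[k1 k2] _|]; last by rewrite eqxx.
have := odd_double_half k; rewrite (negbTE k2) add0n => kE.
by lia.
Qed.

Lemma haar_prim_even m c i : (i < m)%N -> haar_prim m c (2 * i)%N%:Z = dif c i.
Proof. by move=> im; rewrite /= ltn_pmul2l// im mul2n odd_double doubleK. Qed.

Lemma haar_prim_odd m c i : haar_prim m c (2 * i).+1%:Z = 0.
Proof. by rewrite /= mul2n odd_double andbF. Qed.

Lemma haar_even m c i : (i < m)%N ->
  haar_prim m c (2 * i)%N%:Z - haar_prim m c ((2 * i)%N%:Z - 1) = dif c i.
Proof.
move=> im; rewrite haar_prim_even// (_ : haar_prim m c _ = 0) ?subr0//.
case: i {im} => [|i] //; rewrite (_ : (2 * i.+1)%N%:Z - 1 = (2 * i).+1%:Z); last by lia.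
exact: haar_prim_odd.
Qed.

Lemma haar_odd m c i : (i < m)%N ->
  haar_prim m c (2 * i).+1%:Z - haar_prim m c ((2 * i).+1%:Z - 1) = - dif c i.
Proof.
move=> im; rewrite haar_prim_odd sub0r (_ : (2 * i).+1%:Z - 1 = (2 * i)%N%:Z); last by lia.
by rewrite haar_prim_even.
Qed.

Lemma sum_pairs (F : nat -> R) m : \sum_(i < (2 * m)%N) F i = \sum_(i < m) (F (2 * i)%N + F (2 * i).+1).
Proof.
elim: m => [|m IH]; first by rewrite muln0 !big_ord0.
rewrite (_ : (2 * m.+1 = (2 * m).+2)%N); last by lia.
by rewrite !big_ord_recr/= IH addrA.
Qed.

Lemma step_half m c x : (0 < m)%N -> step (2 * m) c x = step m (half c) x + haar m c x.
Proof.
move=> m0; have m20 : (0 < 2 * m)%N by lia.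
case: (boolP ((0 <= x) && (x < 1))) => [/andP[x0 x1]|xo]; last first.
  by rewrite /haar !step_out// addr0.
have [i im ix] := cell_ex m20 x0 x1.
have i2 : (i./2 < m)%N.
  by have := odd_double_half i; clear -im; lia.
have cx : incell m i./2 x.
  have mp : 0 < m%:R :> R by rewrite ltr0n.
  move: ix; rewrite /incell !ler_pdivrMr ?ltr_pdivlMr ?ltr0n// natrM => /andP[h1 h2].
  have o1 : (2 * i./2)%:R <= i%:R :> R by rewrite ler_nat; have := odd_double_half i; clear; lia.
  have o2 : i.+1%:R <= (2 * (i./2).+1)%:R :> R by rewrite ler_nat; have := odd_double_half i; clear; lia.
  by rewrite !natrM in o1 o2; apply/andP; split; lra.
rewrite /haar (step_cell _ im ix) (step_cell _ i2 cx) (step_cell _ im ix).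
have := odd_double_half i; case: (odd i) => iE.
  rewrite (_ : i = (2 * i./2).+1); last by rewrite -[LHS]iE mul2n.
  by rewrite haar_odd// /half /dif; move: i./2 => k; rewrite !mul2n /= uphalf_double; lra.
rewrite (_ : i = (2 * i./2)%N); last by rewrite -[LHS]iE mul2n.
by rewrite haar_even// /half /dif; move: i./2 => k; rewrite !mul2n doubleK; lra.
Qed.

Lemma N_haar m c : (0 < m)%N -> N (haar m c) = m%:R^-1 * \sum_(i < m) dif c i ^+ 2.
Proof.
move=> m0; rewrite /haar N_step (sum_pairs (fun i => (haar_prim m c i%:Z - haar_prim m c (i%:Z - 1)) ^+ 2)) natrM invfM -mulrA mulrCA; congr (_ * _).
rewrite big_distrr/=; apply: eq_bigr => i _; rewrite haar_even// haar_odd//; lra.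
Qed.

Lemma N_step_half m c : (0 < m)%N -> N (step (2 * m) c) = N (step m (half c)) + N (haar m c).
Proof.
move=> m0; rewrite N_haar// !N_step (sum_pairs (fun i => c i ^+ 2)) natrM invfM -mulrA mulrCA -mulrDr -big_split/=.
congr (_ * _); rewrite big_distrr/=; apply: eq_bigr => i _; rewrite /half /dif; lra.
Qed.

Lemma N_haar_prim m c : (0 < m)%N ->
  N (step (2 * m) (fun i => haar_prim m c i%:Z)) = N (haar m c) / 2.
Proof.
move=> m0; rewrite N_haar// N_step (sum_pairs (fun i => haar_prim m c i%:Z ^+ 2)) natrM invfM -mulrA mulrCA -mulrA; congr (_ * _).
rewrite mulrC; congr (_ / _); apply: eq_bigr => i _.
by rewrite haar_prim_even// haar_prim_odd expr0n addr0.
Qed.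

Lemma haar_energy m c : (0 < m)%N ->
  energy (2 * m) (haar_prim m c) <= (2 * m)%:R * N (haar m c).
Proof.
move=> m0; have p : 0 < (2 * m)%:R :> R by rewrite ltr0n; lia.
have E : energy (2 * m) (haar_prim m c) = (2 * m)%:R * (N (haar m c) / 2).
  by rewrite -N_haar_prim// N_step mulrA divff ?gt_eqF// mul1r.
rewrite E ler_pM2l//; have := N_ge0 (haar m c); lra.
Qed.

End haar.

(** * Summing the Haar levels *)

Section quadratic_form.
Context (R : realType).
Variables (q : nat) (S : seq (mat int)) (kap rho : R).
Hypothesis q0 : (0 < q)%N.
Hypothesis q200 : (200 <= q)%N.
Hypothesis S0 : (0 < size S)%N.
Hypothesis Sdet : forall g, g \in S -> mdet g = q%:Z.
Hypothesis kap1 : kap <= 1 / 100.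
Hypothesis Snear : forall P, P \in words S true 2 -> near1 kap (mscale q%:R^-1 (mR R P)).
Hypothesis rho0 : 0 < rho.
Hypothesis qrho : 1 <= rho ^+ 64 * q%:R.
Hypothesis gap : forall n (c e : int -> R), (q <= n)%N -> (forall z, e z != 0 -> 0 <= z < n%:Z - 1) ->
  (forall z, c z = e z - e (z - 1)) ->
  energy n e <= n%:R * N (step n (fun i => c i%:Z)) ->
  N (walk S 2 (step n (fun i => c i%:Z))) ^+ 32 * q%:R <= N (step n (fun i => c i%:Z)) ^+ 32.

Lemma haar_gap m c : (q <= 2 * m)%N -> N (walk S 2 (haar m c)) <= rho ^+ 2 * N (haar m c).
Proof.
move=> qm; have m0 : (0 < m)%N by lia.
have h := gap qm (@haar_prim_supp R m c) (fun z => erefl) (haar_energy c m0).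
rewrite -(@ler_pXn2r _ 32)// ?nnegrE ?N_ge0 ?mulr_ge0 ?N_ge0 ?exprn_ge0 ?(ltW rho0)//.
have qp : 0 < q%:R :> R by rewrite ltr0n.
rewrite -(ler_pM2r qp) exprMn -exprM (le_trans h)// mulrAC ler_peMl ?exprn_ge0 ?N_ge0//.
Qed.

(** Dominates the square root of [1000 / 2^k] given by [off_diagonal], since [45^2 >= 1000] and
    [(3/4)^2 >= 1/2]; a rational base avoids the square root of 2. *)
Let Mk (k : nat) : R := 45 * (3 / 4) ^+ k.

Lemma sqrt_bound (a b x y : R) : 0 <= a -> 0 <= x -> 0 <= y -> b ^+ 2 <= a ^+ 2 * x * y ->
  `|b| <= a * (Num.sqrt x * Num.sqrt y).
Proof.
move=> a0 x0 y0 h; rewrite -(@ler_pXn2r _ 2)// ?nnegrE ?mulr_ge0 ?sqrtr_ge0//.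
by rewrite real_normK ?num_real// !exprMn !sqr_sqrtr// mulrA.
Qed.

Lemma haar_far m1 c1 k c2 : (q <= 2 * m1)%N ->
  `|ip (walk S 2 (haar m1 c1)) (haar (m1 * 2 ^ k) c2)| <=
   Mk k * (Num.sqrt (N (haar m1 c1)) * Num.sqrt (N (haar (m1 * 2 ^ k) c2))).
Proof.
move=> qm; have m0 : (0 < m1)%N by lia.
have m20 : (0 < m1 * 2 ^ k)%N by rewrite muln_gt0 m0 expn_gt0.
have k0 : 0 <= Mk k by rewrite /Mk mulr_ge0// exprn_ge0.
have L1 : L2 (haar m1 c1) by exact: L2_step.
have L2' : L2 (haar (m1 * 2 ^ k) c2) by exact: L2_step.
have LT P : L2 (T (mR R P) (haar m1 c1)) by exact: L2_Tany.
have LS : L2 (fun x => \sum_(P <- words S true 2) T (mR R P) (haar m1 c1) x) by exact: L2sum.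
have E := walk_words q0 Sdet 2 (proj1 L1).
rewrite (ip_eqf (L2_walk S 2 L1) (L2Z _ LS) L2' L2' E (eqf_refl _)) ipZl// ip_suml//.
have Kp : 0 < (size S)%:R ^+ 2 :> R by rewrite exprn_gt0// ltr0n.
rewrite normrM normfV [`|(size S)%:R ^+ 2|]ger0_norm ?(ltW Kp)// mulrC ler_pdivrMr//.
apply: le_trans (ler_norm_sum _ _ _) _.
set B := Mk k * _.
have -> : B * (size S)%:R ^+ 2 = \sum_(P <- words S true 2) B.
  by rewrite big_const_seq iter_addr_0 count_predT size_words -natrX mulr_natr.
rewrite big_seq [leRHS]big_seq; apply: ler_sum => P Pw.
apply: sqrt_bound => //; try exact: N_ge0.
have qi : 0 < q%:R^-1 :> R by rewrite invr_gt0 ltr0n.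
rewrite -(T_scale _ _ qi).
have h : (200 <= 2 * (m1 * 2 ^ k))%N.
  by rewrite (leq_trans q200)// (leq_trans qm)// leq_mul2l/= leq_pmulr// expn_gt0.
apply: le_trans (off_diagonal _ _ h kap1 (Snear Pw) (@haar_prim_supp R _ c2)) _; first by lia.
rewrite N_haar_prim// -/(haar m1 c1); set x := N (haar m1 c1); set y := N (haar _ c2).
rewrite (_ : _ * x * (y / 2) = (2000 * ((2 * m1)%:R / (2 * (m1 * 2 ^ k))%:R) / 2) * (x * y)); last by ring.
rewrite -[leRHS]mulrA; apply: ler_wpM2r; first by rewrite mulr_ge0 ?N_ge0.
rewrite !natrM natrX /Mk exprMn -exprM mulnC exprM.
have m1p : m1%:R != 0 :> R by rewrite pnatr_eq0 -lt0n.
have p2 : 2 ^+ k != 0 :> R by rewrite expf_neq0// pnatr_eq0.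
have -> : 2000 * (2 * m1%:R / (2 * (m1%:R * 2 ^+ k))) / 2 = 1000 * (1 / 2) ^+ k :> R.
  by rewrite expr_div_n expr1n; field; rewrite m1p p2.
have hk : (1 / 2) ^+ k <= ((3 / 4) ^+ 2) ^+ k :> R by rewrite lerXn2r ?nnegrE//; lra.
have pk : 0 <= (1 / 2) ^+ k :> R by rewrite exprn_ge0.
lra.
Qed.

Lemma walk2_adj (f h : R -> R) : L2 f -> L2 h -> ip (walk S 2 f) h = ip f (walk S 2 h).
Proof.
move=> Lf Lh; have La b g : L2 g -> L2 (avg S b g) by exact: L2_avg.
by rewrite /= (ip_avg q0 Sdet)//; [rewrite (ip_avg q0 Sdet)//; exact: La|exact: La].
Qed.

Lemma N_avg_walk (f : R -> R) : L2 f -> N (avg S true f) = ip (walk S 2 f) f.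
Proof.
move=> Lf; have La b g : L2 g -> L2 (avg S b g) by exact: L2_avg.
by rewrite ipC /N /= (ip_avg q0 Sdet)//; exact: La.
Qed.

Lemma avg_sum b (I : Type) (r : seq I) (F : I -> R -> R) :
  avg S b (fun x => \sum_(i <- r) F i x) = fun x => \sum_(i <- r) avg S b (F i) x.
Proof.
apply/funext => x; rewrite /avg -big_distrr/= exchange_big/=; congr (_ * _).
by apply: eq_bigr => e _; rewrite Tsum.
Qed.

Variables (b J : nat) (C : nat -> nat -> R).
Hypothesis qb : (q <= 2 * b)%N.
Hypothesis rho1 : rho <= 1 / (100 * 100).
Let Del (t : nat) := haar (b * 2 ^ t) (C t).
Let s t := Num.sqrt (N (Del t)).
Let LD t : L2 (Del t). Proof. exact: L2_step. Qed.
Let s0 t : 0 <= s t. Proof. exact: sqrtr_ge0. Qed.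

(** Levels less than 40 apart use the spectral gap, the others the decay between scales. The
    threshold 40 makes [40 rho] plus the geometric tail at most [1 / 100]. *)
Let M k := if (k < 40)%N then rho else Mk k.
Let M0 k : 0 <= M k.
Proof. by rewrite /M; case: ifP => _; [exact: ltW|rewrite /Mk mulr_ge0// exprn_ge0]. Qed.

Let qbt t : (q <= 2 * (b * 2 ^ t))%N.
Proof. by rewrite (leq_trans qb)// leq_mul2l/= leq_pmulr// expn_gt0. Qed.

Let pair_le i j : (i <= j)%N -> `|ip (walk S 2 (Del i)) (Del j)| <= M (j - i) * (s i * s j).
Proof.
move=> ij; rewrite /M; case: ifP => _.
  apply: sqrt_bound; rewrite ?N_ge0 ?(ltW rho0)//.
  apply: le_trans (cauchy_schwarz _ _) _; [exact: L2_walk|exact: LD|].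
  by rewrite -!/(N _) ler_wpM2r ?N_ge0// haar_gap.
have := haar_far (C i) (j - i) (C j) (qbt i).
by rewrite -mulnA -expnD subnKC.
Qed.

Let pair_bound i j : ip (walk S 2 (Del i)) (Del j) <= M ((i - j) + (j - i)) * (s i * s j).
Proof.
apply: le_trans (ler_norm _) _; have [ij|ji] := leqP i j.
  by rewrite (eqP ij) add0n; exact: pair_le.
rewrite walk2_adj// ipC [s i * _]mulrC.
by have := pair_le (ltnW ji); rewrite (_ : (j - i = 0)%N) ?addn0//; apply/eqP; exact: ltnW.
Qed.

Let M_sum n : \sum_(k < n) M k <= 1 / 100.
Proof.
have p40 : (3 / 4) ^+ 40 <= 1 / (81 * 81 * 9) :> R.
  have h4 : (3 / 4) ^+ 4 <= 1 / 3 :> R by rewrite expr_div_n ler_pdivrMr ?exprn_gt0//; lra.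
  rewrite (_ : 40 = 4 * 10)%N// exprM.
  apply: le_trans (_ : (1 / 3) ^+ 10 <= _); first by rewrite lerXn2r ?nnegrE// ?exprn_ge0//; lra.
  by rewrite (_ : (1 / 3) ^+ 10 = 1 / (81 * 81 * 9))//; field.
have step n' : \sum_(k < 40 + n') M k <= 40 * rho + 180 * (3 / 4) ^+ 40 - 180 * (3 / 4) ^+ (40 + n').
  elim: n' => [|n' IH].
    rewrite addn0 addrK (eq_bigr (fun=> rho)); last by move=> k _; rewrite /M ltn_ord.
    by rewrite sumr_const card_ord mulr_natl.
  rewrite addnS big_ord_recr/= [X in _ + X](_ : _ = 45 * (3 / 4) ^+ (40 + n')); last by rewrite /M ltnNge leq_addr.
  rewrite (exprS _ (40 + n')); lra.
apply: le_trans (_ : \sum_(k < 40 + n) M k <= _).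
  rewrite -!(big_mkord xpredT M) (@big_cat_nat _ _ _ n 0 (40 + n))//=; last by rewrite leq_addl.
  by rewrite lerDl sumr_ge0.
apply: le_trans (step n) _.
have : 0 <= (3 / 4) ^+ (40 + n) :> R by rewrite exprn_ge0.
by move: p40 rho1; lra.
Qed.

Let row_sum i : (i < J)%N -> \sum_(j < J) M ((i - j) + (j - i)) <= 1 / 50.
Proof.
move=> iJ; rewrite -(big_mkord xpredT (fun j => M ((i - j) + (j - i)))).
rewrite (@big_cat_nat _ _ _ i 0 J)//=; last exact: ltnW.
have h1 : \sum_(0 <= j < i) M ((i - j) + (j - i)) <= 1 / 100.
  apply: le_trans (M_sum i.+1); rewrite big_nat_rev/= add0n -(big_mkord xpredT M) big_nat_recl//.
  apply: le_trans (_ : \sum_(0 <= j < i) M j.+1 <= _); last by rewrite lerDr.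
  rewrite big_nat_cond [leRHS]big_nat_cond; apply: ler_sum => j /andP[/andP[_ ji] _].
  by rewrite (_ : i - (i - j.+1) + (i - j.+1 - i) = j.+1)%N//; lia.
have h2 : \sum_(i <= j < J) M ((i - j) + (j - i)) <= 1 / 100.
  apply: le_trans (M_sum (J - i)).
  rewrite -{1}[i]add0n big_addn -(big_mkord xpredT M).
  apply: ler_sum => j _; by rewrite (_ : i - (j + i) + (j + i - i) = j)%N//; lia.
lra.
Qed.

(** Schur's test: the matrix of bounds is symmetric with row sums at most [1 / 50], and each product
    of norms is replaced by the mean of their squares. *)
Lemma haar_form : N (avg S true (fun x => \sum_(t < J) Del t x)) <= 1 / 50 * \sum_(t < J) N (Del t).
Proof.
have LU : L2 (fun x => \sum_(t < J) Del t x) by exact: L2sum.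
rewrite N_avg_walk// [walk S 2 _]/= !avg_sum -/(walk S 2 _).
have LW t : L2 (avg S false (avg S true (Del t))) by apply: L2_avg; exact: L2_avg.
rewrite ip_suml//.
apply: le_trans (_ : \sum_(i < J) \sum_(j < J) M ((i - j) + (j - i)) * ((N (Del i) + N (Del j)) / 2) <= _).
  apply: ler_sum => i _; rewrite ip_sumr//; apply: ler_sum => j _.
  apply: le_trans (pair_bound i j) _; rewrite ler_wpM2l//.
  have sE t : N (Del t) = s t ^+ 2 by rewrite sqr_sqrtr ?N_ge0.
  rewrite !sE; have := sqr_ge0 (s i - s j); nra.
have sym i j : M ((i - j) + (j - i)) = M ((j - i) + (i - j)) by rewrite addnC.
have E : \sum_(i < J) \sum_(j < J) M ((i - j) + (j - i)) * ((N (Del i) + N (Del j)) / 2) =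
   \sum_(i < J) (\sum_(j < J) M ((i - j) + (j - i))) * N (Del i).
  have E1 : \sum_(i < J) \sum_(j < J) M ((i - j) + (j - i)) * N (Del j) =
     \sum_(i < J) \sum_(j < J) M ((i - j) + (j - i)) * N (Del i).
    by rewrite exchange_big/=; apply: eq_bigr => i _; apply: eq_bigr => j _; rewrite sym.
  transitivity (\sum_(i < J) \sum_(j < J) M ((i - j) + (j - i)) * N (Del i) / 2 +
     \sum_(i < J) \sum_(j < J) M ((i - j) + (j - i)) * N (Del j) / 2).
    by rewrite -big_split/=; apply: eq_bigr => i _; rewrite -big_split/=; apply: eq_bigr => j _; lra.
  under eq_bigr do rewrite -big_distrl/=.
  under [X in _ + X]eq_bigr do rewrite -big_distrl/=.
  rewrite -!big_distrl/= E1 -splitr; apply: eq_bigr => i _; by rewrite -big_distrl.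
rewrite E big_distrr/=; apply: ler_sum => i _.
by rewrite ler_wpM2r ?N_ge0// row_sum.
Qed.

End quadratic_form.

Lemma sum_blocks (V : nmodType) (F : nat -> V) b w :
  \sum_(i < (b * w)%N) F i = \sum_(p < b) \sum_(l < w) F (p * w + l)%N.
Proof.
elim: b => [|b IH]; first by rewrite mul0n !big_ord0.
rewrite big_ord_recr/= -IH mulSn addnC -!(big_mkord xpredT F).
rewrite (@big_cat_nat _ _ _ (b * w) 0 (b * w + w))//=; last exact: leq_addr.
congr (_ + _); rewrite -{1}[(b * w)%N]add0n big_addn addnC addnK -(big_mkord xpredT (fun l => F (b * w + l)%N)).
by apply: eq_bigr => l _; rewrite addnC.
Qed.

(** * Expansion of sets *)

Section set_expansion.
Context (R : realType).
Variables (q : nat) (S : seq (mat int)) (kap rho : R).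
Hypothesis q200 : (200 <= q)%N.
Hypothesis S0 : (0 < size S)%N.
Hypothesis Sdet : forall g, g \in S -> mdet g = q%:Z.
Hypothesis kap1 : kap <= 1 / 640.
Hypothesis Snear : forall P, P \in words S true 2 -> near1 kap (mscale q%:R^-1 (mR R P)).
Hypothesis rho0 : 0 < rho.
Hypothesis rho1 : rho <= 1 / (100 * 100).
Hypothesis qrho : 1 <= rho ^+ 64 * q%:R.
Hypothesis gap : forall n (c e : int -> R), (q <= n)%N -> (forall z, e z != 0 -> 0 <= z < n%:Z - 1) ->
  (forall z, c z = e z - e (z - 1)) ->
  energy n e <= n%:R * N (step n (fun i => c i%:Z)) ->
  N (walk S 2 (step n (fun i => c i%:Z))) ^+ 32 * q%:R <= N (step n (fun i => c i%:Z)) ^+ 32.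

Let q0 : (0 < q)%N. Proof. exact: leq_trans q200. Qed.
Local Notation K := ((size S)%:R : R).

Lemma N_scale (k : R) (f : R -> R) : L2 f -> N (fun x => k * f x) = k ^+ 2 * N f.
Proof. by move=> Lf; rewrite /N ipZl// ?ipZr// ?mulrA -?expr2//; exact: L2Z. Qed.

Lemma N_avg_le b (f : R -> R) : L2 f -> N (avg S b f) <= N f.
Proof.
move=> Lf; have Lt e : L2 (T (mR R e) f) by exact: L2_Tany.
have Kp : 0 < K by rewrite ltr0n.
rewrite /avg N_scale; last exact: L2sum.
rewrite exprVn mulrC ler_pdivrMr ?exprn_gt0// mulrC.
apply: le_trans (N_sum_le_max (B := N f) _ _) _ => //.
  by move=> e eb; rewrite N_T//; exact: (letters_det_gt0 R q0 Sdet eb).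
by rewrite size_letters.
Qed.

(** The weights keep the coarse part almost unamplified at the expense of the Haar part, which
    [haar_form] has made small: [5 / 50 = 1 / 10]. *)
Lemma N_add_weighted (f g : R -> R) : L2 f -> L2 g ->
  N (fun x => f x + g x) <= 5 / 4 * N f + 5 * N g.
Proof.
move=> Lf Lg; rewrite N_add//.
have := N_ge0 (fun x => f x - 4 * g x); rewrite N_sub//; last exact: L2Z.
by rewrite ipZr// N_scale//; lra.
Qed.

Lemma ip_le_weighted (f g : R -> R) : L2 f -> L2 g -> ip f g <= N f / 200 + 50 * N g.
Proof.
move=> Lf Lg; have := N_ge0 (fun x => f x - 100 * g x); rewrite N_sub//; last exact: L2Z.
by rewrite ipZr// N_scale//; lra.
Qed.

Lemma iter_half J (c : nat -> R) p :
  iter J (@half R) c p = (\sum_(l < (2 ^ J)%N) c (p * 2 ^ J + l)%N) / (2 ^ J)%:R.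
Proof.
elim: J p => [|J IH] p; first by rewrite -(big_mkord xpredT (fun l => c (p * 2 ^ 0 + l)%N)) expn0 big_nat1 muln1 addn0 divr1.
rewrite iterS /half !IH expnS (sum_blocks (fun l => c (p * (2 * 2 ^ J) + l)%N) 2 (2 ^ J)).
rewrite !big_ord_recr/= big_ord0 add0r natrM invfM mulrA -mulrDl mulrAC; congr (_ / _ / _).
by congr (_ + _); apply: eq_bigr => l _; congr c; lia.
Qed.

Lemma near1_adj (k : R) g : near1 k g -> near1 k (madj g).
Proof. by move=> [? ? ? ?]; rewrite /near1 /madj /ma /mb /mc /md /= !normrN. Qed.

Variables (B J : nat) (a nb : pred nat).
Hypothesis B0 : (0 < B)%N.
Local Notation b := (64 * B)%N.
Local Notation w := (2 ^ J)%N.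
Local Notation n := (64 * B * 2 ^ J)%N.
Hypothesis qb : (q <= 2 * b)%N.
Hypothesis nb_blocks : forall i p, (i < n)%N -> a i -> (p < b)%N -> nb (p * w + i %% w)%N.
Hypothesis nb_mob : forall P, P \in words S true 2 -> forall i i' x, (i < n)%N -> (i' < n)%N ->
  incell n i' x -> incell n i (mob (mR R P) x) -> a i -> nb i'.

Let sA := \sum_(i < n) (a i)%:R : R.
Let sB := \sum_(i < n) (nb i)%:R : R.
Let n0 : (0 < n)%N. Proof. by rewrite !muln_gt0 B0 expn_gt0. Qed.
Let np : 0 < n%:R :> R. Proof. by rewrite ltr0n. Qed.
Let w0 : (0 < w)%N. Proof. by rewrite expn_gt0. Qed.
Let bp : 0 < b%:R :> R. Proof. by rewrite ltr0n muln_gt0 B0. Qed.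
Let wp : 0 < w%:R :> R. Proof. by rewrite ltr0n. Qed.
Let c (i : nat) : R := (a i)%:R.
Let f := step n c.
Let g := step n (fun i => (nb i)%:R : R).
Let one := step n (fun=> 1 : R).
(** Indicator of [[1/64, 63/64)]. The Moebius maps move points by at most [10 kap <= 1/64], so from
    here no mass leaves the unit interval. *)
Let mid := step n (fun i => ((B * w <= i)%N && (i < 63 * B * w)%N)%:R : R).
Let Lf : L2 f. Proof. exact: L2_step. Qed.
Let Lg : L2 g. Proof. exact: L2_step. Qed.

Let block p : R := \sum_(l < w) c (p * w + l)%N.

(** The translations put a copy of each block of [a] into all [b] blocks of [nb]. *)
Let block_le p : (p < b)%N -> b%:R * block p <= sB.
Proof.
move=> pb; rewrite /sB (sum_blocks (fun i => (nb i)%:R : R)).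
have -> : b%:R * block p = \sum_(p' < b) block p by rewrite sumr_const card_ord mulr_natl.
apply: ler_sum => p' _; apply: ler_sum => l _; rewrite /c ler_nat.
case ai : (a (p * w + l)%N) => //.
have := @nb_blocks (p * w + l)%N p' _ ai (ltn_ord p').
rewrite modnMDl modn_small// => ->//.
by rewrite (leq_trans (_ : _ < p.+1 * w)%N)// ?leq_mul2r ?pb ?orbT// mulSn addnC ltn_add2r.
Qed.

Let sA_blocks : sA = \sum_(p < b) block p. Proof. exact: sum_blocks. Qed.

Let ab i : (i < n)%N -> a i -> nb i.
Proof.
move=> i_n ai; have := nb_blocks i_n ai (_ : i %/ w < b)%N.
by rewrite -divn_eq; apply; rewrite ltn_divLR.
Qed.

Let Nf : N f = sA / n%:R.
Proof.
rewrite N_step mulrC; congr (_ / _); apply: eq_bigr => i _.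
by rewrite /c; case: (a i); rewrite ?expr1n ?expr0n.
Qed.

Let beta := sB / n%:R.

Let coarse := step b (iter J (@half R) c).

(** By [block_le] no block mean exceeds the density [beta] of the neighbourhood, so the coarse part
    has squared norm at most [beta] times the mean of [f]. *)
Let N_coarse : N coarse <= beta * (sA / n%:R).
Proof.
rewrite N_step; have nE : n%:R = b%:R * w%:R :> R by rewrite natrM.
have -> : beta * (sA / n%:R) = b%:R^-1 * \sum_(p < b) beta * (block p / w%:R).
  rewrite -big_distrr/= -big_distrl/= -sA_blocks nE; move: (gt_eqF bp) (gt_eqF wp).
  by move: b%:R w%:R => x y x0 y0; field; rewrite x0 y0.
rewrite ler_pM2l ?invr_gt0//; apply: ler_sum => p _; rewrite iter_half -/(block p) expr2.
have bl0 : 0 <= block p by apply: sumr_ge0.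
apply: ler_wpM2r; first by rewrite divr_ge0.
rewrite /beta nE invfM mulrA ler_pM2r ?invr_gt0// ler_pdivlMr// mulrC.
exact: block_le.
Qed.

Let cs t := iter (J - t) (@half R) c.

Let decomp J' : (J' <= J)%N -> (forall x, step (b * 2 ^ J') (cs J') x =
     coarse x + \sum_(t < J') haar (b * 2 ^ t) (cs t.+1) x) /\
   N (step (b * 2 ^ J') (cs J')) = N coarse + \sum_(t < J') N (haar (b * 2 ^ t) (cs t.+1)).
Proof.
elim: J' => [|J' IH] JJ.
  by rewrite expn0 muln1 /cs subn0 big_ord0 addr0; split=> // x; rewrite big_ord0 addr0.
have [IH1 IH2] := IH (ltnW JJ).
have bt : (0 < b * 2 ^ J')%N by rewrite !muln_gt0 B0 expn_gt0.
have E : cs J' = half (cs J'.+1) by rewrite /cs -iterS subnSK.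
rewrite expnS (mulnCA b 2); split=> [x|].
  by rewrite step_half// -E IH1 big_ord_recr/= addrA.
by rewrite N_step_half// -E IH2 big_ord_recr/= addrA.
Qed.

Let N_avg_f : N (avg S true f) <= 5 / 4 * (beta * (sA / n%:R)) + sA / n%:R / 10.
Proof.
have [E1 E2] := decomp (leqnn J).
have csJ : cs J = c by rewrite /cs subnn.
rewrite csJ -/f in E1 E2.
pose u x := \sum_(t < J) haar (b * 2 ^ t) (cs t.+1) x.
have Lc : L2 coarse by exact: L2_step.
have Lu : L2 u by apply: L2sum => t; exact: L2_step.
have fE : f = fun x => coarse x + u x by apply/funext => x; exact: E1.
have k100 : kap <= 1 / 100 by move: kap1; lra.
have HU := haar_form q0 q200 S0 Sdet k100 Snear rho0 qrho gap J (fun t => cs t.+1) qb rho1.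
have NU : \sum_(t < J) N (haar (b * 2 ^ t) (cs t.+1)) <= sA / n%:R.
  by rewrite -Nf E2 lerDr N_ge0.
have avgE : avg S true f = fun x => avg S true coarse x + avg S true u x.
  rewrite {1}fE; apply/funext => x; rewrite /avg -mulrDr -big_split/=; congr (_ * _).
  by apply: eq_bigr => e _; rewrite TD.
rewrite avgE; apply: le_trans (N_add_weighted (L2_avg _ _ Lc) (L2_avg _ _ Lu)) _.
have := N_avg_le true Lc; have := N_coarse; move: HU NU; rewrite -/u; lra.
Qed.

Let Nw : N (walk S 2 f) <= sA / n%:R.
Proof. by rewrite -Nf; apply: le_trans (N_avg_le _ (L2_avg _ _ Lf)) _; exact: N_avg_le. Qed.

Let N_gf : N (fun x => g x - f x) = beta - sA / n%:R.
Proof.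
have -> : (fun x => g x - f x) = step n (fun i => (nb i)%:R - c i).
  by apply/funext => x; rewrite /g /f /step /itvs -sumrB; apply: eq_bigr => i _; rewrite mulrBl.
rewrite N_step /beta -mulrBl mulrC; congr (_ / _); rewrite /sA /sB -sumrB.
apply: eq_bigr => i _; rewrite /c; case ai : (a i); last by rewrite !subr0; case: (nb i); rewrite ?expr1n ?expr0n.
by rewrite (ab (ltn_ord i) ai) subrr expr0n.
Qed.

Let upper : ip (walk S 2 f) g <= 5 / 4 * (beta * (sA / n%:R)) + 11 / 100 * (sA / n%:R) +
   (50 * (beta - sA / n%:R) - sA / n%:R / 200).
Proof.
have Lw : L2 (walk S 2 f) by exact: L2_walk.
have -> : ip (walk S 2 f) g = ip (walk S 2 f) f + ip (walk S 2 f) (fun x => g x - f x).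
  by rewrite ipBr//; ring.
have := ip_le_weighted Lw (L2B Lg Lf); rewrite N_gf.
have := N_avg_walk q0 Sdet Lf => <-.
have := N_avg_f; have := Nw; lra.
Qed.

Let step_ge0 (e : nat -> R) x : (forall i, 0 <= e i) -> 0 <= step n e x.
Proof. exact: itvs_ge0. Qed.

Let one_in x : 0 <= x -> x < 1 -> one x = 1.
Proof. by move=> x0 x1; have [i i_n ix] := cell_ex n0 x0 x1; rewrite /one (step_cell _ i_n ix). Qed.

Let supported P x : P \in words S true 2 -> T (mR R P) f x * g x = T (mR R P) f x * one x.
Proof.
move=> Pw; case: (boolP ((0 <= x) && (x < 1))) => [/andP[x0 x1]|xo]; last first.
  by rewrite /g /one !step_out.
have [i' i'n ix'] := cell_ex n0 x0 x1.
rewrite one_in// /g (step_cell _ i'n ix'); rewrite /T.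
case: (boolP ((0 <= mob (mR R P) x) && (mob (mR R P) x < 1))) => [/andP[y0 y1]|yo]; last first.
  by rewrite /f step_out// mulr0 !mul0r.
have [i i_n ix] := cell_ex n0 y0 y1.
rewrite /f (step_cell _ i_n ix) /c; case ai : (a i); last by rewrite mulr0 !mul0r.
by rewrite (nb_mob Pw i_n i'n ix' ix ai).
Qed.

Let mid_le (h : mat R) x : near1 kap h -> (1 - 6 * kap) * mid x <= T h one x.
Proof.
move=> hn; have T0 : 0 <= T h one x.
  by rewrite /T divr_ge0// mulr_ge0 ?sqrtr_ge0// step_ge0.
case: (boolP ((0 <= x) && (x < 1))) => [/andP[x0 x1]|xo]; last by rewrite /mid step_out// mulr0.
have [i i_n ix] := cell_ex n0 x0 x1.
rewrite /mid (step_cell _ i_n ix); case: (boolP (_ && _)) => [/andP[i1 i2]|_]; last by rewrite mulr0.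
rewrite mulr1; have k100 : kap <= 1 / 100 by move: kap1; lra.
have nE : n%:R = 64 * (B * w)%:R :> R by rewrite -natrM mulnA.
have Bwp : 0 < (B * w)%:R :> R by rewrite ltr0n muln_gt0 B0.
have xl : 1 / 64 <= x.
  move: ix => /andP[h1 _]; apply: le_trans h1; rewrite nE ler_pdivlMr ?mulr_gt0//.
  have : (B * w)%:R <= i%:R :> R by rewrite ler_nat.
  lra.
have xh : x < 63 / 64.
  move: ix => /andP[_ h2]; apply: lt_le_trans h2 _; rewrite nE ler_pdivrMr ?mulr_gt0//.
  have : i.+1%:R <= 63 * (B * w)%:R :> R by rewrite -natrM ler_nat mulnA.
  lra.
have x12 : -1 <= x <= 2 by apply/andP; split; lra.
have [_ m1 m2] := near1_point k100 hn x12.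
move: m1; rewrite ler_norml => /andP[m3 m4].
have k0 : 0 <= kap by case: hn => /(le_trans (normr_ge0 _)).
rewrite /T one_in; [|move: kap1; lra|move: kap1; lra].
by rewrite mulr1; move: m2; rewrite ler_norml => /andP[m5 _]; lra.
Qed.

Let lower_word P : P \in words S true 2 -> (1 - 6 * kap) * ip f mid <= ip (T (mR R P) f) g.
Proof.
move=> Pw; have -> : ip (T (mR R P) f) g = ip (T (mR R P) f) one.
  by congr integ; apply/funext => x; exact: supported.
have qi : 0 < q%:R^-1 :> R by rewrite invr_gt0 ltr0n.
rewrite -(T_scale _ _ qi); have Pn := Snear Pw; set h := mscale _ _ in Pn *.
have dh : 0 < mdet h.
  by rewrite /h mdetZ mulr_gt0 ?exprn_gt0//; exact: (words_det_gt0 R q0 Sdet Pw).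
have Lone : L2 one by exact: L2_step.
have Lmid : L2 mid by exact: L2_step.
rewrite ip_T_adj// -ipZr//.
apply: int_le; [by apply: L2M => //; exact: L2Z|by apply: L2M => //; exact: L2_Tany|].
move=> x; rewrite ler_wpM2l ?mid_le//; last exact: near1_adj.
by apply: step_ge0 => i; rewrite /c.
Qed.

(** The part outside [mid] consists of [2 B] of the [64 B] blocks, and each contains at most
    [sB / b] points of the set. *)
Let mid_mass : sA / n%:R - beta / 32 <= ip f mid.
Proof.
have -> : sA / n%:R - beta / 32 = n%:R^-1 * (sA - sB / 32) by rewrite /beta; ring.
rewrite ip_step ler_pM2l ?invr_gt0//.
rewrite (sum_blocks (fun i => c i * ((B * w <= i)%N && (i < 63 * B * w)%N)%:R)).
have E p : \sum_(l < w) c (p * w + l)%N * ((B * w <= p * w + l)%N && (p * w + l < 63 * B * w)%N)%:R =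
    block p * ((B <= p)%N && (p < 63 * B)%N)%:R.
  rewrite /block big_distrl/=; apply: eq_bigr => l _; congr (_ * (_ && _)%:R).
    apply/idP/idP => [h|h]; last by rewrite (leq_trans _ (leq_addr _ _))// leq_mul2r h orbT.
    rewrite -ltnS -(ltn_pmul2r w0) (leq_ltn_trans h)// mulSn addnC ltn_add2r//.
  apply/idP/idP => [h|h]; first by rewrite -(ltn_pmul2r w0) (leq_ltn_trans (leq_addr _ _) h).
  by rewrite (leq_trans (_ : _ < p.+1 * w)%N)// ?leq_mul2r ?h ?orbT// mulSn addnC ltn_add2r.
under eq_bigr do rewrite E.
rewrite lerBlDr -lerBlDl sA_blocks -sumrB.
pose F p := block p - block p * ((B <= p)%N && (p < 63 * B)%N)%:R.
rewrite -/(F _) -(big_mkord xpredT F) (@big_cat_nat _ _ _ B 0 b)//=; last by rewrite leq_pmull.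
rewrite (@big_cat_nat _ _ _ (63 * B) B b)//=; [|by rewrite leq_pmull|by rewrite leq_mul2r orbT].
have bl p : (p < b)%N -> F p <= sB / b%:R.
  move=> pb; have bl0 : 0 <= block p by apply: sumr_ge0.
  apply: le_trans (_ : block p <= _); first by rewrite /F gerBl mulr_ge0.
  by rewrite ler_pdivlMr// mulrC block_le.
have BR : B%:R != 0 :> R by rewrite pnatr_eq0 -lt0n.
have h1 : \sum_(0 <= p < B) F p <= sB / 64.
  apply: le_trans (_ : \sum_(0 <= p < B) sB / b%:R <= _).
    rewrite big_nat_cond [leRHS]big_nat_cond; apply: ler_sum => p /andP[/andP[_ pB] _]; apply: bl.
    by rewrite (leq_trans pB)// leq_pmull.
  rewrite sumr_const_nat subn0 -mulr_natr natrM le_eqVlt; apply/orP; left; apply/eqP; field; exact: BR.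
have h2 : \sum_(B <= p < 63 * B) F p = 0.
  rewrite big_nat_cond big1// => p /andP[/andP[p1 p2] _].
  by rewrite /F p1 p2 mulr1 subrr.
have h3 : \sum_(63 * B <= p < b) F p <= sB / 64.
  apply: le_trans (_ : \sum_(63 * B <= p < b) sB / b%:R <= _).
    by rewrite big_nat_cond [leRHS]big_nat_cond; apply: ler_sum => p /andP[/andP[_ pB] _]; exact: bl.
  rewrite sumr_const_nat -mulnBl mul1n -mulr_natr natrM le_eqVlt; apply/orP; left; apply/eqP; field; exact: BR.
by rewrite h2 add0r; move: h1 h3; lra.
Qed.

(** Suppose [beta] exceeds the density [al <= 1/2] by less than the claimed factor. On the unit
    interval [walk 2 f] lives where [g] is 1, so its pairing with [g] is at least about [0.95 al].
    From above, the pairing is at most [5/4 al beta + 0.11 al] and a negligible term, about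
    [0.74 al]: a contradiction. *)
Lemma set_expansion : 2 * sA <= n%:R -> (1 + 1 / (100 * 100)) * sA <= sB.
Proof.
move=> An; have sA0 : 0 <= sA by apply: sumr_ge0.
have [E|sAn] := eqVneq sA 0; first by rewrite E mulr0; apply: sumr_ge0.
have sAp : 0 < sA by rewrite lt_def sAn.
have Lw : L2 (walk S 2 f) by exact: L2_walk.
have LT P : L2 (T (mR R P) f) by exact: L2_Tany.
have LS : L2 (fun x => \sum_(P <- words S true 2) T (mR R P) f x) by exact: L2sum.
have E := walk_words q0 Sdet 2 (proj1 Lf).
have low : (1 - 6 * kap) * ip f mid <= ip (walk S 2 f) g.
  rewrite (ip_eqf Lw (L2Z _ LS) Lg Lg E (eqf_refl _)) ipZl// [ip _ g]ip_suml//.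
  have Kp : 0 < K ^+ 2 by rewrite exprn_gt0// ltr0n.
  rewrite [leRHS]mulrC ler_pdivlMr//.
  have -> : (1 - 6 * kap) * ip f mid * K ^+ 2 = \sum_(P <- words S true 2) (1 - 6 * kap) * ip f mid.
    by rewrite big_const_seq iter_addr_0 count_predT size_words -natrX mulr_natr.
  rewrite big_seq [leRHS]big_seq; apply: ler_sum => P Pw; exact: lower_word.
rewrite leNgt; apply/negP => sBA.
have ap : 0 < sA / n%:R by rewrite divr_gt0.
have a2 : sA / n%:R <= 1 / 2 by rewrite ler_pdivrMr//; lra.
have bb : beta <= (1 + 1 / (100 * 100)) * (sA / n%:R).
  by rewrite /beta mulrA ler_pM2r ?invr_gt0// ltW.
have b0 : 0 <= beta by rewrite divr_ge0//; apply: sumr_ge0.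
have := upper; have := mid_mass; move: low kap1.
set al := sA / n%:R in ap a2 bb *; set be := beta in bb b0 *; set m := ip f mid; set W := ip _ _.
move=> h1 h2 h3 h4; clearbody al be.
have p1 : be * al <= (1 + 1 / (100 * 100)) * al / 2.
  apply: le_trans (_ : (1 + 1 / (100 * 100)) * al * al <= _); first by rewrite ler_wpM2r// ltW.
  rewrite -!mulrA ler_pM2l; last by lra.
  by rewrite ler_pM2l//; lra.
have m0 : 0 <= m by lra.
have p2 : 634 / 640 * m <= (1 - 6 * kap) * m by rewrite ler_wpM2r//; lra.
lra.
Qed.

End set_expansion.

(** * Monotone matchings covering a Moebius map *)

Section mobius_edges.
Context (R : realType).

Lemma mob_mscale (t : R) (g : mat R) x : t != 0 -> mob (mscale t g) x = mob g x.
Proof.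
move=> t0; rewrite /mob /den /mscale /ma /mb /mc /md /=.
by rewrite -!mulrA -!mulrDr invfM mulrACA divff// mul1r.
Qed.

Lemma mob_slope (kap : R) h x y : kap <= 1 / 640 -> near1 kap h -> 0 <= x -> x <= y -> y <= 1 ->
  9 / 10 * (y - x) <= mob h y - mob h x <= 11 / 10 * (y - x).
Proof.
move=> k1 hn x0 xy y1; have k2 : kap <= 1 / 100 by lra.
have := near1_det k2 hn; rewrite ler_norml => /andP[D1 D2]; case: hn => _ _.
rewrite !ler_norml => /andP[c1 c2] /andP[d1 d2].
have dn z : 0 <= z -> z <= 1 -> 99 / 100 <= den h z <= 101 / 100.
  move=> z0 z1; have : -(1 / 640) <= mc h * z <= 1 / 640 by apply/andP; split; nra.
  by rewrite /den => /andP[]; lra.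
have /andP[x2 x3] := dn x x0 (le_trans xy y1); have /andP[y2 y3] := dn y (le_trans x0 xy) y1.
have p1 : 98 / 100 <= den h x * den h y by nra.
have p2 : den h x * den h y <= 102 / 100 + 1 / 1000 by nra.
have -> : mob h y - mob h x = mdet h * (y - x) / (den h x * den h y).
  have [dx dy] : den h x != 0 /\ den h y != 0 by split; rewrite gt_eqF//; move: x2 y2; clear; lra.
  by rewrite /mob; move: dx dy; rewrite /den /mdet => dx dy; field; rewrite dx dy.
have p0 : 0 < den h x * den h y by move: p1; clear; lra.
rewrite ler_pdivlMr// ler_pdivrMr//; have yx : 0 <= y - x by rewrite subr_ge0.
have D3 : 99 / 100 <= mdet h by move: k1 D1; clear; lra.
have D4 : mdet h <= 101 / 100 by move: k1 D2; clear; lra.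
move: (ler_wpM2l yx p1) (ler_wpM2l yx p2) (ler_wpM2l yx D3) (ler_wpM2l yx D4); clear -yx.
by move=> *; apply/andP; split; lra.
Qed.

Variables (n : nat) (kap : R) (h : mat R).
Hypothesis n0 : (0 < n)%N.
Hypothesis kap1 : kap <= 1 / 640.
Hypothesis hn : near1 kap h.

(** The slope lies between [9/10] and [11/10]. Among [j] of one parity [r] the images are therefore
    more than one cell apart and their floors increase strictly; and the image of one cell meets
    only the three cells starting at that floor, indexed by [t]. *)
Definition mob_edge (t r : nat) : rel nat := fun i j =>
  [&& (j < n)%N, (j %% 2 == r)%N & i%:Z == Num.floor (n%:R * mob h (j%:R / n%:R)) + t%:Z].

Let nR : 0 < n%:R :> R. Proof. by rewrite ltr0n. Qed.

Let mob_gap j j' : (j < n)%N -> (j.+2 <= j')%N -> (j' < n)%N ->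
  n%:R * mob h (j%:R / n%:R) + 1 <= n%:R * mob h (j'%:R / n%:R).
Proof.
move=> jn jj jn'.
have /andP[+ _] := @mob_slope kap h (j%:R / n%:R) (j'%:R / n%:R) kap1 hn
  ltac:(by rewrite divr_ge0) ltac:(by rewrite ler_pM2r ?invr_gt0// ler_nat; lia)
  ltac:(by rewrite ler_pdivrMr// mul1r ler_nat; lia).
rewrite -mulrBl mulrA ler_pdivrMr//.
have : (j.+2)%:R <= j'%:R :> R by rewrite ler_nat.
rewrite -addn2 natrD; lra.
Qed.

Lemma mob_edge_strict t r : strict (mob_edge t r).
Proof.
have mono i i' j j' : mob_edge t r i j -> mob_edge t r i' j' -> (j < j')%N -> (i < i')%N.
  move=> /and3P[jn /eqP jr /eqP iE] /and3P[jn' /eqP jr' /eqP iE'] jj.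
  have := @mob_gap j j' jn ltac:(lia) jn'.
  move=> /(le_floor); rewrite floorDrz ?intr_int// floor1.
  move: iE iE'; move: (Num.floor _) (Num.floor _) => z z'; clear; lia.
move=> i i' j j' h1 h2; have [jj|jj|jj] := ltngtP j j'.
- exact: mono h1 h2 jj.
- by apply/negbTE; rewrite -leqNgt ltnW//; exact: mono h2 h1 jj.
- move: h1 h2 => /and3P[_ _ /eqP iE] /and3P[_ _ /eqP iE'].
  by rewrite jj in iE; apply/negbTE; lia.
Qed.

Lemma mob_edge_cover i j x : (j < n)%N -> incell n j x -> incell n i (mob h x) ->
  exists t r, [/\ (t < 3)%N, (r < 2)%N & mob_edge t r i j].
Proof.
move=> jn /andP[x1 x2] /andP[y1 y2].
have /andP[s1 s2] := @mob_slope kap h (j%:R / n%:R) x kap1 hn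
  ltac:(by rewrite divr_ge0) x1
  ltac:(by apply: le_trans (ltW x2) _; rewrite ler_pdivrMr// mul1r ler_nat).
have [y0 y0E] : exists y0, y0 = mob h (j%:R / n%:R) by eexists.
rewrite -y0E in s1 s2; move: (mob h x) y1 y2 s1 s2 => w y1 y2 s1 s2.
have F : Num.floor (n%:R * y0) <= i%:Z <= Num.floor (n%:R * y0) + 2.
  have /andP[f1 f2] := floor_bounds (n%:R * y0).
  move: x1 x2 y1 y2; rewrite !ler_pdivrMr// !ltr_pdivlMr// -!natr1 => x1 x2 y1 y2.
  have xj : x - j%:R / n%:R = (x * n%:R - j%:R) / n%:R by rewrite mulrBl mulfK// gt_eqF.
  move: s1 s2; rewrite xj !mulrA ler_pdivrMr// ler_pdivlMr// => s1 s2.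
  move: f1 f2; move: (Num.floor _) => z f1 f2.
  by apply/andP; split; rewrite -ltzD1 -(ltr_int R) !rmorphD/=; lra.
exists `|i%:Z - Num.floor (n%:R * y0)|%N, (j %% 2)%N; split.
- by move: F; move: (Num.floor _) => z; clear; lia.
- by rewrite ltn_mod.
- by rewrite /mob_edge jn eqxx /= -y0E; move: F; move: (Num.floor _) => z; clear; lia.
Qed.

End mobius_edges.

Lemma prime_above_real (R : realType) (x : R) : exists q, prime q /\ x <= q%:R.
Proof.
have [q qx pq] := prime_above (Num.truncn `|x|).+1.
exists q; split=> //; apply: le_trans (ler_norm _) _.
by rewrite ltW// (lt_le_trans (truncnS_gt _))// ler_nat ltnW.
Qed.

Lemma sqrt_bracket (q : nat) : (0 < q)%N -> exists X, (0 < X)%N /\ (X ^ 2 <= q <= 4 * X ^ 2)%N.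
Proof.
move=> q0; case: (@ex_maxnP (fun X => X ^ 2 <= q)%N q).
- by exists 1%N.
- by move=> i /=; nia.
move=> X Xq Xmax; exists X; have X0 : (0 < X)%N by rewrite Xmax.
split=> //; rewrite Xq /=; have : ~~ (X.+1 ^ 2 <= q)%N.
  by apply/negP => /Xmax; rewrite ltnn.
by rewrite -ltnNge => h; nia.
Qed.

(** * The list of all matchings *)

Section edges.
Context (R : realType).
Variables (q : nat) (S : seq (mat int)) (kap : R) (J : nat).
Hypothesis q0 : (0 < q)%N.
Hypothesis kap1 : kap <= 1 / 640.
Hypothesis Snear : forall P, P \in words S true 2 -> near1 kap (mscale (q%:R)^-1 (mR R P)).
Let b := (64 * q)%N.
Let w := (2 ^ J)%N.
Let n := (b * w)%N.

(** Translations by [-b] to [b - 1] blocks, and six matchings for each word: three offsets and two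
    parities. *)
Definition edge_number : nat := 2 * (64 * q) + 6 * size (words S true 2).

(** A translation by [k - b] blocks is written with [b w] on the other side to avoid truncated
    subtraction. *)
Definition edge (k : nat) : rel nat :=
  if (k < 2 * b)%N then fun i j => (j + b * w == i + k * w)%N
  else let k' := (k - 2 * b)%N in
    mob_edge n (mR R (nth mone (words S true 2) (k' %/ 6))) ((k' %% 6) %/ 2) (k' %% 2).

Let n0 : (0 < n)%N. Proof. by rewrite !muln_gt0 q0 /= expn_gt0. Qed.

Let qR : (q%:R : R)^-1 != 0. Proof. by rewrite invr_eq0 pnatr_eq0 -lt0n. Qed.

Let mob_edgeE P t r : mob_edge n (mscale (q%:R)^-1 (mR R P)) t r = mob_edge n (mR R P) t r.
Proof. by apply/funext => i; apply/funext => j; rewrite /mob_edge mob_mscale. Qed.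

Lemma edge_strict k : (k < edge_number)%N -> strict (edge k).
Proof.
rewrite /edge_number => kd; rewrite /edge; case: ifP => [_|/negbT kb].
  by move=> i j i' j' /eqP h1 /eqP h2; lia.
have Pw : nth mone (words S true 2) ((k - 2 * b) %/ 6) \in words S true 2.
  apply: mem_nth; rewrite ltn_divLR//; move: kd kb; rewrite -/b; move: (size _) => l.
  by clear; lia.
rewrite -mob_edgeE; exact: (mob_edge_strict n0 kap1 (Snear Pw)).
Qed.

Hypothesis expand : forall (a nb : pred nat),
  (forall i p, (i < n)%N -> a i -> (p < b)%N -> nb (p * w + i %% w)%N) ->
  (forall P, P \in words S true 2 -> forall i i' (x : R), (i < n)%N -> (i' < n)%N ->
     incell n i' x -> incell n i (mob (mR R P) x) -> a i -> nb i') ->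
  2 * \sum_(i < n) (a i)%:R <= n%:R :> R ->
  (1 + 1 / (100 * 100)) * \sum_(i < n) (a i)%:R <= \sum_(i < n) (nb i)%:R :> R.

Lemma edges_expand (a : pred nat) : (2 * cnt n a <= n)%N ->
  (1 + 1 / (100 * 100)) * (cnt n a)%:R <= (cnt n (img n (union_rel edge_number edge) a))%:R :> R.
Proof.
move=> an; rewrite /cnt !natr_sum; apply: expand.
- move=> i p i_n ai pb; apply/imgP; exists i; split=> //; apply/hasP.
  have w0 : (0 < w)%N by rewrite expn_gt0.
  have iw : (i %/ w < b)%N by rewrite ltn_divLR.
  exists (p + b - i %/ w)%N; first by
    rewrite mem_iota /edge_number /= -/b; move: (i %/ w)%N iw pb => k kb pb; clear -kb pb; lia.
  rewrite /edge ifT; last by move: (i %/ w)%N iw pb => k kb pb; clear -kb pb; lia.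
  apply/eqP; rewrite {2}(divn_eq i w) mulnBl mulnDl.
  have : (i %/ w * w <= b * w)%N by rewrite leq_mul2r ltnW ?orbT.
  lia.
- move=> P Pw i i' x i_n i'n ix iy ai; apply/imgP; exists i; split=> //; apply/hasP.
  rewrite -(mob_mscale _ _ qR) in iy.
  have [t [r [t3 r2 h]]] := mob_edge_cover n0 kap1 (Snear Pw) i'n ix iy.
  rewrite mob_edgeE in h.
  have Pi : (index P (words S true 2) < size (words S true 2))%N by rewrite index_mem.
  exists (2 * b + (6 * index P (words S true 2) + (2 * t + r)))%N.
    rewrite mem_iota /edge_number /= -/b; move: (index _ _) (size _) Pi => u v Pi.
    by clear -Pi t3 r2; lia.
  rewrite /edge ifF; last by apply/negbTE; rewrite -leqNgt leq_addr.
  rewrite addKn mulnC divnMDl// [X in (_ + X)%N]divn_small; last by clear -t3 r2; lia.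
  rewrite addn0 nth_index// modnMDl [((2 * t + r) %% 6)%N]modn_small; last by clear -t3 r2; lia.
  rewrite mulnC divnMDl// (divn_small r2) addn0.
  have -> : ((index P (words S true 2) * 6 + (t * 2 + r)) %% 2 = r)%N.
    by move: (index _ _) => u; clear -r2; lia.
  exact: h.
- by rewrite -natr_sum -natrM ler_nat.
Qed.

End edges.

(** [D] is chosen so that [66 / D = 1 / 640]. [C] comes from [q <= 4 X^2] and
    [3 X^2 <= 56 (33 D + 1)^4 |S|], as [4 * 56 / 3 < 75]. The exponent 256 matches
    [q^(4k) <= v^256]. None of these, nor [A] and [rho], depends on [q], which is chosen last. *)
Lemma expanding_parameters (R : realType) : exists (q : nat) (S : seq (mat int)) (kap : R),
  [/\ (0 < q)%N, kap <= 1 / 640,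
    forall P, P \in words S true 2 -> near1 kap (mscale (q%:R)^-1 (mR R P)) &
    forall (J : nat) (a nb : pred nat), let b := (64 * q)%N in let w := (2 ^ J)%N in let n := (b * w)%N in
    (forall i p, (i < n)%N -> a i -> (p < b)%N -> nb (p * w + i %% w)%N) ->
    (forall P, P \in words S true 2 -> forall i i' (x : R), (i < n)%N -> (i' < n)%N ->
     incell n i' x -> incell n i (mob (mR R P) x) -> a i -> nb i') ->
    2 * \sum_(i < n) (a i)%:R <= n%:R :> R ->
    (1 + 1 / (100 * 100)) * \sum_(i < n) (a i)%:R <= \sum_(i < n) (nb i)%:R :> R].
Proof.
have [D DE] : exists D, D = (66 * 640)%N by eexists.
have [C CE] : exists C, C = (75 * (33 * D).+1 ^ 4)%N by eexists.
have [Ct CtP] := @divisors_bound 256 isT.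
have Ct0 : (0 < Ct)%N by have := CtP 1%N isT; case: Ct {CtP}.
have [A AP] : exists A : R, 128 * 1000 + 480 * 1000 * (16 * 328) <= A by eexists.
have [rho [rho0 rho1]] : exists rho : R, 0 < rho /\ rho <= 1 / (100 * 100).
  by exists (1 / (100 * 100)); split=> //; lra.
have [q [q_prime]] := prime_above_real (200 + `|gap_const C Ct A ^+ 64| + `|rho ^- 64|).
move=> qbig.
have gq : gap_const C Ct A ^+ 64 <= q%:R.
  have := ler_norm (gap_const C Ct A ^+ 64); have := normr_ge0 (rho ^- 64); lra.
have rq : 1 <= rho ^+ 64 * q%:R.
  rewrite mulrC -ler_pdivrMr ?exprn_gt0// mul1r.
  have := ler_norm (rho ^- 64); have := normr_ge0 (gap_const C Ct A ^+ 64); lra.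
have q200 : (200 <= q)%N.
  rewrite -(ler_nat R); have := normr_ge0 (rho ^- 64); have := normr_ge0 (gap_const C Ct A ^+ 64); lra.
have q0 : (0 < q)%N by exact: prime_gt0.
have [X [X0 Xq]] := sqrt_bracket q0.
have D0 : (0 < D)%N by rewrite DE.
have [S [SU Scard Ssize Sclose]] := generators_exist D0 X0 Xq.
have /andP[Xq1 Xq2] := Xq.
have SC : (q <= C * size S)%N.
  rewrite CE; move: Scard Xq2; move: ((33 * D).+1 ^ 4)%N => c; rewrite -mulnA.
  by move: (c * size S)%N (X ^ 2)%N => u v; clear; lia.
have S0 : (0 < size S)%N by rewrite lt0n; apply: contraTneq SC => ->; rewrite muln0 -ltnNge.
have sz g : g \in S -> sized q X g.
  by move=> /Ssize[dg /andP[? ?] /andP[? ?] /andP[? ?] /andP[? ?]]; split=> //; rewrite ger0_norm.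
have D132 : (132 <= D)%N by rewrite DE.
have kap1 : 66 / D%:R <= 1 / 640 :> R by rewrite DE natrM; lra.
have Snear P : P \in words S true 2 -> near1 (66 / D%:R : R) (mscale (q%:R)^-1 (mR R P)).
  by move=> Pw; exact: (words_near R q_prime X0 Xq1 D132 sz Sclose Pw).
exists q, S, (66 / D%:R); split=> // J a nb b w n h1 h2 h3.
have Sdet g : g \in S -> mdet g = q%:Z by move=> /sz[].
have qb : (q <= 2 * (64 * q))%N by clear; lia.
exact: (set_expansion q200 S0 Sdet kap1 Snear rho0 rho1 rq
  (spectral_gap q_prime X0 Xq1 D132 SU S0 sz Sclose SC Ct0 CtP AP gq) q0 qb h1 h2 h3).
Qed.

Theorem theorem2 (R : realType) :
  exists eps : R, 0 < eps /\ eps <= 1 /\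
    forall N : nat, exists (n m : nat) (G : bigraph n m),
      (N <= n + m)%N /\ bip_expander eps G /\ d_monotone 3 G.
Proof.
have [q [S [kap [q0 kap1 Snear expand]]]] := expanding_parameters R.
pose d := edge_number q S.
(* Taking [2 d] blocks leaves room for the two identity blocks at the ends. *)
have dm : (d + 2 <= 2 * d)%N by rewrite /d /edge_number; lia.
have s0 : 1 <= (2 * d)%:R :> R by rewrite ler1n; lia.
have e0 : 0 < 1 / (100 * 100) :> R by lra.
have e1 : 1 / (100 * 100) <= 1 :> R by lra.
have s3 : 1 <= (2 * d)%:R ^+ 3 :> R by rewrite exprn_ege1.
exists (1 / (100 * 100) / (9 * (2 * d)%:R ^+ 3)); split; [|split].
- by rewrite divr_gt0//; lra.
- by rewrite ler_pdivrMr; lra.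
move=> N; pose n := (64 * q * 2 ^ N)%N.
have n0 : (0 < n)%N by rewrite !muln_gt0 q0 expn_gt0.
have [G [GE G3]] := @block_expander R _ n d d _ n0 dm (@edge_strict R q S kap N q0 kap1 Snear) e0 e1
  (@edges_expand R q S kap N q0 kap1 Snear (expand N)).
exists (2 * d * n)%N, (2 * d * n)%N, G; split=> //.
have : (N < 2 ^ N)%N by exact: ltn_expl.
rewrite /n; move: (2 ^ N)%N => u Nu.
have d1 : (0 < d)%N by lia.
rewrite (leq_trans (ltnW Nu))// (leq_trans _ (leq_addr _ _))//.
by rewrite mulnA leq_pmull// !muln_gt0 d1.
Qed.
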